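(* Let $\Theta_1,\dots,\Theta_{10}$ and $\widetilde\Theta$ be the theta functions on $\mathbb{H}_2$ defined in the context, and consider the following (overdetermined, algebraic) system of ten equations for $z_1,z_2,z_3,z_4$ and $\omega_0$ (the master equation around the boundary point $o_1$): $$P_0\omega_0^2=\Theta_8^2,\quad P_1\omega_0^2=\Theta_1^2,\quad P_2\omega_0^2=-\Theta_9^2,\quad P_3\omega_0^2=-\Theta_7^2,\quad P_4\omega_0^2=\Theta_2^2,$$ $$P_6\omega_0^2=-\Theta_{10}^2,\quad P_7\omega_0^2=\Theta_3^2,\quad P_8\omega_0^2=\Theta_5^2,\quad P_9\omega_0^2=-\Theta_4^2,\quad P_{10}\omega_0^2=\Theta_6^2,$$ where $P_s=P_s(z_1,z_2,z_3,z_4)$ are the polynomials listed in the context. This master equation has a (unique) solution, $$z_1=\frac{\Theta_3^2+\Theta_9^2-\omega_0^2}{\omega_0^2-\Theta_7^2},\quad z_2=\frac{\Theta_3^2+\Theta_9^2-\omega_0^2}{\omega_0^2-\Theta_9^2},\quad z_3=\frac{(\omega_0^2-\Theta_7^2)(\omega_0^2-\Theta_9^2)}{\omega_0^2(\Theta_4^2+\Theta_9^2-\omega_0^2)},\quad z_4=\frac{\Theta_4^2+\Theta_9^2-\omega_0^2}{\Theta_3^2+\Theta_9^2-\omega_0^2},$$ $$\omega_0^2=\frac{1}{2\Theta_8^2}\left\{\Theta_7^2\Theta_8^2-\Theta_{10}^2\Theta_5^2+\Theta_6^2\Theta_9^2-\widetilde\Theta\right\}.$$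
   Context: Domain: $\mathbb{H}_2=\{W\in \mathrm{Mat}(2,\mathbb{C}) : (W-W^\dagger)/2i>0\}$, $W^\dagger={}^t\overline W$, $W=\begin{pmatrix}w_{11}&w_{12}\\ w_{21}&w_{22}\end{pmatrix}$. Theta functions: for $a,b\in\frac{1+i}{2}\mathbb{Z}^2$, $$\Theta\begin{bmatrix}a\\ b\end{bmatrix}(W)=\sum_{n\in\mathbb{Z}[i]^2}\exp\Big(\pi i\big({}^t\overline{(n+a)}\,W(n+a)+2\,\mathrm{Re}({}^t\overline b\,n)\big)\Big).$$ With $a=\frac{1+i}{2}\,{}^t(s_1,s_2)$, $b=\frac{1+i}{2}\,{}^t(s_3,s_4)$, the functions $\Theta_1,\dots,\Theta_{10}$ correspond respectively to $(s_1s_2s_3s_4)=1111,\ 1100,\ 1000,\ 1001,\ 0100,\ 0000,\ 0001,\ 0011,\ 0010,\ 0110$. $q$-variables: $q_1=e^{\pi i w_{11}}$, $q_2=e^{\pi i w_{22}}$, $q_3=\exp\big(\pi i\frac{w_{12}-iw_{21}}{1-i}\big)$, $q_4=\exp\big(\pi i\frac{w_{12}+iw_{21}}{1+i}\big)$ (so $q_3q_4=e^{\pi i(w_{12}+w_{21})}$, $q_3/q_4=e^{-\pi(w_{12}-w_{21})}$). $\widetilde\Theta$ is the weight four modular form with $\widetilde\Theta^2=\frac1{12}\big\{\big(\sum_{k=1}^{10}\Theta_k^4\big)^2-4\sum_{k=1}^{10}\Theta_k^8\big\}$ and $\widetilde\Theta=-64(q_3-q_4)\big\{\frac{q_1q_2(1-q_3q_4)}{q_3q_4}+\cdots\big\}$.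 Polynomials: $P_0=1-(z_1z_2+z_1z_3+z_2z_3+z_1z_2z_3)z_4-z_1z_2z_3z_4^2$, $P_1=-z_1z_2(1+z_3)z_4$, $P_2=-1+z_1z_3z_4$, $P_3=-1+z_2z_3z_4$, $P_4=-z_1z_2(1+z_3z_4)z_4$, $P_6=-(1+z_1z_4)z_2z_3z_4$, $P_7=z_1(1+z_2)z_3z_4$, $P_8=(1+z_1)z_2z_3z_4$, $P_9=-z_1z_3z_4(1+z_2z_4)$, $P_{10}=1-z_1z_2z_4$. Background: the master equation comes from the family of K3 surfaces that are double covers of $\mathbb{P}^2$ branched along six lines; $z_k$ are local coordinates at a boundary point $o_1$ of a resolution of its moduli space.
   Formalization: Literal uniqueness fails: ω0→−ω0, and replacing Θ̃ by −Θ̃ (W→ᵗW), give other solutions. Proved: the formulas solve where denominators are nonzero; if Θ8, all z_k, ω0 are nonzero, any solution is the formula with ±Θ̃; near o1 it is the only one with small z_k (ω0 up to sign). *)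

(* Defs.v *)
From HB Require Import structures.
From mathcomp Require Import all_boot all_order all_algebra.
From mathcomp Require Import complex.
From mathcomp Require Import all_classical all_reals all_analysis.
From mathcomp Require summability.

Set Implicit Arguments.
Unset Strict Implicit.
Unset Printing Implicit Defensive.

Import Order.TTheory GRing.Theory Num.Theory.
Import numFieldNormedType.Exports.

Local Open Scope classical_set_scope.
Local Open Scope ring_scope.

(* The ascription makes the topology and norm that exist on every
   numClosedFieldType available on R[i]; the norm takes values in C R, where
   x < y means that y - x is a positive real. *)
Definition C (R : realType) : numClosedFieldType := R[i].

Section ThetaFunctions.
Variable R : realType.
Local Notation C := (C R).

Definition cexp (z : C) : C :=
  (expR (complex.Re z))%:C%C
  * (cos (complex.Im z) +i* sin (complex.Im z))%C.

Definition cpi : C := (pi : R)%:C%C.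

Definition adj m n (M : 'M[C]_(m, n)) : 'M[C]_(n, m) := map_mx Num.conj M^T.

Definition posdef (M : 'M[C]_2) : Prop :=
  forall v : 'cV[C]_2, v != 0 -> 0 < (adj v *m M *m v) 0 0.

Definition H2 : set 'M[C]_2 :=
  [set W | posdef ((2 * 'i)^-1 *: (W - adj W))].

Definition w11 (W : 'M[C]_2) : C := W 0 0.
Definition w12 (W : 'M[C]_2) : C := W 0 1.
Definition w21 (W : 'M[C]_2) : C := W 1 0.
Definition w22 (W : 'M[C]_2) : C := W 1 1.

(* Z[i]^2 is indexed by pairs (x, y) of integer vectors, standing for x + i y. *)
Definition gaussvec (n : 'cV[int]_2 * 'cV[int]_2) : 'cV[C]_2 :=
  map_mx intr n.1 + 'i *: map_mx intr n.2.

Definition theta_term (a b : 'cV[C]_2) (W : 'M[C]_2) (n : 'cV[C]_2) : C :=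
  cexp (cpi * 'i * ((adj (n + a) *m W *m (n + a)) 0 0
                    + 2 * 'Re ((adj b *m n) 0 0))).

(* summability.sum is the unordered sum, i.e. the limit of the finite partial
   sums along the directed set of finite subsets of the index type. *)
Definition theta (a b : 'cV[C]_2) (W : 'M[C]_2) : C :=
  summability.sum (fun n => theta_term a b W (gaussvec n)).

Definition half_char (s t : nat) : 'cV[C]_2 :=
  ((1 + 'i) / 2) *: \col_(j < 2) (nth 0%N [:: s; t] j)%:R.

Definition characteristic (k : nat) : nat * nat * nat * nat :=
  match k with
  | 1 => (1, 1, 1, 1)
  | 2 => (1, 1, 0, 0)
  | 3 => (1, 0, 0, 0)
  | 4 => (1, 0, 0, 1)
  | 5 => (0, 1, 0, 0)
  | 6 => (0, 0, 0, 0)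
  | 7 => (0, 0, 0, 1)
  | 8 => (0, 0, 1, 1)
  | 9 => (0, 0, 1, 0)
  | 10 => (0, 1, 1, 0)
  | _ => (0, 0, 0, 0) (* unused: only 1 <= k <= 10 occurs *)
  end%N.

Definition Theta (k : nat) : 'M[C]_2 -> C :=
  let: (s1, s2, s3, s4) := characteristic k in
  theta (half_char s1 s2) (half_char s3 s4).

Definition q1 (W : 'M[C]_2) : C := cexp (cpi * 'i * w11 W).
Definition q2 (W : 'M[C]_2) : C := cexp (cpi * 'i * w22 W).
Definition q3 (W : 'M[C]_2) : C :=
  cexp (cpi * 'i * ((w12 W - 'i * w21 W) / (1 - 'i))).
Definition q4 (W : 'M[C]_2) : C :=
  cexp (cpi * 'i * ((w12 W + 'i * w21 W) / (1 + 'i))).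

(* U(2,2) over the Gaussian integers *)
Definition J4 : 'M[C]_(2 + 2) := block_mx 0 1%:M (- 1%:M) 0.

Definition modular_group : set 'M[C]_(2 + 2) :=
  [set g : 'M[C]_(2 + 2) |
     (forall i j, exists m n : int, g i j = m%:~R + 'i * n%:~R)
     /\ g *m J4 *m adj g = J4].

Definition cocycle (g : 'M[C]_(2 + 2)) (W : 'M[C]_2) : 'M[C]_2 :=
  dlsubmx g *m W + drsubmx g.

Definition moebius (g : 'M[C]_(2 + 2)) (W : 'M[C]_2) : 'M[C]_2 :=
  (ulsubmx g *m W + ursubmx g) *m invmx (cocycle g W).

(* A multiplier of absolute value 1 is allowed, as usual for theta constants. *)
Definition modular_weight (k : nat) (f : 'M[C]_2 -> C) : Prop :=
  forall g, modular_group g -> exists c : C,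
    `|c| = 1 /\
    forall W, H2 W -> f (moebius g W) = c * \det (cocycle g W) ^+ k * f W.

(* The first three clauses determine the function up to sign.  In its Fourier
   expansion the only terms linear in both q1 and q2 are those displayed in
     -64 (q3 - q4) { q1 q2 (1 - q3 q4) / (q3 q4) + ... },
   so the last clause, which fixes the sign, is the limit of T W / (q1 q2) when
   w11 and w22 tend to i oo with w12 and w21 (hence q3 and q4) fixed. *)
Definition is_tTheta (T : 'M[C]_2 -> C) : Prop :=
  [/\ forall W, H2 W -> differentiable T W,
      modular_weight 4 T,
      forall W, H2 W -> T W ^+ 2 =
        12^-1 * ((\sum_(1 <= k < 11) Theta k W ^+ 4) ^+ 2
                 - 4 * \sum_(1 <= k < 11) Theta k W ^+ 8)
    & forall (u v eps : C), 0 < eps -> exists M : R,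
        forall W, H2 W -> w12 W = u -> w21 W = v ->
          M < complex.Im (w11 W) -> M < complex.Im (w22 W) ->
          `| T W / (q1 W * q2 W)
             - - 64 * (q3 W - q4 W) * ((1 - q3 W * q4 W) / (q3 W * q4 W)) |
          < eps].

End ThetaFunctions.

Section MasterEquation.
Variable R : realType.
Local Notation C := (C R).

Definition P0 (z1 z2 z3 z4 : C) : C :=
  1 - (z1 * z2 + z1 * z3 + z2 * z3 + z1 * z2 * z3) * z4
    - z1 * z2 * z3 * z4 ^+ 2.
Definition P1 (z1 z2 z3 z4 : C) : C :=
  - z1 * z2 * (1 + z3) * z4.
Definition P2 (z1 z2 z3 z4 : C) : C :=
  - 1 + z1 * z3 * z4.
Definition P3 (z1 z2 z3 z4 : C) : C :=
  - 1 + z2 * z3 * z4.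
Definition P4 (z1 z2 z3 z4 : C) : C :=
  - z1 * z2 * (1 + z3 * z4) * z4.
Definition P6 (z1 z2 z3 z4 : C) : C :=
  - (1 + z1 * z4) * z2 * z3 * z4.
Definition P7 (z1 z2 z3 z4 : C) : C :=
  z1 * (1 + z2) * z3 * z4.
Definition P8 (z1 z2 z3 z4 : C) : C :=
  (1 + z1) * z2 * z3 * z4.
Definition P9 (z1 z2 z3 z4 : C) : C :=
  - z1 * z3 * z4 * (1 + z2 * z4).
Definition P10 (z1 z2 z3 z4 : C) : C :=
  1 - z1 * z2 * z4.

Definition master_equation (W : 'M[C]_2) (z1 z2 z3 z4 omega0 : C) : Prop :=
  let eqn (P : C -> C -> C -> C -> C) (rhs : C) :=
    P z1 z2 z3 z4 * omega0 ^+ 2 = rhs in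
  [/\ [/\ eqn P0 (Theta 8 W ^+ 2), eqn P1 (Theta 1 W ^+ 2),
          eqn P2 (- Theta 9 W ^+ 2), eqn P3 (- Theta 7 W ^+ 2)
        & eqn P4 (Theta 2 W ^+ 2)]
    & [/\ eqn P6 (- Theta 10 W ^+ 2), eqn P7 (Theta 3 W ^+ 2),
          eqn P8 (Theta 5 W ^+ 2), eqn P9 (- Theta 4 W ^+ 2)
        & eqn P10 (Theta 6 W ^+ 2)]].

(* The right-hand sides of the solution; w stands for omega0 ^+ 2 and t for the
   value at W of the weight four form. *)
Definition sol_omega0_sq (W : 'M[C]_2) (t : C) : C :=
  (2 * Theta 8 W ^+ 2)^-1
  * (Theta 7 W ^+ 2 * Theta 8 W ^+ 2 - Theta 10 W ^+ 2 * Theta 5 W ^+ 2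
     + Theta 6 W ^+ 2 * Theta 9 W ^+ 2 - t).

Section Solution.
Variables (W : 'M[C]_2) (w : C).

Definition sol_z1 : C :=
  (Theta 3 W ^+ 2 + Theta 9 W ^+ 2 - w) / (w - Theta 7 W ^+ 2).
Definition sol_z2 : C :=
  (Theta 3 W ^+ 2 + Theta 9 W ^+ 2 - w) / (w - Theta 9 W ^+ 2).
Definition sol_z3 : C :=
  ((w - Theta 7 W ^+ 2) * (w - Theta 9 W ^+ 2))
  / (w * (Theta 4 W ^+ 2 + Theta 9 W ^+ 2 - w)).
Definition sol_z4 : C :=
  (Theta 4 W ^+ 2 + Theta 9 W ^+ 2 - w) / (Theta 3 W ^+ 2 + Theta 9 W ^+ 2 - w).

Definition is_solution_formula (z1 z2 z3 z4 : C) : Prop :=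
  [/\ z1 = sol_z1, z2 = sol_z2, z3 = sol_z3 & z4 = sol_z4].

Definition denominators_neq0 : Prop :=
  [/\ [/\ Theta 8 W != 0, w != 0 & w - Theta 7 W ^+ 2 != 0],
      w - Theta 9 W ^+ 2 != 0,
      Theta 4 W ^+ 2 + Theta 9 W ^+ 2 - w != 0
    & Theta 3 W ^+ 2 + Theta 9 W ^+ 2 - w != 0].

End Solution.

(* The point o1 is the origin of the coordinates z1, z2, z3, z4.  The solution
   is z1 ~ 4 q1/q3, z2 ~ 4 q2/q3, z3 ~ - 4 q4, z4 ~ - q3/q4, so that W
   approaches o1 when these four monomials tend to 0.  Transposition of W fixes
   all Theta k W ^+ 2, exchanges q3 and q4 and changes the sign of the weight
   four form; it turns the solution into a second solution of the same
   equations, for which z4 ~ - q4/q3 is unbounded near o1. *)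
Definition near_o1 (d : C) (W : 'M[C]_2) : Prop :=
  [/\ `|q1 W / q3 W| < d, `|q2 W / q3 W| < d, `|q4 W| < d
    & `|q3 W / q4 W| < d].

Definition small (e z1 z2 z3 z4 : C) : Prop :=
  [/\ `|z1| < e, `|z2| < e, `|z3| < e & `|z4| < e].

End MasterEquation.

(* Main.v *)
(* Put t_k = Theta_k ^ 2.  The unitary substitution u = (n + m) / (1 + i),
   v = (n - m) / (1 + i) in the double series for t_k expresses each t_k by the
   others (Riemann's relation), and these relations make the t_k depend linearly
   on five of them.  On the resulting space the square of the weight four form
   is the discriminant of a quadratic equation for omega0 ^ 2, and both the
   formulas and their uniqueness up to the sign of the form are polynomial
   identities.

   Near o1 every term of a theta series is a monomial with nonnegative exponents
   in x1 = q1 / q3, x2 = q2 / q3, x3 = q4, x4 = q3 / q4, so leading terms are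
   read off uniformly.  With S = t_2 t_6 - t_1 t_8 - t_3 t_5 one has
   T ^ 2 = S ^ 2 - 4 t_1 t_3 t_5 t_8 and S ~ 64 x1 x2 x3 x4, hence
   T ~ +- 64 x1 x2 x3 x4; the sign cannot change along W + i s, s >= 0, and its
   value for large s is given by the Fourier expansion.  Finally
   2 t_8 (t_3 + t_9 - omega0 ^ 2) = S + T, which does not vanish, yields the size
   of z1, ..., z4, while small z force T ~ S and so exclude the root - T. *)
Require Import Defs.
From HB Require Import structures.
From mathcomp Require Import all_boot all_order all_algebra.
From mathcomp Require Import finmap complex.
From mathcomp Require Import all_classical all_reals all_analysis.
From mathcomp Require summability.
From mathcomp Require Import ring lra zify.

Import Order.TTheory GRing.Theory Num.Theory.
Import numFieldNormedType.Exports.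

Local Open Scope ring_scope.

(** * Unordered sums of complex families *)

(** The estimate of [S] is a second-order matter: [t_1] and [t_2] share the leading term
    [16 x1 x2 x4], while [t_6] and [t_8] both tend to 1, so the leading parts of [t_2 t_6] and
    [t_1 t_8] cancel. The half-differences of [Theta 6], [Theta 8] and of [Theta 2], [Theta 1] are
    therefore treated as series of their own, over the indices with odd coordinate sum; each of
    their terms carries an additional factor [x3]. The differences in the solution formulas suffer
    from the same cancellation and are never estimated by subtracting expansions. With
    [D = t_3 + t_9 - omega0 ^ 2], the linear relations turn [omega0 ^ 2 - t_k] for k = 7, 9, 6 into
    [t_5 - D], [t_3 - D], [- (t_1 + D)], and a cubic identity in [omega0 ^ 2] then yields
    [t_4 + t_9 - omega0 ^ 2] as a quotient. The constant 8192 is 32 times 4^4: the first factor is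
    lost in the comparison with a geometric series of ratio 1/2, the second bounds the sum of that
    series over Z^4. *)

Section ComplexNorm.
Context {R : realType}.

(** The modulus with values in the ordered field [R], so that estimates become real inequalities
    instead of the complex-valued ones of the norm on [C R]. *)
Definition nm (x : C R) : R := Normc.normc x.

Lemma nmE (x : C R) : `|x| = (nm x)%:C%C. Proof. by case: x => a b; exact: normc_def. Qed.

Lemma nm0 : nm 0 = 0. Proof. exact: Normc.normc0. Qed.

Lemma nm1 : nm 1 = 1. Proof. exact: Normc.normc1. Qed.

Lemma nmM x y : nm (x * y) = nm x * nm y. Proof. exact: Normc.normcM. Qed.

Lemma nmX x k : nm (x ^+ k) = nm x ^+ k.
Proof. by elim: k => [|k IHk]; rewrite ?expr0 ?nm1 // !exprS nmM IHk. Qed.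

Lemma nmD x y : nm (x + y) <= nm x + nm y. Proof. exact: le_normcD. Qed.

Lemma nmN x : nm (- x) = nm x. Proof. exact: normcN. Qed.

Lemma nmB x y : nm (x - y) <= nm x + nm y.
Proof. by rewrite -(nmN y); exact: nmD. Qed.

Lemma nm_distC x y : nm (x - y) = nm (y - x). Proof. by rewrite -nmN opprB. Qed.

Lemma nmBD x y : nm x - nm y <= nm (x + y).
Proof. by have := nmB (x + y) y; rewrite addrK lerBlDr. Qed.

Lemma nm_ge0 x : 0 <= nm x.
Proof. by rewrite -lecR -nmE; exact: normr_ge0. Qed.

Lemma nm_eq0 x : (nm x == 0) = (x == 0).
Proof.
apply/eqP/eqP => [|->]; last exact: nm0.
exact: Normc.eq0_normc.
Qed.

Lemma nm_gt0 x : (0 < nm x) = (x != 0).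
Proof. by rewrite lt_neqAle nm_ge0 andbT eq_sym nm_eq0. Qed.

Lemma nmV x : nm x^-1 = (nm x)^-1. Proof. exact: Normc.normcV. Qed.

Lemma nm_real (x : R) : nm x%:C%C = `|x|.
Proof. by rewrite /nm /= expr0n addr0 sqrtr_sqr. Qed.

Lemma nm_nat k : nm k%:R = k%:R.
Proof.
by rewrite -[RHS]ger0_norm ?ler0n // -nm_real rmorph_nat.
Qed.

Lemma nm_i : nm 'i = 1.
Proof.
by rewrite -[LHS]/(Num.sqrt (0 ^+ 2 + 1 ^+ 2)) expr0n expr1n add0r sqrtr1.
Qed.

Lemma nm_Re (x : C R) : `|complex.Re x| <= nm x.
Proof.
have : (`|complex.Re x|%:C%C : C R) <= `|x : C R| := normc_ge_Re x.
by rewrite nmE lecR.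
Qed.

Lemma nm_Im (x : C R) : `|complex.Im x| <= nm x.
Proof.
have -> : complex.Im x = - complex.Re (x * 'i).
  by case: x => a b /=; ring.
by rewrite normrN (le_trans (nm_Re _)) // nmM nm_i mulr1.
Qed.

Lemma nm_sum (I : Type) (s : seq I) (P : pred I) (f : I -> C R) :
  nm (\sum_(i <- s | P i) f i) <= \sum_(i <- s | P i) nm (f i).
Proof.
elim/big_ind2 : _ => [|x a y b xa yb|//]; first by rewrite nm0.
by rewrite (le_trans (nmD _ _)) // lerD.
Qed.

Lemma lt_nm (x : C R) (e : R) : (`|x| < e%:C%C :> C R) = (nm x < e).
Proof. by rewrite nmE ltcR. Qed.

Lemma gt0_C (e : C R) : 0 < e -> e = (complex.Re e)%:C%C /\ 0 < complex.Re e.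
Proof.
case: e => a b; rewrite ltcE /= => /andP[/eqP b0 a0]; split => //.
by rewrite b0.
Qed.

End ComplexNorm.

(** * Unordered summation: comparison, reindexing and products *)

Section UnorderedSums.
Context {R : realType}.

(** The epsilon form of convergence along finite subsets. Unlike an equation for [summability.sum],
    it also asserts that the limit exists. *)
Definition has_sum {I : choiceType} (f : I -> C R) (l : C R) :=
  forall e : R, 0 < e -> exists A : {fset I}, forall B : {fset I},
    (A `<=` B)%fset -> nm (\sum_(i <- B) f i - l) < e.

(** For nonnegative [g] this is summability with an explicit bound; it serves as the majorant in all
    comparison arguments. *)
Definition sums_le {I : choiceType} (g : I -> R) (M : R) :=
  forall A : {fset I}, \sum_(i <- A) g i <= M.

Lemma has_sum_sum (I : choiceType) (f : I -> C R) l :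
  has_sum f l -> summability.sum f = l.
Proof.
move=> fl; have PF := @summability.totally_filter I.
apply: cvg_lim; first exact: norm_hausdorff.
have FF : Filter (@summability.totally I) by exact: filter_filter.
apply: (proj2 (@cvgrPdist_lt _ (C R) _ _ FF (summability.partial_sum f) l)).
move=> e /gt0_C [-> e0].
have [A HA] := fl _ e0; exists A => // B AB.
rewrite lt_nm nm_distC /summability.partial_sum.
rewrite -(big_seq_fsetE _ _ predT f) /=; exact: HA.
Qed.

Lemma has_sum_unique (I : choiceType) (f : I -> C R) l l' :
  has_sum f l -> has_sum f l' -> l = l'.
Proof. by move=> /has_sum_sum <- /has_sum_sum <-. Qed.

Lemma eq_has_sum (I : choiceType) (f g : I -> C R) l :
  f =1 g -> has_sum f l -> has_sum g l.
Proof.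
move=> fg fl e /fl[A HA]; exists A => B /HA.
by under eq_bigr do rewrite fg.
Qed.

Lemma has_sumD (I : choiceType) (f g : I -> C R) l m :
  has_sum f l -> has_sum g m -> has_sum (fun i => f i + g i) (l + m).
Proof.
move=> fl gm e e0; have e20 : 0 < e / 2 by lra.
have [A HA] := fl _ e20; have [A' HA'] := gm _ e20.
exists (A `|` A')%fset => B; rewrite fsubUset => /andP[/HA h /HA' h'].
rewrite big_split /= opprD addrACA.
by apply: le_lt_trans (nmD _ _) _; lra.
Qed.

Lemma has_sumZ (I : choiceType) (f : I -> C R) l c :
  has_sum f l -> has_sum (fun i => c * f i) (c * l).
Proof.
move=> fl e e0; have c0 : 0 < nm c + 1 by have := nm_ge0 c; lra.
have [A HA] := fl _ (divr_gt0 e0 c0); exists A => B /HA.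
rewrite ltr_pdivlMr // -mulr_sumr -mulrBr nmM.
by have := nm_ge0 (\sum_(i <- B) f i - l); nra.
Qed.

Lemma has_sum_bigsum (I : choiceType) (J : Type) (s : seq J)
    (f : J -> I -> C R) (l : J -> C R) :
  (forall j, has_sum (f j) (l j)) ->
  has_sum (fun i => \sum_(j <- s) f j i) (\sum_(j <- s) l j).
Proof.
move=> fl; elim: s => [|j s IHs].
  rewrite big_nil => e e0; exists fset0 => B _.
  by rewrite big1 ?subr0 ?nm0 // => i _; rewrite big_nil.
rewrite big_cons; apply: eq_has_sum (has_sumD _ _ _ _ _ (fl j) IHs) => i /=.
by rewrite big_cons.
Qed.

Lemma has_sum_le (I : choiceType) (f : I -> C R) (g : I -> R) l M :
  has_sum f l -> (forall i, nm (f i) <= g i) -> sums_le g M -> nm l <= M.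
Proof.
move=> fl fg gM; apply/ler_addgt0Pr => e /fl[A /(_ A (fsubset_refl _))].
have : nm (\sum_(i <- A) f i) <= M.
  by apply: le_trans (gM A); apply: le_trans (nm_sum _ _ _ _) (ler_sum _ _).
have := nmBD l (\sum_(i <- A) f i - l).
by rewrite subrKC; lra.
Qed.

Lemma has_sum_fset (I : choiceType) (A : {fset I}) (f : I -> C R) :
  (forall i, i \notin A -> f i = 0) -> has_sum f (\sum_(i <- A) f i).
Proof.
move=> f0 e e0; exists A => B AB.
rewrite (big_fset_incl _ AB) ?subrr ?nm0 // => i _; exact: f0.
Qed.

(* The leading terms of the sum are those indexed by [A]. *)
Lemma has_sum_lead (I : choiceType) (A : {fset I}) (f : I -> C R) (g : I -> R)
    l B M :
  has_sum f l -> (forall i, 0 <= g i) -> sums_le g M -> 0 <= B ->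
  (forall i, i \notin A -> nm (f i) <= B * g i) ->
  nm (l - \sum_(i <- A) f i) <= B * M.
Proof.
move=> fl g0 gM B0 fg.
pose h i := if i \in A then f i else 0.
have hl : has_sum h (\sum_(i <- A) f i).
  have -> : \sum_(i <- A) f i = \sum_(i <- A) h i.
    by apply: eq_big_seq => i iA; rewrite /h iA.
  by apply: has_sum_fset => i /negbTE iA; rewrite /h iA.
apply: (@has_sum_le _ (fun i => f i + -1 * h i) (fun i => B * g i)).
- rewrite -[- \sum_(i <- A) f i]mulN1r.
  by apply: has_sumD fl _; exact: has_sumZ.
- move=> i; rewrite /h; case: ifPn => [_|/fg]; last by rewrite mulr0 addr0.
  by rewrite mulN1r subrr nm0 mulr_ge0.
- by move=> D; rewrite -mulr_sumr ler_wpM2l.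
Qed.

Lemma ler_sum_fset (I : choiceType) (A B : {fset I}) (u : I -> R) :
  (A `<=` B)%fset -> (forall i, 0 <= u i) ->
  \sum_(i <- A) u i <= \sum_(i <- B) u i.
Proof.
move=> AB u0; rewrite [leRHS](big_fsetID _ (mem A)) /=.
have -> : [fset x in B | x \in A]%fset = A.
  apply/fsetP => x; rewrite !inE /= andbC; case: (boolP (x \in A)) => //= xA.
  by rewrite (fsubsetP AB).
by rewrite lerDl sumr_ge0.
Qed.

(** The limit is the supremum of the finite partial sums, which increase with the index set. *)
Lemma has_sum_real (I : choiceType) (u : I -> R) M :
  (forall i, 0 <= u i) -> sums_le u M ->
  exists l : R, has_sum (fun i => (u i)%:C%C) l%:C%C.
Proof.
move=> u0 uM; pose E := [set \sum_(i <- A) u i | A in @setT {fset I}]%classic.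
have supE : has_sup E.
  by split; [exists (\sum_(i <- fset0) u i), fset0
            | exists M => _ [A _ <-]; exact: uM].
exists (sup E) => e e0; have [_ [A _ <-] Ae] := sup_adherent e0 supE.
exists A => B AB; rewrite -(rmorph_sum (real_complex R)).
rewrite -(rmorphB (real_complex R)) nm_real ltr_norml.
have : \sum_(i <- B) u i <= sup E by apply: sup_upper_bound => //; exists B.
suff : \sum_(i <- A) u i <= \sum_(i <- B) u i by lra.
exact: ler_sum_fset.
Qed.

(** Absolute convergence. The real and imaginary parts become nonnegative after adding the majorant
    [g], which bounds them by [2 g]; the sum of [g] is subtracted afterwards. *)
Lemma has_sum_ex (I : choiceType) (f : I -> C R) (g : I -> R) M :
  (forall i, nm (f i) <= g i) -> sums_le g M -> exists l, has_sum f l.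
Proof.
move=> fg gM; have g0 i : 0 <= g i := le_trans (nm_ge0 _) (fg i).
have [l0 gl] := has_sum_real _ _ _ g0 gM.
have shift (a : I -> R) : (forall i, `|a i| <= g i) ->
    exists l, has_sum (fun i => (a i)%:C%C) l.
  move=> ag; have [||l al] := has_sum_real _ (fun i => a i + g i) (M + M).
  - by move=> i; have := ag i; rewrite ler_norml; lra.
  - move=> A; rewrite big_split /= lerD //; apply: le_trans (gM A).
    by apply: ler_sum => i _; have := ag i; rewrite ler_norml; lra.
  exists (l%:C%C + -1 * l0%:C%C).
  apply: eq_has_sum (has_sumD _ _ _ _ _ al (has_sumZ _ _ _ (-1) gl)) => i.
  by rewrite (rmorphD (real_complex R)) mulN1r addrK.
have [a fa] := shift _ (fun i => le_trans (nm_Re _) (fg i)).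
have [b fb] := shift _ (fun i => le_trans (nm_Im _) (fg i)).
exists (a + 'i * b).
apply: eq_has_sum (has_sumD _ _ _ _ _ fa (has_sumZ _ _ _ 'i fb)) => i.
by rewrite [RHS]complexE.
Qed.

(** A bijection between the subsets [P] and [Q] suffices because both families vanish outside them.
    This form fits the unitary substitution, which is integral only under a parity condition. *)
Lemma has_sum_reindex (I J : choiceType) (P : pred I) (Q : pred J)
    (h : I -> J) (k : J -> I) (f : I -> C R) (g : J -> C R) l :
  (forall i, ~~ P i -> f i = 0) -> (forall j, ~~ Q j -> g j = 0) ->
  (forall i, P i -> Q (h i) /\ k (h i) = i) ->
  (forall j, Q j -> P (k j) /\ h (k j) = j) ->
  (forall i, P i -> g (h i) = f i) ->
  has_sum f l -> has_sum g l.
Proof.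
move=> f0 g0 hP kQ gf fl e /fl[A HA]; exists (h @` A)%fset => B AB.
(* [A] is adjoined to the preimage of [B] only so that the hypothesis on [A] applies: the elements
   of [A] satisfying [P] lie in [B'] already, and the others contribute 0. *)
pose B' := (k @` [fset j in B | Q j])%fset.
suff -> : \sum_(j <- B) g j = \sum_(i <- (B' `|` A)%fset) f i.
  by apply: HA; exact: fsubsetUr.
have -> : \sum_(j <- B) g j = \sum_(j <- [fset j in B | Q j]%fset) g j.
  apply/esym/big_fset_incl; first by apply/fsubsetP => j; rewrite !inE => /andP[].
  by move=> j jB; rewrite !inE jB /= => /g0.
have -> : \sum_(i <- (B' `|` A)%fset) f i = \sum_(i <- B') f i.
  apply/esym/big_fset_incl; first exact: fsubsetUl.
  move=> i; rewrite inE => /orP[-> //|iA] iB; apply: f0; apply: contra iB => Pi.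
  have [Qh kh] := hP i Pi; rewrite -kh; apply/imfsetP; exists (h i) => //=.
  by rewrite !inE Qh andbT (fsubsetP AB) ?in_imfset.
rewrite [RHS]big_imfset /=; last first.
  move=> j j'; rewrite ?inE => /andP[_ Qj]; rewrite ?inE => /andP[_ Qj'] kk.
  by rewrite -(kQ j Qj).2 kk (kQ j' Qj').2.
apply: eq_big_seq => j; rewrite !inE => /andP[_ Qj].
by have [Pk hk] := kQ j Qj; rewrite -{1}hk gf.
Qed.

Lemma sums_le_geometric (r : R) : 0 <= r < 1 ->
  sums_le (fun n : nat => r ^+ n) (1 - r)^-1.
Proof.
move=> /andP[r0 r1] A; pose N := (\max_(i <- A) i).+1.
have AN i : i \in A -> (i < N)%N by move=> iA; rewrite ltnS; exact: leq_bigmax_seq.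
have -> : \sum_(i <- A) r ^+ i = \sum_(0 <= i < N | i \in A) r ^+ i.
  rewrite -[RHS]big_filter; apply/perm_big/uniq_perm.
  - exact: fset_uniq.
  - exact/filter_uniq/iota_uniq.
  - move=> i; rewrite mem_filter mem_index_iota /=.
    by case: (boolP (i \in A)) => // /AN ->.
rewrite big_mkcond big_mkord /=.
apply: (@le_trans _ _ (\sum_(i < N) r ^+ i)).
  by apply: ler_sum => i _; case: ifP => // _; exact: exprn_ge0.
rewrite -[leRHS]mul1r ler_pdivlMr ?subr_gt0 // mulrC.
have -> : (1 - r) * (\sum_(i < N) r ^+ i) = 1 - r ^+ N.
  by rewrite -[1 - r]opprB mulNr -subrX1 opprB.
by rewrite lerBlDr lerDl exprn_ge0.
Qed.

Lemma sums_le_inj (I J : choiceType) (h : I -> J) (g : J -> R) M :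
  injective h -> sums_le g M -> sums_le (fun i => g (h i)) M.
Proof.
move=> h_inj gM A; apply: le_trans (gM (h @` A)%fset).
by rewrite big_imfset //= => i j _ _ /h_inj.
Qed.

Lemma big_fset_prod (V : nmodType) (I J : choiceType) (A : {fset I})
    (B : {fset J}) (F : I * J -> V) :
  \sum_(p <- (A `*` B)%fset) F p = \sum_(i <- A) \sum_(j <- B) F (i, j).
Proof.
rewrite -big_allpairs; apply/perm_big/uniq_perm; rewrite ?fset_uniq //.
  by apply: allpairs_uniq; rewrite ?fset_uniq // => -[? ?] [? ?].
case=> i j; rewrite in_fsetM; apply/andP/allpairsP => /= [[iA jB]|].
  by exists (i, j).
by case=> -[i' j'] /= [iA jB [-> ->]].
Qed.

Lemma sums_le_prod (I J : choiceType) (f : I -> R) (g : J -> R) M N :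
  (forall i, 0 <= f i) -> (forall j, 0 <= g j) ->
  sums_le f M -> sums_le g N -> sums_le (fun p : I * J => f p.1 * g p.2) (M * N).
Proof.
move=> f0 g0 fM gN A.
pose A1 := [fset p.1 | p in A]%fset; pose A2 := [fset p.2 | p in A]%fset.
have AA : (A `<=` A1 `*` A2)%fset.
  by apply/fsubsetP => p pA; rewrite in_fsetM !in_imfset.
apply: (@le_trans _ _ (\sum_(p <- (A1 `*` A2)%fset) f p.1 * g p.2)).
  by apply: ler_sum_fset => // p; rewrite mulr_ge0.
rewrite big_fset_prod /=.
apply: (@le_trans _ _ (\sum_(i <- A1) f i * \sum_(j <- A2) g j)).
  by apply: ler_sum => i _; rewrite mulr_sumr.
rewrite -mulr_suml; apply: ler_pM => //; by rewrite sumr_ge0.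
Qed.

(** An integer is determined by its sign and absolute value, so each power of [r] occurs at most
    twice. *)
Lemma sums_le_absz (r : R) : 0 <= r < 1 ->
  sums_le (fun x : int => r ^+ `|x|%N) (2 * (1 - r)^-1).
Proof.
move=> r01; have r0 : 0 <= r by case/andP: r01.
have two : sums_le (fun _ : bool => 1 : R) 2.
  move=> A; apply: (@le_trans _ _ (\sum_(i <- [fset true; false]%fset) 1)).
    by apply: ler_sum_fset => //; apply/fsubsetP => -[]; rewrite !inE.
  by rewrite big_fsetU1 ?inE //= big_seq_fset1.
have := sums_le_prod _ _ _ _ _ _ (fun=> ler01) (fun n => exprn_ge0 n r0)
  two (sums_le_geometric _ r01).
have inj : injective (fun x : int => (x < 0, `|x|%N)) by move=> x y [] /=; lia.
move=> /(sums_le_inj _ _ _ _ _ inj) H A.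
by apply: le_trans (H A); apply: ler_sum => i _ /=; rewrite mul1r.
Qed.

(** Absolute convergence provides some sum [k] over pairs; it is identified with [l * m] on a finite
    box, where the double sum factors. *)
Lemma has_sum_prod (I J : choiceType) (f : I -> C R) (g : J -> C R)
    (F : I -> R) (G : J -> R) M N l m :
  (forall i, nm (f i) <= F i) -> (forall j, nm (g j) <= G j) ->
  sums_le F M -> sums_le G N ->
  has_sum f l -> has_sum g m ->
  has_sum (fun p : I * J => f p.1 * g p.2) (l * m).
Proof.
move=> fF gG FM GN fl gm.
have F0 i : 0 <= F i := le_trans (nm_ge0 _) (fF i).
have G0 i : 0 <= G i := le_trans (nm_ge0 _) (gG i).
have [|k fgk] := has_sum_ex _ (fun p : I * J => f p.1 * g p.2) _ _ _
  (sums_le_prod _ _ _ _ _ _ F0 G0 FM GN).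
  by move=> p; rewrite nmM ler_pM ?nm_ge0.
suff -> : l * m = k by [].
apply/eqP; rewrite -subr_eq0 -nm_eq0 eq_le nm_ge0 andbT.
apply/ler_addgt0Pr => e e0; rewrite add0r.
have c0 : 0 < nm l + nm m + 1 by have := nm_ge0 m; have := nm_ge0 l; lra.
(* With [d <= 1] the product of the two errors is at most [d], so the total error is at most
   [e / 2 + d * (nm l + nm m + 1)], hence at most [e]. *)
pose d := Num.min 1 (e / 2 / (nm l + nm m + 1)).
have d0 : 0 < d by rewrite lt_min ltr01 !divr_gt0.
have [A1 H1] := fl _ d0; have [A2 H2] := gm _ d0.
have [|A3 H3] := fgk (e / 2); first by rewrite divr_gt0.
pose B1 := (A1 `|` [fset p.1 | p in A3])%fset.
pose B2 := (A2 `|` [fset p.2 | p in A3])%fset.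
have {}H1 : nm (\sum_(i <- B1) f i - l) < d by apply: H1; exact: fsubsetUl.
have {}H2 : nm (\sum_(i <- B2) g i - m) < d by apply: H2; exact: fsubsetUl.
have {H3} : nm (\sum_(p <- (B1 `*` B2)%fset) f p.1 * g p.2 - k) < e / 2.
  apply: H3; apply/fsubsetP => p pA.
  by rewrite in_fsetM !inE !in_imfset ?orbT.
rewrite big_fset_prod /= [X in X - k](_ : _ =
  (\sum_(i <- B1) f i) * (\sum_(j <- B2) g j)); last first.
  by rewrite mulr_suml; apply: eq_bigr => i _; rewrite mulr_sumr.
set x := \sum_(i <- B1) f i in H1 *; set y := \sum_(j <- B2) g j in H2 * => H3.
have d1 : d <= 1 by rewrite ge_min lexx.
have dc : d * (nm l + nm m + 1) <= e / 2.
  by rewrite -ler_pdivlMr // ge_min lexx orbT.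
have -> : l * m - k = (x * y - k) - (x - l) * (y - m) - l * (y - m) - (x - l) * m.
  by ring.
have a1 := nmB ((x * y - k) - (x - l) * (y - m) - l * (y - m)) ((x - l) * m).
have a2 := nmB ((x * y - k) - (x - l) * (y - m)) (l * (y - m)).
have a3 := nmB (x * y - k) ((x - l) * (y - m)).
rewrite !nmM in a1 a2 a3.
have := nm_ge0 (x - l); have := nm_ge0 (y - m); have := nm_ge0 l; have := nm_ge0 m.
move: (nm l) (nm m) (nm (x - l)) (nm (y - m)) => u v s t in a1 a2 a3 H1 H2 dc *.
move=> v0 u0 t0 s0.
have st : s * t <= d by nra.
have ut : u * t <= d * u by nra.
have sv : s * v <= d * v by nra.
by lra.
Qed.

End UnorderedSums.

(** * The theta series *)

Section ComplexExponential.
Context {R : realType}.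

Lemma cexpD (x y : C R) : cexp (x + y) = cexp x * cexp y.
Proof.
case: x => a b; case: y => c d; rewrite /cexp /= expRD cosD sinD.
apply/eqP; rewrite eq_complex /=; apply/andP; split; apply/eqP; ring.
Qed.

Lemma cexp0 : cexp (0 : C R) = 1.
Proof. by rewrite /cexp /= expR0 cos0 sin0 mul1r. Qed.

Lemma nm_cexp (x : C R) : nm (cexp x) = expR (complex.Re x).
Proof.
rewrite nmM nm_real ger0_norm ?expR_ge0 //.
by rewrite /nm /= cos2Dsin2 sqrtr1 mulr1.
Qed.

Lemma cexp_neq0 (x : C R) : cexp x != 0.
Proof. by rewrite -nm_gt0 nm_cexp expR_gt0. Qed.

Lemma cexpN (x : C R) : cexp (- x) = (cexp x)^-1.
Proof.
by apply: (mulfI (cexp_neq0 x)); rewrite -cexpD subrr cexp0 divff ?cexp_neq0.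
Qed.

Lemma cexp_pi : cexp (cpi R * 'i) = -1.
Proof.
rewrite /cexp /= !mulr0 !mul0r subr0 addr0 mulr1 expR0 cospi sinpi.
by apply/eqP; rewrite eq_complex /= mul1r !mul0r !mulr0 subr0 addr0 oppr0 !eqxx.
Qed.

(** The sign character of the integers; passing to the absolute value preserves parity. *)
Definition sgnz (k : int) : C R := (-1) ^+ `|k|%N.

Lemma sgnzD (k l : int) : sgnz (k + l) = sgnz k * sgnz l.
Proof.
rewrite /sgnz -exprD -signr_odd -[RHS]signr_odd.
suff -> : odd `|k + l| = odd (`|k| + `|l|) by [].
by lia.
Qed.

Lemma sgnz0 : sgnz 0 = 1. Proof. by rewrite /sgnz expr0. Qed.

Lemma nm_sgnz k : nm (sgnz k) = 1.
Proof. by rewrite nmX nmN nm1 expr1n. Qed.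

Lemma cexp_pi_int (k : int) : cexp (cpi R * 'i * k%:~R) = sgnz k.
Proof.
have nat_case (n : nat) : cexp (cpi R * 'i * n%:R) = (-1) ^+ n.
  elim: n => [|n IHn]; first by rewrite mulr0 cexp0.
  by rewrite -natr1 mulrDr mulr1 cexpD IHn cexp_pi exprSr.
case: k => n; first exact: nat_case.
rewrite NegzE mulrNz mulrN cexpN nat_case /sgnz abszN /=.
by rewrite -exprVn invrN invr1.
Qed.

End ComplexExponential.

Lemma hermitian_form2 (K : numClosedFieldType) (M : 'M[K]_2) (v : 'cV[K]_2) :
  (map_mx Num.conj v^T *m M *m v) 0 0
  = M 0 0 * ((v 0 0)^* * v 0 0) + M 1 1 * ((v 1 0)^* * v 1 0)
    + M 0 1 * ((v 0 0)^* * v 1 0) + M 1 0 * ((v 1 0)^* * v 0 0).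
Proof.
rewrite !mxE !big_ord_recl big_ord0 !mxE !big_ord_recl !big_ord0 !mxE.
rewrite (_ : lift ord0 ord0 = 1); last by apply/val_inj.
ring.
Qed.

Lemma hermitian_dot2 (K : numClosedFieldType) (u v : 'cV[K]_2) :
  (map_mx Num.conj u^T *m v) 0 0 = (u 0 0)^* * v 0 0 + (u 1 0)^* * v 1 0.
Proof.
rewrite !mxE !big_ord_recl big_ord0 !mxE.
by rewrite (_ : lift ord0 ord0 = 1) ?addr0 //; apply/val_inj.
Qed.

Section ThetaSeries.
Context {R : realType}.
Implicit Type W : 'M[C R]_2.

(** For real arguments this is the value of the sesquilinear form of [W] at the vector (x1 + i y1,
    x2 + i y2). Written without conjugation, it is a polynomial to which [ring] applies. *)
Definition herm W (x1 y1 x2 y2 : C R) : C R :=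
  w11 W * (x1 ^+ 2 + y1 ^+ 2) + w22 W * (x2 ^+ 2 + y2 ^+ 2)
  + w12 W * ((x1 * x2 + y1 * y2) + 'i * (x1 * y2 - y1 * x2))
  + w21 W * ((x1 * x2 + y1 * y2) - 'i * (x1 * y2 - y1 * x2)).

Definition gauss_term W (x1 y1 x2 y2 : C R) : C R :=
  cexp (cpi R * 'i * herm W x1 y1 x2 y2).

(* The two Gaussian integers of the summation index, by real and imaginary
   parts. *)
Definition Z4 : choiceType := ((int * int) * (int * int))%type.

Definition Z4_of_index (n : 'cV[int]_2 * 'cV[int]_2) : Z4 :=
  ((n.1 0 0, n.2 0 0), (n.1 1 0, n.2 1 0)).

Definition index_of_Z4 (n : Z4) : 'cV[int]_2 * 'cV[int]_2 :=
  (\col_j (if j == 0 then n.1.1 else n.2.1),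
   \col_j (if j == 0 then n.1.2 else n.2.2)).

Lemma index_of_Z4K n : index_of_Z4 (Z4_of_index n) = n.
Proof.
case: n => n m; congr pair; apply/colP => j; rewrite mxE;
  by case: j => [[|[|//]] ?] /=; congr (_ _ _); apply/val_inj.
Qed.

Lemma Z4_of_indexK n : Z4_of_index (index_of_Z4 n) = n.
Proof. by case: n => -[x1 y1] [x2 y2]; rewrite /Z4_of_index !mxE /=. Qed.

(** The characteristic (1 + i) / 2 has equal real and imaginary parts, so both real coordinates of
    an index undergo the same shift by 1/2. *)
Definition shift2 (x : int) (a : bool) : C R := x%:~R + a%:R / 2.

Definition theta_summand (a1 a2 b1 b2 : bool) W (n : Z4) : C R :=
  gauss_term W (shift2 n.1.1 a1) (shift2 n.1.2 a1) (shift2 n.2.1 a2) (shift2 n.2.2 a2)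
  * sgnz (b1%:Z * (n.1.1 + n.1.2) + b2%:Z * (n.2.1 + n.2.2)).

(** For b = (1 + i) / 2 one has 2 Re(conj(b) (x + i y)) = x + y, an integer; hence the second
    characteristic contributes only a sign. *)
Lemma theta_termE (a1 a2 b1 b2 : bool) W n :
  theta_term (half_char R a1 a2) (half_char R b1 b2) W (gaussvec R n)
  = theta_summand a1 a2 b1 b2 W (Z4_of_index n).
Proof.
have conj2 (x y : int) (a : bool) :
    (x%:~R + 'i * y%:~R + (1 + 'i) / 2 * a%:R)^*
    = shift2 x a - 'i * shift2 y a :> C R.
  rewrite /shift2 !(rmorphD, rmorphM, rmorph_int, rmorph_nat, fmorphV, rmorph1).
  by rewrite [_ 'i](conjCi (C R)); field.
have plain (x y : int) (a : bool) :
    x%:~R + 'i * y%:~R + (1 + 'i) / 2 * a%:R = shift2 x a + 'i * shift2 y a :> C R.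
  by rewrite /shift2; field.
have i2 : 'i * 'i = -1 :> C R by rewrite -expr2 sqrCi.
case: n => n m.
have vE (j : 'I_2) (x1 x2 : nat) :
    (gaussvec R (n, m) + half_char R x1 x2) j 0
    = (n j 0)%:~R + 'i * (m j 0)%:~R + (1 + 'i) / 2 * (nth 0%N [:: x1; x2] j)%:R.
  by rewrite /gaussvec /half_char !mxE.
have E1 : (adj (gaussvec R (n, m) + half_char R a1 a2) *m W
           *m (gaussvec R (n, m) + half_char R a1 a2)) 0 0
  = herm W (shift2 (n 0 0) a1) (shift2 (m 0 0) a1) (shift2 (n 1 0) a2) (shift2 (m 1 0) a2).
  rewrite /adj hermitian_form2 !vE /= !conj2 !plain /herm /w11 /w12 /w21 /w22.
  ring: i2.
have E2 : 2 * 'Re ((adj (half_char R b1 b2) *m gaussvec R (n, m)) 0 0)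
  = (b1%:Z * (n 0 0 + m 0 0) + b2%:Z * (n 1 0 + m 1 0))%:~R.
  have halfE (s x y : C R) : s^* = s -> x^* = x -> y^* = y ->
      'Re (((1 + 'i) / 2 * s)^* * (x + 'i * y)) = s * (x + y) / 2.
    move=> sr xr yr.
    have -> : ((1 + 'i) / 2 * s)^* = (1 - 'i) / 2 * s.
      rewrite !(rmorphD, rmorphM, fmorphV, rmorph1).
      by rewrite [_ 'i](conjCi (C R)) [_ s]sr.
    have -> : (1 - 'i) / 2 * s * (x + 'i * y)
            = s * (x + y) / 2 + 'i * (s * (y - x) / 2) by field: i2.
    have real_half (z : C R) : z^* = z -> (s * z / 2)^* = s * z / 2.
      move=> zr; rewrite !(rmorphM, fmorphV, rmorphD, rmorph1).
      by rewrite [_ s]sr [_ z]zr.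
    have xyr : (x + y)^* = x + y by rewrite rmorphD /= [_^*]xr [y^*]yr.
    have yxr : (y - x)^* = y - x by rewrite rmorphB /= [_^*]yr [x^*]xr.
    by apply: Re_rect; apply/CrealP; exact: real_half.
  rewrite /adj hermitian_dot2 raddfD mulrDr /= /half_char /gaussvec !mxE /=.
  rewrite !halfE ?rmorph_nat ?rmorph_int // rmorphD !rmorphM !rmorphD /=.
  by field.
rewrite /theta_summand /gauss_term -cexp_pi_int -[RHS]cexpD -[in RHS]mulrDr.
exact: (congr2 (fun z t => cexp (cpi R * 'i * (z + t))) E1 E2).
Qed.

End ThetaSeries.

(** * Absolute convergence of the theta series on the domain *)

Section Convergence.
Context {R : realType}.
Implicit Type W : 'M[C R]_2.

Lemma Re_pi_i (z : C R) : complex.Re (cpi R * 'i * z) = - (pi * complex.Im z).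
Proof. by case: z => a b /=; ring. Qed.

Lemma Im_herm_gt0 W (x1 y1 x2 y2 : R) : H2 W ->
  [|| x1 != 0, y1 != 0, x2 != 0 | y2 != 0] ->
  0 < complex.Im (herm W x1%:C%C y1%:C%C x2%:C%C y2%:C%C).
Proof.
move=> HW nz.
pose v : 'cV[C R]_2 :=
  \col_j (if j == 0 then x1%:C%C + 'i * y1%:C%C else x2%:C%C + 'i * y2%:C%C).
have realC (x : R) : (x%:C%C : C R)^* = x%:C%C by apply/CrealP/complex_realP; exists x.
have conjE (x y : R) : (x%:C%C + 'i * y%:C%C : C R)^* = x%:C%C - 'i * y%:C%C.
  by rewrite rmorphD rmorphM /= [_^*]realC [y%:C%C^*]realC conjCi mulNr.
have v0 : v != 0.
  apply: contraTN nz => /eqP/colP v0; have := v0 0; have := v0 1; rewrite !mxE /=.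
  rewrite -[X in X = _ -> _](complexE (x2 +i* y2)%C).
  rewrite -[X in _ -> X = _ -> _](complexE (x1 +i* y1)%C).
  by move=> [-> ->] [-> ->]; rewrite eqxx.
have := HW v v0.
rewrite /adj hermitian_form2 !mxE /= !conjE -ltcR complexIm ImE.
set h := herm _ _ _ _ _.
have -> : h^* = (W 0 0)^* * (x1%:C%C ^+ 2 + y1%:C%C ^+ 2)
    + (W 1 1)^* * (x2%:C%C ^+ 2 + y2%:C%C ^+ 2)
  + (W 0 1)^* * ((x1%:C%C * x2%:C%C + y1%:C%C * y2%:C%C)
       - 'i * (x1%:C%C * y2%:C%C - y1%:C%C * x2%:C%C))
  + (W 1 0)^* * ((x1%:C%C * x2%:C%C + y1%:C%C * y2%:C%C)
       + 'i * (x1%:C%C * y2%:C%C - y1%:C%C * x2%:C%C)).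
  rewrite /h /herm /w11 /w12 /w21 /w22.
  rewrite !(rmorphD, rmorphN, rmorphM, rmorphXn) /= [_ 'i]conjCi.
  rewrite ![_ x1%:C%C]realC ![_ x2%:C%C]realC ![_ y1%:C%C]realC ![_ y2%:C%C]realC.
  by ring.
set s := (X in 0 < X -> _); set t := (X in _ -> _ < X).
suff -> : s = t by [].
rewrite /s /t /h /herm /w11 /w12 /w21 /w22.
have i2 : 'i * 'i = -1 :> C R by rewrite -expr2 sqrCi.
have i0 : ('i : C R) != 0 := neq0Ci _.
have iV : (2 * 'i)^-1 = - 'i / 2 :> C R by field: i2.
by rewrite iV; field: i2.
Qed.

Lemma Im_herm W (x1 y1 x2 y2 : R) :
  complex.Im (herm W x1%:C%C y1%:C%C x2%:C%C y2%:C%C)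
  = complex.Im (w11 W) * (x1 ^+ 2 + y1 ^+ 2)
    + complex.Im (w22 W) * (x2 ^+ 2 + y2 ^+ 2)
    + (complex.Im (w12 W) + complex.Im (w21 W)) * (x1 * x2 + y1 * y2)
    + (complex.Re (w12 W) - complex.Re (w21 W)) * (x1 * y2 - y1 * x2).
Proof.
rewrite /herm !expr2; case: (w11 W) (w12 W) (w21 W) (w22 W) => [a a'] [b b'] [c c'] [d d'] /=.
by ring.
Qed.

(* The smaller eigenvalue of a positive definite matrix is at least
   determinant / trace. *)
Lemma Im_herm_ge W : H2 W -> exists2 c : R, 0 < c & forall x1 y1 x2 y2 : R,
  c * (x1 ^+ 2 + y1 ^+ 2 + (x2 ^+ 2 + y2 ^+ 2))
  <= complex.Im (herm W x1%:C%C y1%:C%C x2%:C%C y2%:C%C).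
Proof.
move=> HW; have F x1 y1 x2 y2 := @Im_herm_gt0 W x1 y1 x2 y2 HW.
have E := Im_herm W.
set a := complex.Im (w11 W) in E; set b := complex.Im (w22 W) in E.
set p2 := _ + complex.Im _ in E; set q2 := _ - complex.Re _ in E.
pose p := p2 / 2; pose q := q2 / 2.
have a0 : 0 < a by have := F 1 0 0 0; rewrite oner_eq0 E => /(_ isT); lra.
have b0 : 0 < b by have := F 0 0 1 0; rewrite oner_eq0 eqxx E => /(_ isT); lra.
have det0 : 0 < a * b - p ^+ 2 - q ^+ 2.
  (* This vector minimizes the form among those with second coordinate [a]; its value is [a] times
     the determinant. *)
  have := F (- p) q a 0; rewrite (gt_eqF a0) /= !orbT E => /(_ isT).
  have -> : a * ((- p) ^+ 2 + q ^+ 2) + b * (a ^+ 2 + 0 ^+ 2) +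
    p2 * (- p * a + q * 0) + q2 * (- p * 0 - q * a)
    = a * (a * b - p ^+ 2 - q ^+ 2) by rewrite /p /q; field.
  by rewrite pmulr_rgt0.
have ab0 : 0 < a + b by rewrite addr_gt0.
pose c := (a * b - p ^+ 2 - q ^+ 2) / (a + b).
have cE : c * (a + b) = a * b - p ^+ 2 - q ^+ 2.
  by rewrite /c divfK // gt_eqF.
have c0 : 0 < c by rewrite divr_gt0.
have ac0 : 0 < a - c.
  by rewrite subr_gt0 -(ltr_pM2r ab0) cE; have := sqr_ge0 p; have := sqr_ge0 q; nra.
exists c => // x1 y1 x2 y2; rewrite E -subr_ge0 -(pmulr_rge0 _ ac0).
have bE : p ^+ 2 + q ^+ 2 = (a - c) * (b - c) - c ^+ 2.
  have -> : (a - c) * (b - c) - c ^+ 2 = a * b - c * (a + b) by ring.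
  by rewrite cE; ring.
(* Completion of squares with pivot [a - c]. The choice of [c] makes the reduced determinant exactly
   [c ^+ 2], which is [bE], so the last summand vanishes. *)
have -> : (a - c) * (a * (x1 ^+ 2 + y1 ^+ 2) + b * (x2 ^+ 2 + y2 ^+ 2) +
     p2 * (x1 * x2 + y1 * y2) + q2 * (x1 * y2 - y1 * x2) -
     c * (x1 ^+ 2 + y1 ^+ 2 + (x2 ^+ 2 + y2 ^+ 2)))
   = ((a - c) * x1 + p * x2 + q * y2) ^+ 2 + ((a - c) * y1 + p * y2 - q * x2) ^+ 2
     + c ^+ 2 * (x2 ^+ 2 + y2 ^+ 2)
     + ((a - c) * (b - c) - c ^+ 2 - (p ^+ 2 + q ^+ 2)) * (x2 ^+ 2 + y2 ^+ 2).
  by rewrite /p /q; field.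
rewrite -bE subrr mul0r addr0; apply: addr_ge0; first by rewrite addr_ge0 ?sqr_ge0.
by apply: mulr_ge0; rewrite ?addr_ge0 ?sqr_ge0.
Qed.

Definition geom4 (r : R) (n : Z4) : R :=
  (r ^+ `|n.1.1|%N * r ^+ `|n.1.2|%N) * (r ^+ `|n.2.1|%N * r ^+ `|n.2.2|%N).

Lemma geom4_ge0 r n : 0 <= r -> 0 <= geom4 r n.
Proof. by move=> r0; rewrite /geom4 !mulr_ge0 ?exprn_ge0. Qed.

Lemma sums_le_geom4 (r : R) : 0 <= r < 1 ->
  sums_le (geom4 r) ((2 * (1 - r)^-1) ^+ 4).
Proof.
move=> r01; have r0 : 0 <= r by case/andP: r01.
have h0 (x : int) : 0 <= r ^+ `|x|%N by exact: exprn_ge0.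
have h := sums_le_absz _ r01.
have hh0 (x : int * int) : 0 <= r ^+ `|x.1|%N * r ^+ `|x.2|%N by exact: mulr_ge0.
have hh := sums_le_prod _ _ _ _ _ _ h0 h0 h h.
have := sums_le_prod _ _ _ _ _ _ hh0 hh0 hh hh.
by rewrite -!expr2 -exprM.
Qed.

Definition norm1 (n : Z4) : nat := (`|n.1.1| + `|n.1.2| + `|n.2.1| + `|n.2.2|)%N.

Lemma geom4E r n : geom4 r n = r ^+ norm1 n.
Proof. by rewrite /geom4 /norm1 !exprD !mulrA. Qed.

Definition shift2R (x : int) (a : bool) : R := x%:~R + a%:R / 2.

Lemma shift2_real x a : shift2 x a = (shift2R x a)%:C%C.
Proof.
by rewrite /shift2 /shift2R rmorphD rmorphM fmorphV rmorph_int !rmorph_nat.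
Qed.

(** Replaces Gaussian by geometric decay. Dropping [a / 4] from the square leaves the integer x^2 +
    a x, and the loss of 1 covers [x = -1], [a = true]. *)
Lemma sqr_shift2R_ge x a : (`|x|%N)%:R - 1 <= shift2R x a ^+ 2.
Proof.
have [y yE] : exists y : int, y = x * x + a%:Z * x by exists (x * x + a%:Z * x).
have le1 : `|x|%N%:Z - 1 <= y by rewrite yE; case: a {yE}; nia.
have le2 : (`|x|%N)%:R - 1 <= y%:~R :> R.
  by have := le1; rewrite -(ler_int R) intrB.
apply: le_trans le2 _; rewrite yE intrD !intrM /shift2R.
case: a {yE le1} => /=; last by nra.
by rewrite -[1%:~R]/1; nra.
Qed.

Lemma nm_theta_summand a1 a2 b1 b2 W n :
  nm (theta_summand a1 a2 b1 b2 W n) = expR (- (pi * complex.Im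
    (herm W (shift2R n.1.1 a1)%:C%C (shift2R n.1.2 a1)%:C%C
            (shift2R n.2.1 a2)%:C%C (shift2R n.2.2 a2)%:C%C))).
Proof.
by rewrite /theta_summand nmM nm_sgnz mulr1 nm_cexp Re_pi_i !shift2_real.
Qed.

Lemma theta_summand_bound a1 a2 W : H2 W ->
  exists (r K : R), 0 <= r < 1 /\ forall b1 b2 n,
    nm (theta_summand a1 a2 b1 b2 W n) <= K * geom4 r n.
Proof.
(* The factor 4 in the constant collects the loss of 1 from [sqr_shift2R_ge] in each of the four
   coordinates. *)
move=> /Im_herm_ge[c c0 Hc]; exists (expR (- (pi * c))), (expR (4 * (pi * c))).
have pic : 0 < pi * c by rewrite mulr_gt0 ?pi_gt0.
split; first by rewrite expR_ge0 /= -expR0 ltr_expR oppr_lt0.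
move=> b1 b2 n; rewrite nm_theta_summand geom4E -expRM_natl -expRD ler_expR.
apply: (@le_trans _ _ (- (pi * (c * (shift2R n.1.1 a1 ^+ 2 + shift2R n.1.2 a1 ^+ 2
   + (shift2R n.2.1 a2 ^+ 2 + shift2R n.2.2 a2 ^+ 2)))))).
  by rewrite lerN2 ler_pM2l ?pi_gt0.
have := sqr_shift2R_ge n.1.1 a1; have := sqr_shift2R_ge n.1.2 a1.
have := sqr_shift2R_ge n.2.1 a2; have := sqr_shift2R_ge n.2.2 a2.
rewrite /norm1 !natrD mulrA; nra.
Qed.

Lemma theta_has_sum (a1 a2 b1 b2 : bool) W : H2 W ->
  has_sum (theta_summand a1 a2 b1 b2 W)
          (theta (half_char R a1 a2) (half_char R b1 b2) W).
Proof.
move=> /(theta_summand_bound a1 a2)[r [K [r01 bnd]]].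
have gK : sums_le (fun n => K * geom4 r n) (K * (2 * (1 - r)^-1) ^+ 4).
  have K0 : 0 <= K.
    have := le_trans (nm_ge0 _) (bnd b1 b2 ((0, 0), (0, 0))).
    by rewrite geom4E expr0 mulr1.
  by move=> A; rewrite -mulr_sumr ler_wpM2l // sums_le_geom4.
have [l fl] := has_sum_ex _ _ _ _ (bnd b1 b2) gK.
suff -> : theta (half_char R a1 a2) (half_char R b1 b2) W = l by [].
apply: has_sum_sum.
apply: (has_sum_reindex _ _ predT predT index_of_Z4 Z4_of_index _ _ _ _ _ _ _ _ fl) => //.
- by move=> n _; split => //; exact: Z4_of_indexK.
- by move=> n _; split => //; exact: index_of_Z4K.
- by move=> n _; rewrite theta_termE Z4_of_indexK.
Qed.

End Convergence.

(** * Riemann's theta relation *)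

Section RiemannRelation.
Context {R : realType}.
Implicit Type W : 'M[C R]_2.

Lemma sgnz_eq (k l : int) : ((k - l) %% 2)%Z = 0 -> sgnz k = sgnz l :> C R.
Proof.
move=> kl; rewrite /sgnz -signr_odd -[RHS]signr_odd.
suff -> : odd `|k| = odd `|l| by [].
by lia.
Qed.

Definition theta2 (a b : bool * bool) W : C R :=
  theta (half_char R a.1 a.2) (half_char R b.1 b.2) W ^+ 2.

Definition theta_summand2 (a b : bool * bool) W (p : Z4 * Z4) : C R :=
  theta_summand a.1 a.2 b.1 b.2 W p.1 * theta_summand a.1 a.2 b.1 b.2 W p.2.

Lemma theta2_has_sum a b W : H2 W ->
  has_sum (theta_summand2 a b W) (theta2 a b W).
Proof.
move=> HW; have [r [K [r01 bnd]]] := theta_summand_bound a.1 a.2 W HW.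
have gK : sums_le (fun n => K * geom4 r n) (K * (2 * (1 - r)^-1) ^+ 4).
  have K0 : 0 <= K.
    have := le_trans (nm_ge0 _) (bnd b.1 b.2 ((0, 0), (0, 0))).
    by rewrite geom4E expr0 mulr1.
  by move=> A; rewrite -mulr_sumr ler_wpM2l // sums_le_geom4.
rewrite /theta2 expr2.
have fl := theta_has_sum a.1 a.2 b.1 b.2 W HW.
exact: (has_sum_prod _ _ _ _ _ _ _ _ _ _ (bnd b.1 b.2) (bnd b.1 b.2) gK gK fl fl).
Qed.

(* Multiplication of [n + a (1 + i) / 2] by [i]. *)
Lemma theta_odd_eq0 (a1 a2 b1 b2 : bool) W : H2 W ->
  (a1 && b1) (+) (a2 && b2) ->
  theta (half_char R a1 a2) (half_char R b1 b2) W = 0.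
Proof.
move=> HW odd_ab; have fl := theta_has_sum a1 a2 b1 b2 W HW.
set l := theta _ _ _ in fl *.
pose h (n : Z4) : Z4 :=
  ((- n.1.2 - a1%:Z, n.1.1), (- n.2.2 - a2%:Z, n.2.1)).
pose k (n : Z4) : Z4 :=
  ((n.1.2, - n.1.1 - a1%:Z), (n.2.2, - n.2.1 - a2%:Z)).
have hk : cancel h k.
  by move=> [[? ?] [? ?]]; rewrite /h /k /=; congr (_, _); congr (_, _); lia.
have kh : cancel k h.
  by move=> [[? ?] [? ?]]; rewrite /h /k /=; congr (_, _); congr (_, _); lia.
have : has_sum (fun n => -1 * theta_summand a1 a2 b1 b2 W n) l.
  apply: (has_sum_reindex _ _ predT predT h k _ _ _ _ _ _ _ _ fl) => //.
  move=> n _; rewrite /theta_summand /h /=.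
  have -> : gauss_term W (shift2 (- n.1.2 - a1%:Z) a1) (shift2 n.1.1 a1)
      (shift2 (- n.2.2 - a2%:Z) a2) (shift2 n.2.1 a2)
    = gauss_term W (shift2 n.1.1 a1) (shift2 n.1.2 a1) (shift2 n.2.1 a2) (shift2 n.2.2 a2).
    have neg (x : int) (a : bool) : shift2 (- x - a%:Z) a = - shift2 x a :> C R.
      by rewrite /shift2 intrB intrN -[a%:Z%:~R]/(a%:R); field.
    by rewrite !neg /gauss_term /herm; congr (cexp (_ * _)); ring.
  rewrite mulrCA; congr (_ * _).
  (* The substitution changes the exponent of the sign by [a1 b1 + a2 b2] modulo 2, which is odd by
     hypothesis. *)
  rewrite -[X in X * _]/(sgnz 1) -sgnzD; apply: sgnz_eq.
  by move: odd_ab; case: a1 a2 b1 b2 {fl l h k hk kh} => [] [] [] []; lia.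
move=> /has_sum_unique /(_ (has_sumZ _ _ _ (-1) fl)) /eqP.
by rewrite mulN1r -addr_eq0 -mulr2n mulrn_eq0 => /eqP.
Qed.

(** The congruence u + v = a modulo 1 + i, since a Gaussian integer is divisible by 1 + i exactly
    when its coordinates have even sum. It is the integrality condition of the substitution
    below. *)
Definition same_parity (u v : int * int) (a : bool) : bool :=
  ((u.1 + u.2 + v.1 + v.2 - a%:Z) %% 2)%Z == 0.

(* The unitary substitution [n + m + 2 al = (1 + i) (u + ga)],
   [n - m = (1 + i) (v + ga)] with [al = a (1 + i) / 2], [ga = c (1 + i) / 2]. *)
Definition rot_n (a c : bool) (u v : int * int) : int * int :=
  (((u.1 + v.1 - (u.2 + v.2) - a%:Z) %/ 2)%Z,
   ((u.1 + v.1 + (u.2 + v.2) - a%:Z) %/ 2)%Z + c%:Z).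

Definition rot_m (a c : bool) (u v : int * int) : int * int :=
  (((u.1 - v.1 - (u.2 - v.2) - a%:Z) %/ 2)%Z,
   ((u.1 - v.1 + (u.2 - v.2) - a%:Z) %/ 2)%Z).

Definition rot_u (a c : bool) (n m : int * int) : int * int :=
  (((n.1 + m.1 + (n.2 + m.2) - c%:Z) %/ 2)%Z + a%:Z,
   ((n.2 + m.2 - (n.1 + m.1) - c%:Z) %/ 2)%Z).

Definition rot_v (a c : bool) (n m : int * int) : int * int :=
  (((n.1 - m.1 + (n.2 - m.2) - c%:Z) %/ 2)%Z,
   ((n.2 - m.2 - (n.1 - m.1) - c%:Z) %/ 2)%Z).

(** Under the parity condition all divisions by 2 are exact, and the characteristics [a] and [c]
    exchange their roles. *)
Lemma rot_uvK a c u v : same_parity u v a ->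
  [/\ same_parity (rot_n a c u v) (rot_m a c u v) c,
      rot_u a c (rot_n a c u v) (rot_m a c u v) = u
    & rot_v a c (rot_n a c u v) (rot_m a c u v) = v].
Proof.
case: u v => [x y] [x' y'].
rewrite /same_parity /rot_u /rot_v /rot_n /rot_m /= => H.
split; first by lia.
- by congr pair; lia.
- by congr pair; lia.
Qed.

Lemma rot_nmK a c n m : same_parity n m c ->
  [/\ same_parity (rot_u a c n m) (rot_v a c n m) a,
      rot_n a c (rot_u a c n m) (rot_v a c n m) = n
    & rot_m a c (rot_u a c n m) (rot_v a c n m) = m].
Proof.
case: n m => [x y] [x' y'].
rewrite /same_parity /rot_u /rot_v /rot_n /rot_m /= => H.
split; first by lia.
- by congr pair; lia.
- by congr pair; lia.
Qed.

Lemma shift2_rot a c u v : same_parity u v a ->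
  [/\ shift2 (rot_n a c u v).1 a = (shift2 u.1 c + shift2 v.1 c - shift2 u.2 c - shift2 v.2 c) / 2 :> C R,
      shift2 (rot_n a c u v).2 a = (shift2 u.1 c + shift2 v.1 c + shift2 u.2 c + shift2 v.2 c) / 2 :> C R,
      shift2 (rot_m a c u v).1 a = (shift2 u.1 c - shift2 v.1 c - shift2 u.2 c + shift2 v.2 c) / 2 :> C R
    & shift2 (rot_m a c u v).2 a = (shift2 u.1 c - shift2 v.1 c + shift2 u.2 c - shift2 v.2 c) / 2 :> C R].
Proof.
case: u v => [x y] [x' y']; rewrite /same_parity /rot_n /rot_m /= => H.
have E (k s : int) : 2 * k = s - a%:Z -> k%:~R = (s%:~R - a%:R) / 2 :> C R.
  move=> /(congr1 (fun z : int => z%:~R : C R)); rewrite intrM intrB.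
  by rewrite -[a%:Z%:~R]/(a%:R) => <-; field.
rewrite /shift2 !intrD -[c%:Z%:~R]/(c%:R).
split.
- rewrite (E _ (x + x' - (y + y'))); last by lia.
  by rewrite !(intrD, intrN); field.
- rewrite (E _ (x + x' + (y + y'))); last by lia.
  by rewrite !(intrD, intrN); field.
- rewrite (E _ (x - x' - (y - y'))); last by lia.
  by rewrite !(intrD, intrN); field.
- rewrite (E _ (x - x' + (y - y'))); last by lia.
  by rewrite !(intrD, intrN); field.
Qed.

Definition bits2 : seq (bool * bool) :=
  [:: (false, false); (false, true); (true, false); (true, true)].

Definition dotz (a b : bool * bool) : int :=
  a.1%:Z * b.1%:Z + a.2%:Z * b.2%:Z.

Definition gauss_pair W (a : bool * bool) (p : Z4 * Z4) : C R :=
  gauss_term W (shift2 p.1.1.1 a.1) (shift2 p.1.1.2 a.1) (shift2 p.1.2.1 a.2) (shift2 p.1.2.2 a.2)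
  * gauss_term W (shift2 p.2.1.1 a.1) (shift2 p.2.1.2 a.1) (shift2 p.2.2.1 a.2) (shift2 p.2.2.2 a.2).

Definition same_parity2 (a : bool * bool) (p : Z4 * Z4) :=
  same_parity p.1.1 p.2.1 a.1 && same_parity p.1.2 p.2.2 a.2.

Lemma theta_summand2E a b W p : theta_summand2 a b W p = gauss_pair W a p *
  sgnz (b.1%:Z * (p.1.1.1 + p.1.1.2 + p.2.1.1 + p.2.1.2)
        + b.2%:Z * (p.1.2.1 + p.1.2.2 + p.2.2.1 + p.2.2.2)).
Proof.
rewrite /theta_summand2 /theta_summand mulrACA -sgnzD; congr (_ * sgnz _); ring.
Qed.

(** Orthogonality of the characters of (Z/2)^2: summing over [d] detects the parity classes. *)
Lemma sum_signs a W c p :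
  \sum_(d <- bits2) sgnz (dotz a d) * theta_summand2 c d W p
  = if same_parity2 a p then 4 * gauss_pair W c p else 0.
Proof.
have E d : sgnz (dotz a d) * theta_summand2 c d W p = gauss_pair W c p *
    sgnz (d.1%:Z * (p.1.1.1 + p.1.1.2 + p.2.1.1 + p.2.1.2 - a.1%:Z)
          + d.2%:Z * (p.1.2.1 + p.1.2.2 + p.2.2.1 + p.2.2.2 - a.2%:Z)).
  rewrite theta_summand2E mulrCA; congr (_ * _); rewrite -sgnzD.
  by apply: sgnz_eq; rewrite /dotz; case: d => -[] []; case: a => -[] []; lia.
under eq_bigr do rewrite E.
rewrite -mulr_sumr !big_cons big_nil /= !mul0r !mul1r !add0r !addr0 sgnz0.
set s := p.1.1.1 + _ + _ + _ - _; set t := p.1.2.1 + _ + _ + _ - _.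
rewrite (sgnzD s t).
have S (k : int) : sgnz k = (if (k %% 2)%Z == 0 then 1 else -1) :> C R.
  by case: ifPn => k2; [apply: (sgnz_eq k 0)|apply: (sgnz_eq k 1)]; lia.
rewrite !S /same_parity2 /same_parity -/s -/t.
by case: ((s %% 2)%Z == 0); case: ((t %% 2)%Z == 0) => /=; ring.
Qed.

(** Both sides are sums over pairs. The pairs (n, m) on the left split into four parity classes
    indexed by [c]; the substitution carries class [c] to the pairs (u, v) of class [a] with
    characteristic [c], and these are what the sum over [d] on the right selects. *)
Lemma riemann_relation a b W : H2 W ->
  4 * theta2 a b W
  = \sum_(c <- bits2) \sum_(d <- bits2) sgnz (dotz b c + dotz a d) * theta2 c d W.
Proof.
move=> HW.
apply: (has_sum_unique _ _ _ _ (has_sumZ _ _ _ 4 (theta2_has_sum a b W HW))).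
(* Each pair belongs to exactly one class [c], on which the sign of the term depends only on
   [dotz b c]. *)
have E p : \sum_(c <- bits2) (if same_parity2 c p then 4 * (sgnz (dotz b c) * gauss_pair W a p) else 0)
    = 4 * theta_summand2 a b W p.
  rewrite theta_summand2E.
  have -> : sgnz (b.1%:Z * (p.1.1.1 + p.1.1.2 + p.2.1.1 + p.2.1.2)
        + b.2%:Z * (p.1.2.1 + p.1.2.2 + p.2.2.1 + p.2.2.2)) = 
     sgnz (dotz b (((p.1.1.1 + p.1.1.2 + p.2.1.1 + p.2.1.2) %% 2)%Z != 0,
                   ((p.1.2.1 + p.1.2.2 + p.2.2.1 + p.2.2.2) %% 2)%Z != 0)) :> C R.
    by apply: sgnz_eq; rewrite /dotz /=; case: b => -[] [] /=; lia.
  rewrite !big_cons big_nil /same_parity2 /same_parity /=.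
  set s := _ + p.2.1.2; set t := _ + p.2.2.2.
  have P0 (k : int) : ((k - 0) %% 2)%Z = (k %% 2)%Z by rewrite subr0.
  have P1 (k : int) : (((k - 1) %% 2)%Z == 0) = ~~ ((k %% 2)%Z == 0) by lia.
  rewrite !P0 !P1.
  by case: (_ == 0); case: (_ == 0) => /=; ring.
apply: eq_has_sum E _; apply: has_sum_bigsum => c.
under [X in has_sum _ X]eq_bigr do rewrite sgnzD -mulrA.
rewrite -mulr_sumr.
have fl : has_sum (fun p => sgnz (dotz b c) * \sum_(d <- bits2) sgnz (dotz a d) * theta_summand2 c d W p)
   (sgnz (dotz b c) * \sum_(d <- bits2) sgnz (dotz a d) * theta2 c d W).
  by apply/has_sumZ/has_sum_bigsum => d; apply/has_sumZ/theta2_has_sum.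
pose h (p : Z4 * Z4) : Z4 * Z4 :=
  ((rot_n a.1 c.1 p.1.1 p.2.1, rot_n a.2 c.2 p.1.2 p.2.2),
   (rot_m a.1 c.1 p.1.1 p.2.1, rot_m a.2 c.2 p.1.2 p.2.2)).
pose k (p : Z4 * Z4) : Z4 * Z4 :=
  ((rot_u a.1 c.1 p.1.1 p.2.1, rot_u a.2 c.2 p.1.2 p.2.2),
   (rot_v a.1 c.1 p.1.1 p.2.1, rot_v a.2 c.2 p.1.2 p.2.2)).
apply: (has_sum_reindex _ _ (same_parity2 a) (same_parity2 c) h k _ _ _ _ _ _ _ _ fl).
- by move=> p /negbTE; rewrite sum_signs => ->; rewrite mulr0.
- by move=> p /negbTE ->.
- move=> [[u1 u2] [v1 v2]] /andP[/= H1 H2].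
  have [P1 U1 V1] := rot_uvK _ c.1 _ _ H1; have [P2 U2 V2] := rot_uvK _ c.2 _ _ H2.
  by rewrite /same_parity2 /h /k /= P1 P2 U1 U2 V1 V2.
- move=> [[u1 u2] [v1 v2]] /andP[/= H1 H2].
  have [P1 U1 V1] := rot_nmK a.1 _ _ _ H1; have [P2 U2 V2] := rot_nmK a.2 _ _ _ H2.
  by rewrite /same_parity2 /h /k /= P1 P2 U1 U2 V1 V2.
- move=> p Hp; rewrite sum_signs Hp; case/andP: Hp => H1 H2.
  have [P1 U1 V1] := rot_uvK _ c.1 _ _ H1; have [P2 U2 V2] := rot_uvK _ c.2 _ _ H2.
  rewrite /same_parity2 /h /= P1 P2 /= mulrCA; congr (_ * (_ * _)).
  rewrite /gauss_pair /=.
  have [-> -> -> ->] := shift2_rot _ c.1 _ _ H1.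
  have [-> -> -> ->] := shift2_rot _ c.2 _ _ H2.
  rewrite /gauss_term -[LHS]cexpD -[RHS]cexpD; congr cexp.
  (* Parallelogram law: the substitution is unitary on pairs, so the sum of the two values of [herm]
     is unchanged. *)
  by rewrite /herm; field.
Qed.

End RiemannRelation.

(** * Linear relations between the theta squares *)

Section ThetaRelations.
Context {R : realType}.
Implicit Type W : 'M[C R]_2.

(** The six odd characteristics drop out, and the ten remaining values form an eigenvector with
    eigenvalue 4 of a matrix of signs. Five of the ten eigenvector equations already give the five
    relations; the fractions below are the coefficients of the required linear combinations. *)
Lemma solve_riemann_relations (v : bool * bool -> bool * bool -> C R) :
  (forall a b, (a.1 && b.1) (+) (a.2 && b.2) -> v a b = 0) ->
  (forall a b, 4 * v a b
     = \sum_(c <- bits2) \sum_(d <- bits2) sgnz (dotz b c + dotz a d) * v c d) ->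
  let t1 := v (true, true) (true, true) in
  let t2 := v (true, true) (false, false) in
  let t3 := v (true, false) (false, false) in
  let t4 := v (true, false) (false, true) in
  let t5 := v (false, true) (false, false) in
  let t6 := v (false, false) (false, false) in
  let t7 := v (false, false) (false, true) in
  let t8 := v (false, false) (true, true) in
  let t9 := v (false, false) (true, false) in
  let t10 := v (false, true) (true, false) in
  [/\ t5 = t3 + t9 - t7, t10 = t4 + t9 - t7, t1 = t6 - t3 - t9,
      t2 = t6 - t4 - t9 & t8 = t6 + t7 - t9 - t3 - t4].
Proof.
move=> odd0 rel t1 t2 t3 t4 t5 t6 t7 t8 t9 t10.
have o1 : v (true, false) (true, false) = 0 by exact: odd0.
have o2 : v (true, false) (true, true) = 0 by exact: odd0.
have o3 : v (false, true) (false, true) = 0 by exact: odd0.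
have o4 : v (false, true) (true, true) = 0 by exact: odd0.
have o5 : v (true, true) (true, false) = 0 by exact: odd0.
have o6 : v (true, true) (false, true) = 0 by exact: odd0.
have sg (k : int) : sgnz k = (if odd `|k| then -1 else 1) :> C R.
  by rewrite /sgnz -signr_odd; case: odd; rewrite ?expr0 ?expr1.
have r1 : t1 + t2 - t3 + t4 - t5 + t6 - t7 + t8 - t9 + t10 - 4 * t1 = 0.
  have -> : 4 * t1 = _ := rel _ _.
  rewrite !big_cons !big_nil.
   rewrite o1 o2 o3 o4 o5 o6 !mulr0 !sg /dotz /=.
  by rewrite -/t1 -/t2 -/t3 -/t4 -/t5 -/t6 -/t7 -/t8 -/t9 -/t10; ring.
have r2 : t1 + t2 + t3 - t4 + t5 + t6 - t7 + t8 - t9 - t10 - 4 * t2 = 0.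
  have -> : 4 * t2 = _ := rel _ _.
  rewrite !big_cons !big_nil.
  rewrite o1 o2 o3 o4 o5 o6 !mulr0 !sg /dotz /=.
  by rewrite -/t1 -/t2 -/t3 -/t4 -/t5 -/t6 -/t7 -/t8 -/t9 -/t10; ring.
have r3 : - t1 + t2 + t3 + t4 + t5 + t6 + t7 - t8 - t9 - t10 - 4 * t3 = 0.
  have -> : 4 * t3 = _ := rel _ _.
  rewrite !big_cons !big_nil.
  rewrite o1 o2 o3 o4 o5 o6 !mulr0 !sg /dotz /=.
  by rewrite -/t1 -/t2 -/t3 -/t4 -/t5 -/t6 -/t7 -/t8 -/t9 -/t10; ring.
have r4 : t1 - t2 + t3 + t4 - t5 + t6 + t7 - t8 - t9 + t10 - 4 * t4 = 0.
  have -> : 4 * t4 = _ := rel _ _.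
  rewrite !big_cons !big_nil.
  rewrite o1 o2 o3 o4 o5 o6 !mulr0 !sg /dotz /=.
  by rewrite -/t1 -/t2 -/t3 -/t4 -/t5 -/t6 -/t7 -/t8 -/t9 -/t10; ring.
have r5 : - t1 + t2 + t3 - t4 + t5 + t6 - t7 - t8 + t9 + t10 - 4 * t5 = 0.
  have -> : 4 * t5 = _ := rel _ _.
  rewrite !big_cons !big_nil.
  rewrite o1 o2 o3 o4 o5 o6 !mulr0 !sg /dotz /=.
  by rewrite -/t1 -/t2 -/t3 -/t4 -/t5 -/t6 -/t7 -/t8 -/t9 -/t10; ring.
split.
- apply/eqP; rewrite -subr_eq0; apply/eqP.
  have -> : t5 - (t3 + t9 - t7)
    = (1 / 6) * (t1 + t2 - t3 + t4 - t5 + t6 - t7 + t8 - t9 + t10 - 4 * t1)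
      + (- (1 / 6)) * (t1 + t2 + t3 - t4 + t5 + t6 - t7 + t8 - t9 - t10 - 4 * t2)
      + (1 / 6) * (- t1 + t2 + t3 + t4 + t5 + t6 + t7 - t8 - t9 - t10 - 4 * t3)
      + (1 / 3) * (t1 - t2 + t3 + t4 - t5 + t6 + t7 - t8 - t9 + t10 - 4 * t4)
      + (- (1 / 2)) * (- t1 + t2 + t3 - t4 + t5 + t6 - t7 - t8 + t9 + t10 - 4 * t5).
    by field.
  by rewrite r1 r2 r3 r4 r5 !mulr0 ?addr0.
- apply/eqP; rewrite -subr_eq0; apply/eqP.
  have -> : t10 - (t4 + t9 - t7)
    = (1 / 3) * (t1 + t2 - t3 + t4 - t5 + t6 - t7 + t8 - t9 + t10 - 4 * t1)
      + (- (1 / 3)) * (t1 + t2 + t3 - t4 + t5 + t6 - t7 + t8 - t9 - t10 - 4 * t2)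
      + (- (1 / 6)) * (- t1 + t2 + t3 + t4 + t5 + t6 + t7 - t8 - t9 - t10 - 4 * t3)
      + (2 / 3) * (t1 - t2 + t3 + t4 - t5 + t6 + t7 - t8 - t9 + t10 - 4 * t4)
      + (- (1 / 2)) * (- t1 + t2 + t3 - t4 + t5 + t6 - t7 - t8 + t9 + t10 - 4 * t5).
    by field.
  by rewrite r1 r2 r3 r4 r5 !mulr0 ?addr0.
- apply/eqP; rewrite -subr_eq0; apply/eqP.
  have -> : t1 - (t6 - t3 - t9)
    = (- (1 / 3)) * (t1 + t2 - t3 + t4 - t5 + t6 - t7 + t8 - t9 + t10 - 4 * t1)
      + (- (1 / 6)) * (t1 + t2 + t3 - t4 + t5 + t6 - t7 + t8 - t9 - t10 - 4 * t2)
      + (- (1 / 3)) * (- t1 + t2 + t3 + t4 + t5 + t6 + t7 - t8 - t9 - t10 - 4 * t3)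
      + (- (1 / 6)) * (t1 - t2 + t3 + t4 - t5 + t6 + t7 - t8 - t9 + t10 - 4 * t4).
    by field.
  by rewrite r1 r2 r3 r4 !mulr0 ?addr0.
- apply/eqP; rewrite -subr_eq0; apply/eqP.
  have -> : t2 - (t6 - t4 - t9)
    = (- (1 / 6)) * (t1 + t2 - t3 + t4 - t5 + t6 - t7 + t8 - t9 + t10 - 4 * t1)
      + (- (1 / 3)) * (t1 + t2 + t3 - t4 + t5 + t6 - t7 + t8 - t9 - t10 - 4 * t2)
      + (- (1 / 6)) * (- t1 + t2 + t3 + t4 + t5 + t6 + t7 - t8 - t9 - t10 - 4 * t3)
      + (- (1 / 3)) * (t1 - t2 + t3 + t4 - t5 + t6 + t7 - t8 - t9 + t10 - 4 * t4).
    by field.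
  by rewrite r1 r2 r3 r4 !mulr0 ?addr0.
- apply/eqP; rewrite -subr_eq0; apply/eqP.
  have -> : t8 - (t6 + t7 - t9 - t3 - t4)
    = (- (1 / 2)) * (- t1 + t2 + t3 + t4 + t5 + t6 + t7 - t8 - t9 - t10 - 4 * t3)
      + (- (1 / 2)) * (t1 - t2 + t3 + t4 - t5 + t6 + t7 - t8 - t9 + t10 - 4 * t4).
    by field.
  by rewrite r3 r4 !mulr0 ?addr0.
Qed.

Definition theta_relations (t : nat -> C R) : Prop :=
  [/\ t 5%N = t 3%N + t 9%N - t 7%N, t 10%N = t 4%N + t 9%N - t 7%N, t 1%N = t 6%N - t 3%N - t 9%N,
      t 2%N = t 6%N - t 4%N - t 9%N & t 8%N = t 6%N + t 7%N - t 9%N - t 3%N - t 4%N].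

Lemma theta_square_relations W : H2 W ->
  theta_relations (fun k => Theta k W ^+ 2).
Proof.
move=> HW; have := solve_riemann_relations (fun a b => theta2 a b W).
move=> /(_ _ (fun a b => riemann_relation a b W HW)); apply => a b ab.
by rewrite /theta2 theta_odd_eq0 // expr0n.
Qed.

End ThetaRelations.

(** * Algebra of the master equation *)

Section MasterAlgebra.
Context {R : realType}.
Implicit Types (W : 'M[C R]_2) (t : nat -> C R) (w z : C R).

Definition lin t : C R := t 7%N * t 8%N - t 10%N * t 5%N + t 6%N * t 9%N.

(** Discriminant of [t 8 * w ^+ 2 - lin t * w + t 6 * t 7 * t 9], the quadratic polynomial satisfied
    by [omega0 ^ 2]. *)
Definition disc t : C R := lin t ^+ 2 - 4 * (t 7%N * t 8%N * t 6%N * t 9%N).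

Lemma igusa_quartic t : theta_relations t ->
  12^-1 * ((\sum_(1 <= k < 11) t k ^+ 2) ^+ 2 - 4 * \sum_(1 <= k < 11) t k ^+ 4)
  = disc t.
Proof.
move=> [t5 t10 t1 t2 t8].
by rewrite unlock /= /disc /lin t5 t10 t1 t2 t8; field.
Qed.

Lemma tTheta_sqr (T : 'M[C R]_2 -> C R) W : is_tTheta T -> H2 W ->
  T W ^+ 2 = disc (fun k => Theta k W ^+ 2).
Proof.
move=> [_ _ Tsq _] HW; rewrite Tsq //.
rewrite -(igusa_quartic _ (theta_square_relations W HW)).
by congr (_ * (_ ^+ 2 - _ * _)); apply: eq_bigr => k _; rewrite -exprM.
Qed.

Lemma quadratic_root t T w : T ^+ 2 = disc t -> t 8%N != 0 ->
  w = (2 * t 8%N)^-1 * (lin t - T) ->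
  t 8%N * w ^+ 2 - lin t * w + t 6%N * t 7%N * t 9%N = 0.
Proof.
move=> Tsq t80 wE.
have TE : T = lin t - 2 * t 8%N * w by rewrite wE; field.
move: Tsq; rewrite TE /disc => /eqP; rewrite -subr_eq0 => /eqP sq.
apply: (mulfI (_ : 4 * t 8%N != 0)); first by rewrite mulf_neq0.
by rewrite mulr0 -[RHS]sq; ring.
Qed.

(** The cubic terms cancel and the difference of the two sides is the quadratic of [quadratic_root].
    For the solution formulas the identity expresses the compatibility
    [z1 * z2 * z4 * w = w - t 6]. *)
Lemma root_cubic t T w : theta_relations t -> T ^+ 2 = disc t -> t 8%N != 0 ->
  w = (2 * t 8%N)^-1 * (lin t - T) ->
  w * (t 3%N + t 9%N - w) * (t 4%N + t 9%N - w)
  = (w - t 6%N) * (w - t 7%N) * (w - t 9%N).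
Proof.
move=> [t5 t10 t1 t2 t8] Tsq t80 wE.
have Q := quadratic_root _ _ _ Tsq t80 wE.
apply/eqP; rewrite -subr_eq0 -Q /lin t8 t10 t5; apply/eqP; ring.
Qed.

Definition masterz t w z1 z2 z3 z4 : Prop :=
  [/\ [/\ P0 z1 z2 z3 z4 * w = t 8%N, P1 z1 z2 z3 z4 * w = t 1%N,
          P2 z1 z2 z3 z4 * w = - t 9%N, P3 z1 z2 z3 z4 * w = - t 7%N
        & P4 z1 z2 z3 z4 * w = t 2%N]
    & [/\ P6 z1 z2 z3 z4 * w = - t 10%N, P7 z1 z2 z3 z4 * w = t 3%N,
          P8 z1 z2 z3 z4 * w = t 5%N, P9 z1 z2 z3 z4 * w = - t 4%N
        & P10 z1 z2 z3 z4 * w = t 6%N]].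

Definition formulaz t w z1 z2 z3 z4 : Prop :=
  [/\ z1 = (t 3%N + t 9%N - w) / (w - t 7%N),
      z2 = (t 3%N + t 9%N - w) / (w - t 9%N),
      z3 = ((w - t 7%N) * (w - t 9%N)) / (w * (t 4%N + t 9%N - w))
    & z4 = (t 4%N + t 9%N - w) / (t 3%N + t 9%N - w)].

(** After multiplication by [w], every P_s is a linear combination of [w] and five monomials. The
    formulas give these monomials the values [w - t 6], [F], [G], [D], [E], the first through the
    cubic, and the ten equations become linear relations. *)
Lemma formula_master t T w z1 z2 z3 z4 : theta_relations t -> T ^+ 2 = disc t ->
  t 8%N != 0 -> w = (2 * t 8%N)^-1 * (lin t - T) ->
  w != 0 -> w - t 7%N != 0 -> w - t 9%N != 0 -> t 4%N + t 9%N - w != 0 ->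
  t 3%N + t 9%N - w != 0 -> formulaz t w z1 z2 z3 z4 -> masterz t w z1 z2 z3 z4.
Proof.
move=> Ht Tsq t80 wE w0 F0 G0 E0 D0 [z1E z2E z3E z4E].
have cubic := root_cubic _ _ _ Ht Tsq t80 wE.
case: Ht => t5E t10E t1E t2E t8E {wE t80 Tsq}.
rewrite /masterz /P0 /P1 /P2 /P3 /P4 /P6 /P7 /P8 /P9 /P10.
set D := t 3%N + t 9%N - w in z1E z2E z4E D0 cubic.
set E := t 4%N + t 9%N - w in z3E z4E E0 cubic.
set F := w - t 7%N in z1E z3E F0 cubic.
set G := w - t 9%N in z2E z3E G0 cubic.
have a : z1 * z2 * z4 * w = w - t 6%N.
  apply: (mulIf (mulf_neq0 F0 G0)); rewrite z1E z2E z4E [RHS]mulrA -cubic.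
  by field; rewrite F0 G0 D0.
have b : z2 * z3 * z4 * w = F by rewrite z2E z3E z4E; field; rewrite w0 G0 D0 E0.
have c : z1 * z3 * z4 * w = G by rewrite z1E z3E z4E; field; rewrite w0 F0 D0 E0.
have e : z1 * z2 * z3 * z4 * w = D.
  by rewrite z1E z2E z3E z4E; field; rewrite w0 F0 G0 D0 E0.
have f : z1 * z2 * z3 * z4 ^+ 2 * w = E.
  by rewrite expr2 mulrA [_ * w]mulrAC e z4E; field.
split; split.
- have -> : (1 - (z1 * z2 + z1 * z3 + z2 * z3 + z1 * z2 * z3) * z4
    - z1 * z2 * z3 * z4 ^+ 2) * w
    = w - z1 * z2 * z4 * w - z1 * z3 * z4 * w - z2 * z3 * z4 * w
      - z1 * z2 * z3 * z4 * w - z1 * z2 * z3 * z4 ^+ 2 * w by ring.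
  by rewrite a b c e f t8E /D /E /F /G; ring.
- have -> : - z1 * z2 * (1 + z3) * z4 * w
    = - (z1 * z2 * z4 * w) - z1 * z2 * z3 * z4 * w by ring.
  by rewrite a e t1E /D; ring.
- have -> : (-1 + z1 * z3 * z4) * w = - w + z1 * z3 * z4 * w by ring.
  by rewrite c /G; ring.
- have -> : (-1 + z2 * z3 * z4) * w = - w + z2 * z3 * z4 * w by ring.
  by rewrite b /F; ring.
- have -> : - z1 * z2 * (1 + z3 * z4) * z4 * w
    = - (z1 * z2 * z4 * w) - z1 * z2 * z3 * z4 ^+ 2 * w by ring.
  by rewrite a f t2E /E; ring.
- have -> : - (1 + z1 * z4) * z2 * z3 * z4 * w
    = - (z2 * z3 * z4 * w) - z1 * z2 * z3 * z4 ^+ 2 * w by ring.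
  by rewrite b f t10E /F /E; ring.
- have -> : z1 * (1 + z2) * z3 * z4 * w
    = z1 * z3 * z4 * w + z1 * z2 * z3 * z4 * w by ring.
  by rewrite c e /G /D; ring.
- have -> : (1 + z1) * z2 * z3 * z4 * w
    = z2 * z3 * z4 * w + z1 * z2 * z3 * z4 * w by ring.
  by rewrite b e t5E /F /D; ring.
- have -> : - z1 * z3 * z4 * (1 + z2 * z4) * w
    = - (z1 * z3 * z4 * w) - z1 * z2 * z3 * z4 ^+ 2 * w by ring.
  by rewrite c f /G /E; ring.
- have -> : (1 - z1 * z2 * z4) * w = w - z1 * z2 * z4 * w by ring.
  by rewrite a; ring.
Qed.

(** On solutions of the master equation the discriminant is a perfect square, and this is the
    nonmonomial factor of its square root. *)
Definition Qpoly (z1 z2 z3 z4 : C R) : C R :=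
  1 + z4 * (1 + z1 + z2 + z3) - z1 * z2 * z3 * z4 ^+ 2.

Lemma masterz_values t w z1 z2 z3 z4 : masterz t w z1 z2 z3 z4 ->
  [/\ t 3%N = P7 z1 z2 z3 z4 * w, t 4%N = - (P9 z1 z2 z3 z4 * w),
      t 7%N = - (P3 z1 z2 z3 z4 * w) & t 9%N = - (P2 z1 z2 z3 z4 * w)]
  /\ [/\ t 5%N = P8 z1 z2 z3 z4 * w, t 6%N = P10 z1 z2 z3 z4 * w,
         t 8%N = P0 z1 z2 z3 z4 * w & t 10%N = - (P6 z1 z2 z3 z4 * w)].
Proof.
by move=> [[e0 e1 e2 e3 e4] [e6 e7 e8 e9 e10]]; rewrite e0 e2 e3 e6 e7 e8 e9 e10 !opprK.
Qed.

Lemma master_disc t w z1 z2 z3 z4 : masterz t w z1 z2 z3 z4 ->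
  disc t = (w ^+ 2 * (z1 * z2 * z3 * z4) * Qpoly z1 z2 z3 z4) ^+ 2.
Proof.
move=> /masterz_values[[_ _ t7 t9] [t5 t6 t8 t10]].
rewrite /disc /lin t5 t6 t7 t8 t9 t10 /P0 /P2 /P3 /P6 /P8 /P10 /Qpoly; ring.
Qed.

(** The choice of square root of [disc t] decides which root of the quadratic [w] is; the opposite
    choice gives the formula with [- T]. *)
Lemma master_root t T w z1 z2 z3 z4 : t 8%N != 0 -> masterz t w z1 z2 z3 z4 ->
  T = w ^+ 2 * (z1 * z2 * z3 * z4) * Qpoly z1 z2 z3 z4 ->
  w = (2 * t 8%N)^-1 * (lin t - T).
Proof.
move=> t80 /masterz_values[[_ _ t7 t9] [t5 t6 t8 t10]] ->.
have nz2 : 2 * t 8%N != 0 by rewrite mulf_neq0.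
apply: (mulfI nz2); rewrite mulVKf //.
rewrite /lin t5 t6 t7 t8 t9 t10 /P0 /P2 /P3 /P6 /P8 /P10 /Qpoly; ring.
Qed.

(** The numerators and denominators of the formulas are monomials in the [z] times [w], and their
    quotients isolate the single coordinates. *)
Lemma master_formula t w z1 z2 z3 z4 :
  z1 != 0 -> z2 != 0 -> z3 != 0 -> z4 != 0 -> w != 0 ->
  masterz t w z1 z2 z3 z4 -> formulaz t w z1 z2 z3 z4.
Proof.
move=> z10 z20 z30 z40 w0 /masterz_values[[t3 t4 t7 t9] _].
rewrite /formulaz t3 t4 t7 t9 /P2 /P3 /P7 /P9.
have -> : z1 * (1 + z2) * z3 * z4 * w - (- 1 + z1 * z3 * z4) * w - w
  = z1 * z2 * z3 * z4 * w by ring.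
have -> : - (- z1 * z3 * z4 * (1 + z2 * z4) * w) - (- 1 + z1 * z3 * z4) * w - w
  = z1 * z2 * z3 * z4 ^+ 2 * w by ring.
have -> : w - - ((-1 + z2 * z3 * z4) * w) = z2 * z3 * z4 * w by ring.
have -> : w - - ((-1 + z1 * z3 * z4) * w) = z1 * z3 * z4 * w by ring.
by split; field; rewrite ?z10 ?z20 ?z30 ?z40 ?w0.
Qed.

Lemma formula_part (T : 'M[C R]_2 -> C R) W (z1 z2 z3 z4 omega0 : C R) :
  is_tTheta T -> H2 W -> omega0 ^+ 2 = sol_omega0_sq W (T W) ->
  denominators_neq0 W (omega0 ^+ 2) ->
  is_solution_formula W (omega0 ^+ 2) z1 z2 z3 z4 ->
  master_equation W z1 z2 z3 z4 omega0.
Proof.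
move=> HT HW wE [[Th8 w0 F0] G0 E0 D0] fz.
have t80 : Theta 8 W ^+ 2 != 0 by rewrite expf_neq0.
exact: (formula_master (fun k => Theta k W ^+ 2) _ _ _ _ _ _
  (theta_square_relations W HW) (tTheta_sqr T W HT HW) t80 wE w0 F0 G0 E0 D0 fz).
Qed.

Lemma unique_part (T : 'M[C R]_2 -> C R) W (z1 z2 z3 z4 omega0 : C R) :
  is_tTheta T -> H2 W -> Theta 8 W != 0 -> z1 * z2 * z3 * z4 * omega0 != 0 ->
  master_equation W z1 z2 z3 z4 omega0 ->
  is_solution_formula W (omega0 ^+ 2) z1 z2 z3 z4 /\
  (omega0 ^+ 2 = sol_omega0_sq W (T W) \/ omega0 ^+ 2 = sol_omega0_sq W (- T W)).
Proof.
move=> HT HW Th8 + mz.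
rewrite !mulf_eq0 !negb_or => /andP[/andP[/andP[/andP[z10 z20] z30] z40] w0].
have {}mz : masterz (fun k => Theta k W ^+ 2) (omega0 ^+ 2) z1 z2 z3 z4 := mz.
have t80 : Theta 8 W ^+ 2 != 0 by rewrite expf_neq0.
have {}w0 : omega0 ^+ 2 != 0 by rewrite expf_neq0.
split; first exact: (master_formula _ _ _ _ _ _ z10 z20 z30 z40 w0 mz).
have := tTheta_sqr T W HT HW; rewrite (master_disc _ _ _ _ _ _ mz) => /eqP.
rewrite eqf_sqr => /orP[/eqP TE|/eqP TE]; [left|right].
  exact: (master_root _ _ _ _ _ _ _ t80 mz TE).
by apply: (master_root _ _ _ _ _ _ _ t80 mz); rewrite TE opprK.
Qed.

End MasterAlgebra.

(** * Leading terms near the boundary point *)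

Section LeadingTerms.
Context {R : realType}.
Implicit Type W : 'M[C R]_2.

Definition alpha W : C R := (w12 W - 'i * w21 W) / (1 - 'i).
Definition beta W : C R := (w12 W + 'i * w21 W) / (1 + 'i).

(* Logarithms of the monomials [q1 / q3], [q2 / q3], [q4], [q3 / q4]. *)
Definition log1 W : C R := cpi R * 'i * (w11 W - alpha W).
Definition log2 W : C R := cpi R * 'i * (w22 W - alpha W).
Definition log3 W : C R := cpi R * 'i * beta W.
Definition log4 W : C R := cpi R * 'i * (alpha W - beta W).

(** The exponents multiply fixed logarithms, so the half-integral powers that occur have a definite
    branch. *)
Definition mono W (e1 e2 e3 e4 : R) : C R :=
  cexp (e1%:C%C * log1 W + e2%:C%C * log2 W + e3%:C%C * log3 W + e4%:C%C * log4 W).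

Lemma monoD W e1 e2 e3 e4 f1 f2 f3 f4 :
  mono W (e1 + f1) (e2 + f2) (e3 + f3) (e4 + f4)
  = mono W e1 e2 e3 e4 * mono W f1 f2 f3 f4.
Proof.
rewrite /mono -[RHS]cexpD; congr cexp; rewrite !(rmorphD (real_complex R)) /=; ring.
Qed.

Lemma nm_mono W e1 e2 e3 e4 : nm (mono W e1 e2 e3 e4)
  = expR (e1 * complex.Re (log1 W) + e2 * complex.Re (log2 W)
          + e3 * complex.Re (log3 W) + e4 * complex.Re (log4 W)).
Proof.
rewrite nm_cexp; congr expR; move: (log1 W) (log2 W) (log3 W) (log4 W).
by move=> [a a'] [b b'] [c c'] [d d'] /=; ring.
Qed.

Lemma q1E W : q1 W / q3 W = mono W 1 0 0 0.
Proof.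
rewrite /mono mul1r !mul0r !addr0 /q1 /q3 -/(alpha W) -cexpN -[LHS]cexpD.
by rewrite /log1; congr cexp; ring.
Qed.

Lemma q2E W : q2 W / q3 W = mono W 0 1 0 0.
Proof.
rewrite /mono mul1r !mul0r !addr0 add0r /q2 /q3 -/(alpha W) -cexpN -[LHS]cexpD.
by rewrite /log2; congr cexp; ring.
Qed.

Lemma q4E W : q4 W = mono W 0 0 1 0.
Proof. by rewrite /mono mul1r !mul0r !addr0 !add0r. Qed.

Lemma q34E W : q3 W / q4 W = mono W 0 0 0 1.
Proof.
rewrite /mono mul1r !mul0r !add0r /q3 /q4 -/(alpha W) -/(beta W) -cexpN -[LHS]cexpD.
by rewrite /log4; congr cexp; ring.
Qed.

(** With v1 = x1 + i y1 and v2 = x2 + i y2 the exponents are |v1|^2, |v2|^2, |v1 + v2|^2 and half of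
    |v1|^2 + |v1 + (1 - i) v2|^2; their nonnegativity makes the four monomials adapted to o1. *)
Lemma gauss_termE W (x1 y1 x2 y2 : R) :
  gauss_term W x1%:C%C y1%:C%C x2%:C%C y2%:C%C
  = mono W (x1 ^+ 2 + y1 ^+ 2) (x2 ^+ 2 + y2 ^+ 2)
      ((x1 + x2) ^+ 2 + (y1 + y2) ^+ 2)
      ((x1 ^+ 2 + y1 ^+ 2 + ((x1 + x2 + y2) ^+ 2 + (y1 + y2 - x2) ^+ 2)) / 2).
Proof.
rewrite /gauss_term /mono /log1 /log2 /log3 /log4; congr cexp.
rewrite !(rmorphD, rmorphN, rmorphM, rmorphXn, fmorphV, rmorph_nat) /=.
have i2 : 'i * 'i = -1 :> C R by rewrite -expr2 sqrCi.
have V1 : (1 - 'i)^-1 = (1 + 'i) / 2 :> C R.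
  have h : (1 - 'i) * ((1 + 'i) / 2) = 1 :> C R by field: i2.
  have n0 : (1 - 'i) != 0 :> C R by apply: contra_eq_neq h => ->; rewrite mul0r eq_sym oner_neq0.
  by apply: (mulfI n0); rewrite h divff.
have V2 : (1 + 'i)^-1 = (1 - 'i) / 2 :> C R.
  have h : (1 + 'i) * ((1 - 'i) / 2) = 1 :> C R by field: i2.
  have n0 : (1 + 'i) != 0 :> C R by apply: contra_eq_neq h => ->; rewrite mul0r eq_sym oner_neq0.
  by apply: (mulfI n0); rewrite h divff.
by rewrite /alpha /beta V1 V2 /herm; field: i2.
Qed.

Definition log_near W (d : R) : Prop :=
  [/\ expR (complex.Re (log1 W)) < d, expR (complex.Re (log2 W)) < d,
      expR (complex.Re (log3 W)) < d & expR (complex.Re (log4 W)) < d].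

Lemma near_o1E W (d : R) : near_o1 d%:C%C W <-> log_near W d.
Proof.
rewrite /near_o1 /log_near q1E q2E q34E q4E !lt_nm !nm_mono.
by rewrite !mul1r !mul0r !addr0 !add0r.
Qed.

(** One factor [d] is kept and the remaining [tot - 1] are replaced by 1/2. Since [tot - 1] is at
    least [u - 5], this costs 2^5 = 32. *)
Lemma expR_near (u : nat) (k d tot : R) : 0 < d -> d <= 1 / 2 ->
  1 <= tot -> u%:R <= tot + 4 -> k <= ln d * tot ->
  expR k <= d * 32 * (1 / 2) ^+ u.
Proof.
move=> d0 d12 t1 tu kt.
have h0 : 0 < 1 / 2 :> R by rewrite divr_gt0.
have ld : ln d <= ln (1 / 2) by rewrite ler_ln // posrE.
have l2 : ln (1 / 2) < 0 :> R by apply: ln_lt0; rewrite h0 /=; lra.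
have -> : d * 32 * (1 / 2) ^+ u = expR (ln d + ln (1 / 2) * (u%:R - 5)).
  have -> : ln (1 / 2) * (u%:R - 5) = u%:R * ln (1 / 2) - 5%:R * ln (1 / 2) :> R.
    by ring.
  rewrite expRD lnK ?posrE // expRD expRN !expRM_natl lnK ?posrE //.
  have -> : ((1 / 2) ^+ 5)^-1 = 32 :> R by field.
  by ring.
by rewrite ler_expR; nra.
Qed.

(** The [l] are the exponents of the leading monomial, the [D] the integral excesses of the other
    terms ([D4] counted in halves), and [A] lists the leading indices. Outside [A] the total excess
    is at least 1, which yields the factor [d], while [D1 + D2] controls [norm1] and so ensures
    summability. *)
Lemma leading_terms (W : 'M[C R]_2) (d : R) (a1 a2 : bool) (sigma : Z4 -> C R)
    (v : C R) (l1 l2 l3 l4 : R) (D1 D2 D3 D4 : Z4 -> int) (A : seq Z4) :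
  0 < d -> d <= 1 / 2 -> log_near W d ->
  (forall n, nm (sigma n) <= 1) ->
  has_sum (fun n : Z4 => gauss_term W (shift2 n.1.1 a1) (shift2 n.1.2 a1)
      (shift2 n.2.1 a2) (shift2 n.2.2 a2) * sigma n) v ->
  (forall n : Z4, let x1 := shift2R n.1.1 a1 in let y1 := shift2R n.1.2 a1 in
    let x2 := shift2R n.2.1 a2 in let y2 := shift2R n.2.2 a2 in
    [/\ x1 ^+ 2 + y1 ^+ 2 = l1 + (D1 n)%:~R, x2 ^+ 2 + y2 ^+ 2 = l2 + (D2 n)%:~R,
        (x1 + x2) ^+ 2 + (y1 + y2) ^+ 2 = l3 + (D3 n)%:~R
      & (x1 ^+ 2 + y1 ^+ 2 + ((x1 + x2 + y2) ^+ 2 + (y1 + y2 - x2) ^+ 2)) / 2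
        = l4 + (D4 n)%:~R / 2]) ->
  uniq A ->
  (forall n, n \in A -> [/\ D1 n = 0, D2 n = 0, D3 n = 0 & D4 n = 0]) ->
  (forall n, n \notin A -> sigma n = 0 \/
    [/\ 0 <= D1 n, 0 <= D2 n, 0 <= D3 n & 0 <= D4 n] /\
    2 <= 2 * D1 n + 2 * D2 n + 2 * D3 n + D4 n /\ (norm1 n)%:Z <= D1 n + D2 n + 4) ->
  nm (v - mono W l1 l2 l3 l4 * \sum_(n <- A) sigma n)
  <= nm (mono W l1 l2 l3 l4) * (8192 * d).
Proof.
move=> d0 d12 [near1 near2 near3 near4] sigma1 fv eE uA DA DN.
set m := mono W l1 l2 l3 l4.
pose AA : {fset Z4} := [fset n in A]%fset.
pose f (n : Z4) := gauss_term W (shift2 n.1.1 a1) (shift2 n.1.2 a1)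
      (shift2 n.2.1 a2) (shift2 n.2.2 a2) * sigma n.
have fE n : f n = m * mono W (D1 n)%:~R (D2 n)%:~R (D3 n)%:~R ((D4 n)%:~R / 2) * sigma n.
  rewrite /f !shift2_real gauss_termE -monoD.
  by have [-> -> -> ->] := eE n.
have -> : m * \sum_(n <- A) sigma n = \sum_(n <- AA) f n.
  have -> : \sum_(n <- AA) f n = \sum_(n <- A) f n.
    by apply/perm_big/uniq_perm; rewrite ?fset_uniq // => n; rewrite !inE.
  rewrite mulr_sumr; apply: eq_big_seq => n /DA[z1 z2 z3 z4].
  by rewrite fE z1 z2 z3 z4 mul0r /mono !mul0r !addr0 cexp0 mulr1.
have half01 : 0 <= (1 / 2 : R) < 1 by lra.
(* 32 comes from [expR_near] and 4^4 from the geometric series of ratio 1/2 over Z^4. *)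
have -> : nm m * (8192 * d) = (nm m * (d * 32)) * (2 * (1 - 1 / 2)^-1) ^+ 4.
  by field.
apply: (has_sum_lead _ _ _ _ _ _ _ fv _ (sums_le_geom4 _ half01)).
- by move=> n; apply: geom4_ge0; lra.
- by rewrite !mulr_ge0 ?nm_ge0 // ltW.
move=> n; rewrite !inE => /DN[->|[[n1 n2 n3 n4] [tot nn]]].
  rewrite mulr0 nm0 !mulr_ge0 ?nm_ge0 ?geom4_ge0 //; lra.
rewrite -/(f n) fE (nmM _ (sigma n)) (nmM m) geom4E -[leLHS]mulrA -[leRHS]mulrA ler_wpM2l ?nm_ge0 //.
have lnlt (x : R) : expR x < d -> x <= ln d 
  by move=> xd; rewrite -(expRK x) ler_ln ?posrE ?expR_gt0 // ltW.
have pos (k : int) : 0 <= k -> 0 <= k%:~R :> R by rewrite ler0z.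
have [{}n1 {}n2 {}n3 {}n4] := And4 (pos _ n1) (pos _ n2) (pos _ n3) (pos _ n4).
have {}tot : 2 <= 2 * (D1 n)%:~R + 2 * (D2 n)%:~R + 2 * (D3 n)%:~R + (D4 n)%:~R :> R.
  by have := tot; rewrite -(ler_int R) !intrD !intrM.
have {}nn : (norm1 n)%:R <= (D1 n)%:~R + (D2 n)%:~R + 4 :> R.
  by have := nn; rewrite -(ler_int R) !intrD.
apply: (@le_trans _ _ (nm (mono W (D1 n)%:~R (D2 n)%:~R (D3 n)%:~R ((D4 n)%:~R / 2)))).
  by rewrite ler_piMr ?nm_ge0.
rewrite nm_mono; apply: (expR_near _ _ _ ((D1 n)%:~R + (D2 n)%:~R + (D3 n)%:~R + (D4 n)%:~R / 2)) => //.
- by lra.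
- by lra.
move/lnlt: near1; move/lnlt: near2; move/lnlt: near3; move/lnlt: near4.
move: (complex.Re _) (complex.Re _) (complex.Re _) (complex.Re _) => r4 r3 r2 r1.
move: (ln d) (D1 n)%:~R (D2 n)%:~R (D3 n)%:~R (D4 n)%:~R n1 n2 n3 n4 => L e1 e2 e3 e4.
by move=> *; nra.
Qed.

End LeadingTerms.

Arguments nm : simpl never.
Arguments mono : simpl never.
Arguments cexp : simpl never.

(** * Leading terms of the individual theta series *)

Section ThetaExpansions.
Context {R : realType}.
Implicit Types (W : 'M[C R]_2) (d : R).

Local Notation th a1 a2 b1 b2 W :=
  (theta (half_char R (nat_of_bool a1) (nat_of_bool a2))
         (half_char R (nat_of_bool b1) (nat_of_bool b2)) W).

Lemma sqrz_parity (x : int) : exists k, x * x = x + 2 * k.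
Proof.
have [->|->] : x = 2 * (x %/ 2)%Z \/ x = 2 * (x %/ 2)%Z + 1 by lia.
- by exists (2 * (x %/ 2)%Z * (x %/ 2)%Z - (x %/ 2)%Z); ring.
- by exists (2 * (x %/ 2)%Z * (x %/ 2)%Z + (x %/ 2)%Z); ring.
Qed.

Lemma sqrz_ge0 (x : int) : 0 <= x * x. Proof. by nia. Qed.

Lemma absz_ge0 (x : int) : 0 <= `|x|%N%:Z. Proof. by []. Qed.

Lemma sqrz_ge_abs (x : int) : `|x|%N%:Z <= x * x. Proof. by nia. Qed.

Lemma sqrz_ge1 (x : int) : x != 0 -> 1 <= x * x. Proof. by nia. Qed.

Lemma sqrz_add_ge0 (x : int) : 0 <= x * x + x. Proof. by nia. Qed.

Lemma sqrz_add_ge_abs (x : int) : `|x|%N%:Z - 1 <= x * x + x.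
Proof. by nia. Qed.

Lemma sqrz_add_ge2 (x : int) : x != 0 -> x != -1 -> 2 <= x * x + x.
Proof. by nia. Qed.

Lemma theta00_near W d (b1 b2 : bool) : H2 W -> 0 < d -> d <= 1 / 2 ->
  log_near W d -> nm (th false false b1 b2 W - 1) <= 8192 * d.
Proof.
move=> HW d0 d12 near.
have := leading_terms W d false false
  (fun n => sgnz (b1%:Z * (n.1.1 + n.1.2) + b2%:Z * (n.2.1 + n.2.2))) _ 0 0 0 0
  (fun n => n.1.1 * n.1.1 + n.1.2 * n.1.2)
  (fun n => n.2.1 * n.2.1 + n.2.2 * n.2.2)
  (fun n => (n.1.1 + n.2.1) * (n.1.1 + n.2.1) + (n.1.2 + n.2.2) * (n.1.2 + n.2.2))
  (fun n => n.1.1 * n.1.1 + n.1.2 * n.1.2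
            + ((n.1.1 + n.2.1 + n.2.2) * (n.1.1 + n.2.1 + n.2.2)
               + (n.1.2 + n.2.2 - n.2.1) * (n.1.2 + n.2.2 - n.2.1)))
  [:: ((0, 0), (0, 0))] d0 d12 near _ (theta_has_sum _ _ _ _ W HW).
rewrite big_seq1 /= !mulr0 sgnz0 mulr1.
have -> : mono W 0 0 0 0 = 1 by rewrite /mono !mul0r !addr0 cexp0.
rewrite nm1 mul1r; apply => //.
- by move=> n; rewrite nm_sgnz.
- move=> [[x1 y1] [x2 y2]] /=; rewrite /shift2R /=.
  by split; rewrite !(intrD, intrN, intrM); field.
- by move=> n; rewrite inE => /eqP ->.
move=> [[x1 y1] [x2 y2]]; rewrite inE => n0; right; rewrite /norm1 /=.
have {}n0 : x1 != 0 \/ y1 != 0 \/ x2 != 0 \/ y2 != 0.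
  by move: n0; rewrite !xpair_eqE; lia.
have n1 : 1 <= `|x1|%N%:Z + `|y1|%N%:Z + (`|x2|%N%:Z + `|y2|%N%:Z) by lia.
have := (sqrz_ge_abs x1, sqrz_ge_abs y1, sqrz_ge_abs x2, sqrz_ge_abs y2).
have := (sqrz_ge0 (x1 + x2 + y2), sqrz_ge0 (y1 + y2 - x2)).
have := (sqrz_ge0 (x1 + x2), sqrz_ge0 (y1 + y2)).
have := (absz_ge0 x1, absz_ge0 y1, absz_ge0 x2, absz_ge0 y2).
rewrite !PoszD; move: (`|x1|%N%:Z) (`|y1|%N%:Z) (`|x2|%N%:Z) (`|y2|%N%:Z) n1 => a1 a2 a3 a4.
(* The squares become independent variables subject to the inequalities just collected, which leaves
   linear goals. *)
move: (x1 * x1) (y1 * y1) (x2 * x2) (y2 * y2) ((x1 + x2) * _) ((y1 + y2) * _) => s1 s2 s3 s4 s5 s6.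
move: (_ * _) (_ * _) => s7 s8 n1 [[[g1 g2] g3] g4] [h1 h2] [h3 h4] [[[h5 h6] h7] h8].
split; first by split; lia.
by split; lia.
Qed.

(** Half the difference of [Theta 6] and [Theta 8] keeps the indices with odd coordinate sum. For
    these n1 + n2 is nonzero, so a factor [x3] splits off, and one further small factor remains; the
    list of leading indices is empty. *)
Lemma theta00_odd_part W d : H2 W -> 0 < d -> d <= 1 / 2 -> log_near W d ->
  nm ((th false false false false W - th false false true true W) / 2)
  <= nm (mono W 0 0 1 0) * (8192 * d).
Proof.
move=> HW d0 d12 near.
have fl : has_sum (fun n : Z4 => gauss_term W (shift2 n.1.1 false) (shift2 n.1.2 false)
   (shift2 n.2.1 false) (shift2 n.2.2 false)
   * ((1 - sgnz (n.1.1 + n.1.2 + n.2.1 + n.2.2)) / 2))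
  ((th false false false false W - th false false true true W) / 2).
  rewrite mulrC -[_ - _]/(_ + - _) -mulN1r.
  apply: eq_has_sum (has_sumZ _ _ _ 2^-1 (has_sumD _ _ _ _ _
    (theta_has_sum false false false false W HW)
    (has_sumZ _ _ _ (-1) (theta_has_sum false false true true W HW)))) => n.
  rewrite /theta_summand !mul0r !mul1r addr0 sgnz0 addrA; ring.
have := leading_terms W d false false _ _ 0 0 1 0
  (fun n => n.1.1 * n.1.1 + n.1.2 * n.1.2)
  (fun n => n.2.1 * n.2.1 + n.2.2 * n.2.2)
  (fun n => (n.1.1 + n.2.1) * (n.1.1 + n.2.1) + (n.1.2 + n.2.2) * (n.1.2 + n.2.2) - 1)
  (fun n => n.1.1 * n.1.1 + n.1.2 * n.1.2
            + ((n.1.1 + n.2.1 + n.2.2) * (n.1.1 + n.2.1 + n.2.2)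
               + (n.1.2 + n.2.2 - n.2.1) * (n.1.2 + n.2.2 - n.2.1)))
  [::] d0 d12 near _ fl.
rewrite big_nil mulr0 subr0; apply => //.
- move=> n; rewrite nmM nmV nm_nat ler_pdivrMr //.
  by apply: le_trans (nmB _ _) _; rewrite nm1 nm_sgnz; lra.
- move=> [[x1 y1] [x2 y2]] /=; rewrite /shift2R /=.
  by split; rewrite !(intrD, intrN, intrM); field.
move=> [[x1 y1] [x2 y2]] _; rewrite /norm1 /=.
have [ev|od] : ((x1 + y1 + x2 + y2) %% 2)%Z = 0 \/ ((x1 + y1 + x2 + y2) %% 2)%Z = 1.
- by lia.
- left; rewrite (sgnz_eq _ 0) ?subr0 // sgnz0 subrr mul0r //.
right.
have n0 : x1 != 0 \/ y1 != 0 \/ x2 != 0 \/ y2 != 0 by lia.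
have n1 : 1 <= `|x1|%N%:Z + `|y1|%N%:Z + (`|x2|%N%:Z + `|y2|%N%:Z) by lia.
have := (sqrz_ge_abs x1, sqrz_ge_abs y1, sqrz_ge_abs x2, sqrz_ge_abs y2).
have := (sqrz_ge0 (x1 + x2 + y2), sqrz_ge0 (y1 + y2 - x2)).
have : 1 <= (x1 + x2) * (x1 + x2) + (y1 + y2) * (y1 + y2).
  by have [? ?] := (sqrz_ge_abs (x1 + x2), sqrz_ge_abs (y1 + y2)); lia.
have := (absz_ge0 x1, absz_ge0 y1, absz_ge0 x2, absz_ge0 y2).
rewrite !PoszD; move: (`|x1|%N%:Z) (`|y1|%N%:Z) (`|x2|%N%:Z) (`|y2|%N%:Z) n1 => a1 a2 a3 a4.
move: (x1 * x1) (y1 * y1) (x2 * x2) (y2 * y2) ((x1 + x2) * _) ((y1 + y2) * _) => s1 s2 s3 s4 s5 s6.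
move: (_ * _) (_ * _) => s7 s8 n1 [[[g1 g2] g3] g4] h1 [h3 h4] [[[h5 h6] h7] h8].
split; first by split; lia.
by split; lia.
Qed.

Lemma theta01_near W d : H2 W -> 0 < d -> d <= 1 / 2 -> log_near W d ->
  nm (th false true false false W - mono W 0 (1 / 2) (1 / 2) (1 / 2) * 4)
  <= nm (mono W 0 (1 / 2) (1 / 2) (1 / 2)) * (8192 * d).
Proof.
move=> HW d0 d12 near.
have := leading_terms W d false true _ _ 0 (1 / 2) (1 / 2) (1 / 2)
  (fun n => n.1.1 * n.1.1 + n.1.2 * n.1.2)
  (fun n => n.2.1 * n.2.1 + n.2.1 + (n.2.2 * n.2.2 + n.2.2))
  (fun n => (n.1.1 + n.2.1) * (n.1.1 + n.2.1) + (n.1.1 + n.2.1)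
            + ((n.1.2 + n.2.2) * (n.1.2 + n.2.2) + (n.1.2 + n.2.2)))
  (fun n => n.1.1 * n.1.1 + n.1.2 * n.1.2
            + ((n.1.1 + n.2.1 + n.2.2 + 1) * (n.1.1 + n.2.1 + n.2.2 + 1)
               + (n.1.2 + n.2.2 - n.2.1) * (n.1.2 + n.2.2 - n.2.1)) - 1)
  [:: ((0, 0), (0, 0)); ((0, 0), (0, -1)); ((0, 0), (-1, 0)); ((0, 0), (-1, -1))]
  d0 d12 near _ (theta_has_sum _ _ false false W HW).
rewrite !big_cons big_nil /= !mul0r sgnz0.
have -> : 1 + (1 + (1 + (1 + 0))) = 4 :> C R by ring.
apply => //.
- by move=> n; rewrite nm_sgnz.
- move=> [[x1 y1] [x2 y2]] /=; rewrite /shift2R /=.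
  by split; rewrite !(intrD, intrN, intrM); field.
- by move=> n; rewrite !inE => /or4P[] /eqP ->.
move=> [[x1 y1] [x2 y2]]; rewrite !inE !xpair_eqE => n0; right; rewrite /norm1 /=.
have {}n0 : x1 != 0 \/ y1 != 0 \/ (x2 != 0 /\ x2 != -1) \/ (y2 != 0 /\ y2 != -1).
  by lia.
have n1 : 1 <= x1 * x1 + y1 * y1 + (x2 * x2 + x2 + (y2 * y2 + y2)).
  have [[[? ?] ?] ?] := (sqrz_ge0 x1, sqrz_ge0 y1, sqrz_add_ge0 x2, sqrz_add_ge0 y2).
  by case: n0 => [/sqrz_ge1|[/sqrz_ge1|[[/sqrz_add_ge2 h /h]|[/sqrz_add_ge2 h /h]]]]; lia.
(* The sum of the four squares is odd, because squares preserve parity, and is therefore at least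
   1. *)
have h0 : 0 <= x1 * x1 + y1 * y1 + ((x1 + x2 + y2 + 1) * (x1 + x2 + y2 + 1)
               + (y1 + y2 - x2) * (y1 + y2 - x2)) - 1.
  have [? ?] := (sqrz_ge0 x1, sqrz_ge0 y1).
  have [? ?] := (sqrz_ge0 (x1 + x2 + y2 + 1), sqrz_ge0 (y1 + y2 - x2)).
  have [[k1 K1] [k2 K2]] := (sqrz_parity x1, sqrz_parity y1).
  have [[k3 K3] [k4 K4]] := (sqrz_parity (x1 + x2 + y2 + 1), sqrz_parity (y1 + y2 - x2)).
  by rewrite K1 K2 K3 K4; lia.
have := (sqrz_ge_abs x1, sqrz_ge_abs y1, sqrz_add_ge_abs x2, sqrz_add_ge_abs y2).
have := (sqrz_add_ge0 x2, sqrz_add_ge0 y2, sqrz_add_ge0 (x1 + x2), sqrz_add_ge0 (y1 + y2)).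
rewrite !PoszD; move: (absz_ge0 x1) (absz_ge0 y1).
move: (`|x1|%N%:Z) (`|y1|%N%:Z) (`|x2|%N%:Z) (`|y2|%N%:Z) => a1 a2 a3 a4.
move: (x1 * x1) (y1 * y1) (x2 * x2) (y2 * y2) ((x1 + x2) * _) ((y1 + y2) * _)
  ((x1 + x2 + y2 + 1) * _) ((y1 + y2 - x2) * _) n1 h0
  => s1 s2 s3 s4 s5 s6 s7 s8 n1 h0 g1 g2 [[[h1 h2] h3] h4] [[[h5 h6] h7] h8].
split; first by split; lia.
by split; lia.
Qed.

Lemma theta10_near W d : H2 W -> 0 < d -> d <= 1 / 2 -> log_near W d ->
  nm (th true false false false W - mono W (1 / 2) 0 (1 / 2) (1 / 2) * 4)
  <= nm (mono W (1 / 2) 0 (1 / 2) (1 / 2)) * (8192 * d).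
Proof.
move=> HW d0 d12 near.
have := leading_terms W d true false _ _ (1 / 2) 0 (1 / 2) (1 / 2)
  (fun n => n.1.1 * n.1.1 + n.1.1 + (n.1.2 * n.1.2 + n.1.2))
  (fun n => n.2.1 * n.2.1 + n.2.2 * n.2.2)
  (fun n => (n.1.1 + n.2.1) * (n.1.1 + n.2.1) + (n.1.1 + n.2.1)
            + ((n.1.2 + n.2.2) * (n.1.2 + n.2.2) + (n.1.2 + n.2.2)))
  (fun n => n.1.1 * n.1.1 + n.1.1 + (n.1.2 * n.1.2 + n.1.2)
            + ((n.1.1 + n.2.1 + n.2.2) * (n.1.1 + n.2.1 + n.2.2) + (n.1.1 + n.2.1 + n.2.2)
            + ((n.1.2 + n.2.2 - n.2.1) * (n.1.2 + n.2.2 - n.2.1) + (n.1.2 + n.2.2 - n.2.1))))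
  [:: ((0, 0), (0, 0)); ((0, -1), (0, 0)); ((-1, 0), (0, 0)); ((-1, -1), (0, 0))]
  d0 d12 near _ (theta_has_sum _ _ false false W HW).
rewrite !big_cons big_nil /= !mul0r sgnz0.
have -> : 1 + (1 + (1 + (1 + 0))) = 4 :> C R by ring.
apply => //.
- by move=> n; rewrite nm_sgnz.
- move=> [[x1 y1] [x2 y2]] /=; rewrite /shift2R /=.
  by split; rewrite !(intrD, intrN, intrM); field.
- by move=> n; rewrite !inE => /or4P[] /eqP ->.
move=> [[x1 y1] [x2 y2]]; rewrite !inE !xpair_eqE => n0; right; rewrite /norm1 /=.
have {}n0 : x2 != 0 \/ y2 != 0 \/ (x1 != 0 /\ x1 != -1) \/ (y1 != 0 /\ y1 != -1).
  by lia.
have n1 : 1 <= x2 * x2 + y2 * y2 + (x1 * x1 + x1 + (y1 * y1 + y1)).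
  have [[[? ?] ?] ?] := (sqrz_ge0 x2, sqrz_ge0 y2, sqrz_add_ge0 x1, sqrz_add_ge0 y1).
  by case: n0 => [/sqrz_ge1|[/sqrz_ge1|[[/sqrz_add_ge2 h /h]|[/sqrz_add_ge2 h /h]]]]; lia.
have := (sqrz_ge_abs x2, sqrz_ge_abs y2, sqrz_add_ge_abs x1, sqrz_add_ge_abs y1).
have := (sqrz_add_ge0 x1, sqrz_add_ge0 y1, sqrz_add_ge0 (x1 + x2), sqrz_add_ge0 (y1 + y2)).
have := (sqrz_add_ge0 (x1 + x2 + y2), sqrz_add_ge0 (y1 + y2 - x2)).
rewrite !PoszD; move: (absz_ge0 x2) (absz_ge0 y2).
move: (`|x1|%N%:Z) (`|y1|%N%:Z) (`|x2|%N%:Z) (`|y2|%N%:Z) => a1 a2 a3 a4.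
move: (x1 * x1) (y1 * y1) (x2 * x2) (y2 * y2) ((x1 + x2) * _) ((y1 + y2) * _)
  ((x1 + x2 + y2) * _) ((y1 + y2 - x2) * _) n1
  => s1 s2 s3 s4 s5 s6 s7 s8 n1 g1 g2 [g3 g4] [[[h1 h2] h3] h4] [[[h5 h6] h7] h8].
split; first by split; lia.
by split; lia.
Qed.

(** The leading vectors satisfy v1 + v2 = 0 and have even coordinate sums, so [Theta 1] and
    [Theta 2] have the same leading term. *)
Lemma theta11_near W d (b : bool) : H2 W -> 0 < d -> d <= 1 / 2 -> log_near W d ->
  nm (th true true b b W - mono W (1 / 2) (1 / 2) 0 (1 / 2) * 4)
  <= nm (mono W (1 / 2) (1 / 2) 0 (1 / 2)) * (8192 * d).
Proof.
move=> HW d0 d12 near.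
have := leading_terms W d true true _ _ (1 / 2) (1 / 2) 0 (1 / 2)
  (fun n => n.1.1 * n.1.1 + n.1.1 + (n.1.2 * n.1.2 + n.1.2))
  (fun n => n.2.1 * n.2.1 + n.2.1 + (n.2.2 * n.2.2 + n.2.2))
  (fun n => (n.1.1 + n.2.1 + 1) * (n.1.1 + n.2.1 + 1)
            + (n.1.2 + n.2.2 + 1) * (n.1.2 + n.2.2 + 1))
  (fun n => n.1.1 * n.1.1 + n.1.1 + (n.1.2 * n.1.2 + n.1.2)
            + ((n.1.1 + n.2.1 + n.2.2 + 1) * (n.1.1 + n.2.1 + n.2.2 + 1) + (n.1.1 + n.2.1 + n.2.2 + 1)
            + ((n.1.2 + n.2.2 - n.2.1) * (n.1.2 + n.2.2 - n.2.1) + (n.1.2 + n.2.2 - n.2.1))))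
  [:: ((0, 0), (-1, -1)); ((0, -1), (-1, 0)); ((-1, 0), (0, -1)); ((-1, -1), (0, 0))]
  d0 d12 near _ (theta_has_sum _ _ b b W HW).
have sg (k : int) : (k %% 2)%Z = 0 -> sgnz k = 1 :> C R.
  by move=> k2; rewrite (sgnz_eq k 0) ?subr0 // sgnz0.
rewrite !big_cons big_nil /= !sg; try by case: (b).
have -> : 1 + (1 + (1 + (1 + 0))) = 4 :> C R by ring.
apply => //.
- by move=> n; rewrite nm_sgnz.
- move=> [[x1 y1] [x2 y2]] /=; rewrite /shift2R /=.
  by split; rewrite !(intrD, intrN, intrM); field.
- by move=> n; rewrite !inE => /or4P[] /eqP ->.
move=> [[x1 y1] [x2 y2]]; rewrite !inE !xpair_eqE => n0; right; rewrite /norm1 /=.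
have {}n0 : (x1 + x2 + 1 != 0) \/ (y1 + y2 + 1 != 0) \/ (x1 != 0 /\ x1 != -1) \/ (y1 != 0 /\ y1 != -1).
  by lia.
have n1 : 1 <= (x1 + x2 + 1) * (x1 + x2 + 1) + (y1 + y2 + 1) * (y1 + y2 + 1)
               + (x1 * x1 + x1 + (y1 * y1 + y1)).
  have [[[? ?] ?] ?] := (sqrz_ge0 (x1 + x2 + 1), sqrz_ge0 (y1 + y2 + 1), sqrz_add_ge0 x1, sqrz_add_ge0 y1).
  by case: n0 => [/sqrz_ge1|[/sqrz_ge1|[[/sqrz_add_ge2 h /h]|[/sqrz_add_ge2 h /h]]]]; lia.
have := (sqrz_add_ge_abs x2, sqrz_add_ge_abs y2, sqrz_add_ge_abs x1, sqrz_add_ge_abs y1).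
have := (sqrz_add_ge0 x1, sqrz_add_ge0 y1, sqrz_add_ge0 x2, sqrz_add_ge0 y2).
have := (sqrz_add_ge0 (x1 + x2 + y2 + 1), sqrz_add_ge0 (y1 + y2 - x2)).
have := (sqrz_ge0 (x1 + x2 + 1), sqrz_ge0 (y1 + y2 + 1)).
rewrite !PoszD; move: (`|x1|%N%:Z) (`|y1|%N%:Z) (`|x2|%N%:Z) (`|y2|%N%:Z) => a1 a2 a3 a4.
move: (x1 * x1) (y1 * y1) (x2 * x2) (y2 * y2) ((x1 + x2 + 1) * _) ((y1 + y2 + 1) * _)
  ((x1 + x2 + y2 + 1) * _) ((y1 + y2 - x2) * _) n1
  => s1 s2 s3 s4 s5 s6 s7 s8 n1 [g1 g2] [g3 g4] [[[h1 h2] h3] h4] [[[h5 h6] h7] h8].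
split; first by split; lia.
by split; lia.
Qed.

(** Of the eight odd indices with coordinates in {0, -1}, the fourth exponent is minimal on only
    four; these are the leading ones, and their monomial has one factor [x3] more than in
    [theta11_near]. *)
Lemma theta11_odd_part W d : H2 W -> 0 < d -> d <= 1 / 2 -> log_near W d ->
  nm ((th true true false false W - th true true true true W) / 2
      - mono W (1 / 2) (1 / 2) 1 (1 / 2) * 4)
  <= nm (mono W (1 / 2) (1 / 2) 1 (1 / 2)) * (8192 * d).
Proof.
move=> HW d0 d12 near.
have fl : has_sum (fun n : Z4 => gauss_term W (shift2 n.1.1 true) (shift2 n.1.2 true)
   (shift2 n.2.1 true) (shift2 n.2.2 true)
   * ((1 - sgnz (n.1.1 + n.1.2 + n.2.1 + n.2.2)) / 2))
  ((th true true false false W - th true true true true W) / 2).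
  rewrite mulrC -[_ - _]/(_ + - _) -mulN1r.
  apply: eq_has_sum (has_sumZ _ _ _ 2^-1 (has_sumD _ _ _ _ _
    (theta_has_sum true true false false W HW)
    (has_sumZ _ _ _ (-1) (theta_has_sum true true true true W HW)))) => n.
  rewrite /theta_summand !mul0r !mul1r addr0 sgnz0 addrA; ring.
have := leading_terms W d true true _ _ (1 / 2) (1 / 2) 1 (1 / 2)
  (fun n => n.1.1 * n.1.1 + n.1.1 + (n.1.2 * n.1.2 + n.1.2))
  (fun n => n.2.1 * n.2.1 + n.2.1 + (n.2.2 * n.2.2 + n.2.2))
  (fun n => (n.1.1 + n.2.1 + 1) * (n.1.1 + n.2.1 + 1)
            + (n.1.2 + n.2.2 + 1) * (n.1.2 + n.2.2 + 1) - 1)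
  (fun n => n.1.1 * n.1.1 + n.1.1 + (n.1.2 * n.1.2 + n.1.2)
            + ((n.1.1 + n.2.1 + n.2.2 + 1) * (n.1.1 + n.2.1 + n.2.2 + 1) + (n.1.1 + n.2.1 + n.2.2 + 1)
            + ((n.1.2 + n.2.2 - n.2.1) * (n.1.2 + n.2.2 - n.2.1) + (n.1.2 + n.2.2 - n.2.1))))
  [:: ((0, 0), (0, -1)); ((0, -1), (-1, -1)); ((-1, 0), (0, 0)); ((-1, -1), (-1, 0))]
  d0 d12 near _ fl.
have sg0 (k : int) : (k %% 2)%Z = 0 -> (1 - sgnz k) / 2 = 0 :> C R.
  by move=> k2; rewrite (sgnz_eq k 0) ?subr0 // sgnz0 subrr mul0r.
have sg1 (k : int) : ((k - 1) %% 2)%Z = 0 -> (1 - sgnz k) / 2 = 1 :> C R.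
  by move=> k2; rewrite (sgnz_eq k 1) // /sgnz expr1; field.
rewrite !big_cons big_nil /= !sg1 //.
have -> : 1 + (1 + (1 + (1 + 0))) = 4 :> C R by ring.
apply => //.
- move=> n; rewrite nmM nmV nm_nat ler_pdivrMr //.
  by apply: le_trans (nmB _ _) _; rewrite nm1 nm_sgnz; lra.
- move=> [[x1 y1] [x2 y2]] /=; rewrite /shift2R /=.
  by split; rewrite !(intrD, intrN, intrM); field.
- by move=> n; rewrite !inE => /or4P[] /eqP ->.
move=> [[x1 y1] [x2 y2]]; rewrite !inE !xpair_eqE => n0; rewrite /norm1 /=.
have [ev|od] : ((x1 + y1 + x2 + y2) %% 2)%Z = 0 \/ ((x1 + y1 + x2 + y2) %% 2)%Z = 1.
- by lia.
- by left; exact: sg0.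
right.
have {}n0 : (x1 != 0 /\ x1 != -1) \/ (y1 != 0 /\ y1 != -1) \/
  (x2 != 0 /\ x2 != -1) \/ (y2 != 0 /\ y2 != -1) \/
  (x1 + x2 + y2 + 1 != 0 /\ x1 + x2 + y2 + 1 != -1) \/
  (y1 + y2 - x2 != 0 /\ y1 + y2 - x2 != -1).
  by lia.
have := (sqrz_add_ge_abs x2, sqrz_add_ge_abs y2, sqrz_add_ge_abs x1, sqrz_add_ge_abs y1).
have := (sqrz_add_ge0 x1, sqrz_add_ge0 y1, sqrz_add_ge0 x2, sqrz_add_ge0 y2).
have := (sqrz_add_ge0 (x1 + x2 + y2 + 1), sqrz_add_ge0 (y1 + y2 - x2)).
have n1 : 2 <= (x1 + x2 + y2 + 1) * (x1 + x2 + y2 + 1) + (x1 + x2 + y2 + 1)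
  + ((y1 + y2 - x2) * (y1 + y2 - x2) + (y1 + y2 - x2))
  + (x1 * x1 + x1 + (y1 * y1 + y1) + (x2 * x2 + x2 + (y2 * y2 + y2))).
  have [[[? ?] ?] ?] := (sqrz_add_ge0 x1, sqrz_add_ge0 y1, sqrz_add_ge0 x2, sqrz_add_ge0 y2).
  have [? ?] := (sqrz_add_ge0 (x1 + x2 + y2 + 1), sqrz_add_ge0 (y1 + y2 - x2)).
  by case: n0 => [|[|[|[|[|]]]]] [/sqrz_add_ge2 h /h]; lia.
have : 1 <= (x1 + x2 + 1) * (x1 + x2 + 1) + (y1 + y2 + 1) * (y1 + y2 + 1).
  by have [? ?] := (sqrz_ge_abs (x1 + x2 + 1), sqrz_ge_abs (y1 + y2 + 1)); lia.
rewrite !PoszD; move: (`|x1|%N%:Z) (`|y1|%N%:Z) (`|x2|%N%:Z) (`|y2|%N%:Z) => a1 a2 a3 a4.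
move: (x1 * x1) (y1 * y1) (x2 * x2) (y2 * y2) ((x1 + x2 + 1) * _) ((y1 + y2 + 1) * _)
  ((x1 + x2 + y2 + 1) * _) ((y1 + y2 - x2) * _) n1
  => s1 s2 s3 s4 s5 s6 s7 s8 n1 g1 [g3 g4] [[[h1 h2] h3] h4] [[[h5 h6] h7] h8].
split; first by split; lia.
by split; lia.
Qed.

End ThetaExpansions.

(** * Relative errors: numbers close to 1 *)

Section NearOne.
Context {R : realType}.
Implicit Types (x y z : C R) (a b : R).

Definition near1 a z : Prop := nm (z - 1) <= a.

Lemma near1_ge0 a z : near1 a z -> 0 <= a.
Proof. exact: le_trans (nm_ge0 _). Qed.

Lemma near1W a b z : near1 a z -> a <= b -> near1 b z.
Proof. exact: le_trans. Qed.

Lemma near1_nm a z : near1 a z -> 1 - a <= nm z /\ nm z <= 1 + a.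
Proof.
rewrite /near1 => h; split.
  have := nmB z (z - 1); rewrite opprB subrKC nm1; lra.
by have := nmD (z - 1) 1; rewrite subrK nm1; lra.
Qed.

Lemma near1_neq0 a z : near1 a z -> a < 1 -> z != 0.
Proof. by move=> /near1_nm[h _] a1; rewrite -nm_gt0; lra. Qed.

Lemma near1M a b x y : near1 a x -> near1 b y -> near1 (a + b + a * b) (x * y).
Proof.
move=> hx hy; have a0 := near1_ge0 _ _ hx; have b0 := near1_ge0 _ _ hy.
rewrite /near1.
have -> : x * y - 1 = (x - 1) * (y - 1) + (x - 1) + (y - 1) by ring.
have h1 := nmD ((x - 1) * (y - 1) + (x - 1)) (y - 1).
have h2 := nmD ((x - 1) * (y - 1)) (x - 1); rewrite nmM in h2.
have h3 : nm (x - 1) * nm (y - 1) <= a * b by rewrite ler_pM ?nm_ge0.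
by rewrite /near1 in hx hy; lra.
Qed.

Lemma near1D a b x y : near1 a x -> nm y <= b -> near1 (a + b) (x + y).
Proof.
rewrite /near1 => hx hy; rewrite addrAC.
by apply: le_trans (nmD _ _) _; lra.
Qed.

Lemma near1_mean a b x y : near1 a x -> near1 b y -> near1 ((a + b) / 2) ((x + y) / 2).
Proof.
rewrite /near1 => hx hy.
have -> : (x + y) / 2 - 1 = ((x - 1) + (y - 1)) / 2 by field.
by rewrite nmM nmV nm_nat ler_pM2r //; apply: le_trans (nmD _ _) _; lra.
Qed.

Lemma near1_small a z x c : near1 a z -> nm x <= c -> nm (x * z) <= c * (1 + a).
Proof.
move=> hz hx; have [_ h] := near1_nm _ _ hz.
by rewrite nmM ler_pM ?nm_ge0.
Qed.

Lemma near1_quotient (v m : C R) (e : R) : m != 0 -> nm (v - m * 4) <= nm m * e ->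
  near1 e (v / (4 * m)).
Proof.
move=> m0 h; have m1 : 0 < nm m by rewrite nm_gt0.
have e0 : 0 <= e by rewrite -(pmulr_rge0 _ m1); exact: le_trans (nm_ge0 _) h.
rewrite /near1.
have -> : v / (4 * m) - 1 = (v - m * 4) / (4 * m) by field.
rewrite nmM nmV nmM nm_nat ler_pdivrMr ?mulr_gt0 //.
by apply: le_trans h _; nra.
Qed.

(* Of the two square roots of a number close to 1, the one in the right
   half-plane is close to 1. *)
Lemma near1_sqrt a z : near1 a (z ^+ 2) -> 0 < complex.Re z -> near1 a z.
Proof.
rewrite /near1 => h z0; apply: le_trans h.
have -> : z ^+ 2 - 1 = (z - 1) * (z + 1) by ring.
rewrite nmM ler_peMr ?nm_ge0 //.
have := nm_Re (z + 1).
have -> : complex.Re (z + 1) = complex.Re z + 1 by case: (z).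
rewrite ger0_norm; lra.
Qed.

End NearOne.

(** * Asymptotics of the theta squares and of the form S *)

Section Asymptotics.
Context {R : realType}.
Implicit Types (W : 'M[C R]_2) (d : R) (t : nat -> C R).

Definition X1 W : C R := q1 W / q3 W.
Definition X2 W : C R := q2 W / q3 W.
Definition X3 W : C R := q4 W.
Definition X4 W : C R := q3 W / q4 W.

Definition Sform t : C R := t 2%N * t 6%N - t 1%N * t 8%N - t 3%N * t 5%N.

Lemma mono_neq0 W e1 e2 e3 e4 : mono W e1 e2 e3 e4 != 0.
Proof. exact: cexp_neq0. Qed.

Lemma log_near_nm W d : log_near W d ->
  [/\ nm (X1 W) <= d, nm (X2 W) <= d, nm (X3 W) <= d & nm (X4 W) <= d].
Proof.
move=> /near_o1E; rewrite /near_o1 !lt_nm => -[h1 h2 h3 h4].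
by split; rewrite ltW.
Qed.

Definition asymptotic t (x1 x2 x3 x4 : C R) (e : R) : Prop :=
  exists v1 v3 v5 v7 v8 s : C R,
  [/\ [/\ near1 (3 * e) v1, near1 (3 * e) v3, near1 (3 * e) v5,
          near1 (3 * e) v7 & near1 (3 * e) v8] /\ near1 (10 * e) s,
      t 1%N = 16 * (x1 * x2 * x4) * v1,
      t 3%N = 16 * (x1 * x3 * x4) * v3,
      t 5%N = 16 * (x2 * x3 * x4) * v5
    & [/\ t 7%N = v7, t 8%N = v8 & Sform t = 64 * (x1 * x2 * x3 * x4) * s]].

(** The first two products in S form a difference of squares. Its small factor
    [th 2 * th 6 - th 1 * th 8] equals [th 2 * (th 6 - th 8) + (th 2 - th 1) * th 8], and both
    differences are divisible by [x3] with control. *)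
Lemma asymptotic_of_thetas (th : nat -> C R) (m1 m3 m5 x1 x2 x3 x4 : C R) (e : R) :
  e <= 1 / 1000 -> m1 != 0 -> m3 != 0 -> m5 != 0 -> x3 != 0 ->
  m1 ^+ 2 = x1 * x2 * x4 -> m3 ^+ 2 = x1 * x3 * x4 -> m5 ^+ 2 = x2 * x3 * x4 ->
  nm x3 <= e -> nm x4 <= e ->
  near1 e (th 6%N) -> near1 e (th 7%N) -> near1 e (th 8%N) ->
  near1 e (th 1%N / (4 * m1)) -> near1 e (th 2%N / (4 * m1)) ->
  near1 e (th 3%N / (4 * m3)) -> near1 e (th 5%N / (4 * m5)) ->
  nm ((th 6%N - th 8%N) / 2) <= nm x3 * e ->
  near1 e ((th 2%N - th 1%N) / 2 / (4 * (m1 * x3))) ->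
  asymptotic (fun k => th k ^+ 2) x1 x2 x3 x4 e.
Proof.
move=> e1 m10 m30 m50 x30 m1E m3E m5E x3e x4e n6 n7 n8 n1 n2 n3 n5 nO nP.
have e0 := near1_ge0 _ _ n6.
set u1 := th 1%N / _ in n1; set u2 := th 2%N / _ in n2; set u3 := th 3%N / _ in n3.
set u5 := th 5%N / _ in n5; set uP := (_ - _) / 2 / _ in nP.
pose o := (th 6%N - th 8%N) / 2 / x3.
have oe : nm o <= e.
  by rewrite nmM nmV ler_pdivrMr ?nm_gt0 // [e * _]mulrC.
have sq (u : C R) : near1 e u -> near1 (3 * e) (u ^+ 2).
  by move=> h; rewrite expr2; apply: near1W (near1M _ _ _ _ h h) _; nra.
have t1E : th 1%N = 4 * m1 * u1 by rewrite /u1; field.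
have t2E : th 2%N = 4 * m1 * u2 by rewrite /u2; field.
have t3E : th 3%N = 4 * m3 * u3 by rewrite /u3; field.
have t5E : th 5%N = 4 * m5 * u5 by rewrite /u5; field.
have t6E : th 6%N = th 8%N + 2 * x3 * o by rewrite /o; field.
have PE : th 2%N = th 1%N + 2 * (4 * m1 * x3 * uP).
  by rewrite /uP; field; rewrite m10 x30.
(* The quotient of S by [64 * (x1 * x2 * x3 * x4)]: only [uP * th 8] and the mean in the second
   factor are close to 1; the product of [t 3] and [t 5] contributes the smaller last term. *)
pose s := (u2 * o + uP * th 8%N) * ((u2 * th 6%N + u1 * th 8%N) / 2)
          - 4 * x3 * x4 * (u3 ^+ 2 * u5 ^+ 2).
exists (u1 ^+ 2), (u3 ^+ 2), (u5 ^+ 2), (th 7%N ^+ 2), (th 8%N ^+ 2), s.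
have ns : near1 (10 * e) s.
  have hA : near1 (5 * e) (uP * th 8%N + u2 * o).
    apply: near1W (near1D _ _ _ _ (near1M _ _ _ _ nP n8) (_ : _ <= 2 * e)) _; last by nra.
    by rewrite mulrC; apply: le_trans (near1_small _ _ _ _ n2 oe) _; nra.
  have hB : near1 (3 * e) ((u2 * th 6%N + u1 * th 8%N) / 2).
    by apply: near1W (near1_mean _ _ _ _ (near1M _ _ _ _ n2 n6) (near1M _ _ _ _ n1 n8)) _; nra.
  have h35 := near1M _ _ _ _ (sq _ n3) (sq _ n5).
  have hC : nm (- (4 * x3 * x4 * (u3 ^+ 2 * u5 ^+ 2))) <= e.
    have n34 : nm (4 * x3 * x4) <= 4 * e * e.
      rewrite !nmM nm_nat; apply: ler_pM; rewrite ?mulr_ge0 ?nm_ge0 //.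
      by rewrite ler_pM2l.
    rewrite nmN; apply: le_trans (near1_small _ _ _ _ h35 n34) _; nra.
  rewrite /s [u2 * o + _]addrC.
  by apply: near1W (near1D _ _ _ _ (near1M _ _ _ _ hA hB) hC) _; nra.
split => //.
- by split => //; split; apply: sq.
- by rewrite t1E -m1E; ring.
- by rewrite t3E -m3E; ring.
- by rewrite t5E -m5E; ring.
split => //; rewrite /Sform.
have -> : th 2%N ^+ 2 * th 6%N ^+ 2 - th 1%N ^+ 2 * th 8%N ^+ 2 - th 3%N ^+ 2 * th 5%N ^+ 2
  = (th 2%N * th 6%N - th 1%N * th 8%N) * (th 2%N * th 6%N + th 1%N * th 8%N)
    - th 3%N ^+ 2 * th 5%N ^+ 2 by ring.
have -> : th 2%N * th 6%N - th 1%N * th 8%N = 8 * m1 * x3 * (u2 * o + uP * th 8%N).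
  by rewrite t6E mulrDr {1}PE t2E; ring.
have -> : th 2%N * th 6%N + th 1%N * th 8%N = 8 * m1 * ((u2 * th 6%N + u1 * th 8%N) / 2).
  by rewrite t2E t1E; field.
have -> : th 3%N ^+ 2 * th 5%N ^+ 2 = 256 * (x1 * x3 * x4) * (x2 * x3 * x4) * (u3 ^+ 2 * u5 ^+ 2).
  by rewrite t3E t5E -m3E -m5E; ring.
rewrite /s.
have -> : 64 * (x1 * x2 * x3 * x4) = 64 * (x1 * x2 * x4) * x3 by ring.
by rewrite -m1E; ring: m1E.
Qed.

Lemma theta_asymptotic W d : H2 W -> 0 < d -> 8192 * d <= 1 / 1000 ->
  log_near W d ->
  asymptotic (fun k => Theta k W ^+ 2) (X1 W) (X2 W) (X3 W) (X4 W) (8192 * d).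
Proof.
move=> HW d0 d1 near.
have d12 : d <= 1 / 2 by lra.
have [_ _ x3d x4d] := log_near_nm _ _ near.
have hh : 1 / 2 + 1 / 2 = 1 :> R by field.
apply: (asymptotic_of_thetas (fun k => Theta k W) (mono W (1 / 2) (1 / 2) 0 (1 / 2))
  (mono W (1 / 2) 0 (1 / 2) (1 / 2)) (mono W 0 (1 / 2) (1 / 2) (1 / 2))).
- by [].
- exact: mono_neq0.
- exact: mono_neq0.
- exact: mono_neq0.
- by rewrite /X3 q4E; exact: mono_neq0.
- by rewrite /X1 /X2 /X4 q1E q2E q34E expr2 -!monoD !hh !addr0 !add0r.
- by rewrite /X1 /X3 /X4 q1E q34E q4E expr2 -!monoD !hh !addr0 !add0r.
- by rewrite /X2 /X3 /X4 q2E q34E q4E expr2 -!monoD !hh !addr0 !add0r.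
- by apply: le_trans x3d _; lra.
- by apply: le_trans x4d _; lra.
- exact: (theta00_near W d false false HW d0 d12 near).
- exact: (theta00_near W d false true HW d0 d12 near).
- exact: (theta00_near W d true true HW d0 d12 near).
- exact: (near1_quotient _ _ _ (mono_neq0 _ _ _ _ _) (theta11_near W d true HW d0 d12 near)).
- exact: (near1_quotient _ _ _ (mono_neq0 _ _ _ _ _) (theta11_near W d false HW d0 d12 near)).
- exact: (near1_quotient _ _ _ (mono_neq0 _ _ _ _ _) (theta10_near W d HW d0 d12 near)).
- exact: (near1_quotient _ _ _ (mono_neq0 _ _ _ _ _) (theta01_near W d HW d0 d12 near)).
- by rewrite /X3 q4E; exact: (theta00_odd_part W d HW d0 d12 near).
- rewrite /X3 q4E -monoD !addr0 add0r.
  exact: (near1_quotient _ _ _ (mono_neq0 _ _ _ _ _) (theta11_odd_part W d HW d0 d12 near)).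
Qed.

End Asymptotics.

(** * The sign of the weight four form *)

Section SignOfT.
Context {R : realType}.
Implicit Types (W : 'M[C R]_2) (d : R) (t : nat -> C R).

Lemma disc_Sform t : theta_relations t ->
  disc t = Sform t ^+ 2 - 4 * (t 1%N * t 3%N * t 5%N * t 8%N).
Proof.
move=> [t5 t10 t1 t2 t8].
by rewrite /disc /lin /Sform t10 t2 t1 t8 t5; ring.
Qed.

(** Relative to S^2, the correction [4 * (t 1 * t 3 * t 5 * t 8)] carries an extra factor
    [4 * x4]. *)
Lemma tTheta_sqr_near t T x1 x2 x3 x4 e : theta_relations t -> T ^+ 2 = disc t ->
  asymptotic t x1 x2 x3 x4 e -> e <= 1 / 1000 -> nm x4 <= e ->
  x1 * x2 * x3 * x4 != 0 ->
  near1 (30 * e) ((T / (64 * (x1 * x2 * x3 * x4))) ^+ 2).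
Proof.
move=> Ht Tsq [v1 [v3 [v5 [v7 [v8 [s]]]]]].
move=> [[[n1 n3 n5 n7 n8] ns] t1E t3E t5E [t7E t8E SE]] e1 x4e nz.
have e0 : 0 <= e := le_trans (nm_ge0 _) x4e.
move: nz; rewrite !mulf_eq0 !negb_or => /andP[/andP[/andP[x10 x20] x30] x40].
rewrite expr_div_n Tsq (disc_Sform _ Ht) SE t1E t3E t5E t8E.
have -> : ((64 * (x1 * x2 * x3 * x4) * s) ^+ 2 -
    4 * (16 * (x1 * x2 * x4) * v1 * (16 * (x1 * x3 * x4) * v3)
      * (16 * (x2 * x3 * x4) * v5) * v8)) / (64 * (x1 * x2 * x3 * x4)) ^+ 2
  = s * s + - (4 * x4 * (v1 * v3 * (v5 * v8))).
  by field; rewrite ?x10 ?x20 ?x30 ?x40.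
have h13 := near1M _ _ _ _ n1 n3; have h58 := near1M _ _ _ _ n5 n8.
have h := near1M _ _ _ _ h13 h58.
have n4 : nm (4 * x4) <= 4 * e by rewrite nmM nm_nat ler_pM2l.
apply: near1W (near1D _ _ _ _ (near1M _ _ _ _ ns ns) (_ : _ <= 8 * e)) _; last by nra.
by rewrite nmN; apply: le_trans (near1_small _ _ _ _ h n4) _; nra.
Qed.

(** Only [w11] and [w22] move, so [q3] and [q4] are constant along the path, as the limit clause for
    the weight four form requires. *)
Definition lift_path W (s : R) : 'M[C R]_2 := W + s%:C%C *: 'i%:M.

Lemma lift_path_offdiag W s : w12 (lift_path W s) = w12 W /\ w21 (lift_path W s) = w21 W.
Proof.
by rewrite /w12 /w21 /lift_path !mxE /= !mulr0n !mulr0 !addr0.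
Qed.

Lemma lift_path_diag W s : w11 (lift_path W s) = w11 W + s%:C%C * 'i /\
  w22 (lift_path W s) = w22 W + s%:C%C * 'i.
Proof. by rewrite /w11 /w22 /lift_path !mxE /= !mulr1n. Qed.

Lemma H2_lift_path W s : H2 W -> 0 <= s -> H2 (lift_path W s).
Proof.
move=> HW s0 v v0.
have sr : (s%:C%C : C R)^* = s%:C%C by apply/CrealP/complex_realP; exists s.
have si : (s%:C%C * 'i : C R)^* = - (s%:C%C * 'i).
  by rewrite rmorphM /= [s%:C%C^*]sr conjCi mulrN.
have i2 : 'i * 'i = -1 :> C R by rewrite -expr2 sqrCi.
have iV : (2 * 'i)^-1 = - 'i / 2 :> C R by have := neq0Ci (C R) => i0; field: i2.
have -> : (2 * 'i)^-1 *: (lift_path W s - adj (lift_path W s))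
        = (2 * 'i)^-1 *: (W - adj W) + (s%:C%C)%:M.
  apply/matrixP => i j; rewrite /lift_path /adj !mxE iV eq_sym.
  case: (j == i); rewrite !(mulr1n, mulr0n) ?mulr0 ?addr0 //.

  rewrite rmorphD /= [(s%:C%C * 'i)^*]si.
  by field: i2.
rewrite mulmxDr mulmxDl mxE ltr_wpDr ?HW //.
rewrite mul_mx_scalar -scalemxAl mxE mulr_ge0 ?ler0c // /adj hermitian_dot2.
by rewrite addr_ge0 // mulrC mul_conjC_ge0.
Qed.

Lemma log_near_lift_path W s d : 0 <= s -> log_near W d -> log_near (lift_path W s) d.
Proof.
move=> s0 [h1 h2 h3 h4]; rewrite /log_near /log1 /log2 /log3 /log4 /alpha /beta.
have [-> ->] := lift_path_offdiag W s; have [-> ->] := lift_path_diag W s.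
have shift (z a : C R) : complex.Re (cpi R * 'i * (z + s%:C%C * 'i - a))
    <= complex.Re (cpi R * 'i * (z - a)).
  rewrite !Re_pi_i lerN2 ler_pM2l ?pi_gt0 //.
  by case: z a => [? ?] [? ?] /=; lra.
split => //.
- by apply: le_lt_trans h1; rewrite ler_expR; exact: shift.
- by apply: le_lt_trans h2; rewrite ler_expR; exact: shift.
Qed.

(** Equal to [64 q1 q2 / q3]. The Fourier term fixing the sign of the form is [Mform] times
    [(1 - q3 / q4) (1 - q3 q4)]. *)
Definition Mform W : C R := 64 * (X1 W * X2 W * X3 W * X4 W).

Lemma X_neq0 W : [/\ X1 W != 0, X2 W != 0, X3 W != 0 & X4 W != 0].
Proof.
by rewrite /X1 /X2 /X3 /X4 q1E q2E q34E q4E; split; exact: mono_neq0.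
Qed.

Lemma Mform_mono W : Mform W = 64 * mono W 1 1 1 1.
Proof.
rewrite /Mform; congr (_ * _).
rewrite /X1 /X2 /X3 /X4 q1E q2E q34E q4E.
by rewrite -monoD -monoD -monoD !addr0 !add0r.
Qed.

Lemma Mform_lift_path W s :
  Mform (lift_path W s) = Mform W * (expR (- (2 * pi * s)))%:C%C.
Proof.
rewrite !Mform_mono -mulrA; congr (_ * _); rewrite /mono !mul1r.
have -> : (expR (- (2 * pi * s)))%:C%C = cexp ((- (2 * pi * s))%:C%C) :> C R.
  by rewrite /cexp /= cos0 sin0 mulr1.
rewrite -[RHS]cexpD; congr cexp; rewrite /log1 /log2 /log3 /log4 /alpha /beta.
have [-> ->] := lift_path_offdiag W s; have [-> ->] := lift_path_diag W s.
rewrite /cpi !(rmorphN, rmorphM, rmorph_nat) /=.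
have i2 : 'i * 'i = -1 :> C R by rewrite -expr2 sqrCi.
by ring: i2.
Qed.

Lemma continuous_real_complex : continuous (fun s : R => s%:C%C : C R).
Proof.
have FF (s : R) : Filter (nbhs s) by exact: nbhs_filter.
move=> s; apply: (proj2 (@cvgrPdist_lt _ (C R) _ _ (FF s) (fun s : R => s%:C%C : C R) _)).
move=> e /gt0_C[-> e0]; exists (complex.Re e); first by case: e e0.
move=> r /= h; rewrite lt_nm.
by rewrite -(rmorphB (real_complex R)) nm_real.
Qed.

Lemma continuous_Re : continuous (fun z : C R => complex.Re z : R).
Proof.
have FF (z : C R) : Filter (nbhs z) by exact: nbhs_filter.
move=> z; apply: (proj2 (@cvgrPdist_lt _ R _ _ (FF z) (fun z : C R => complex.Re z) _)).
move=> e e0; have e0' : 0 < e%:C%C :> C R by rewrite ltcR.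
exists (e%:C%C) => // y /=; rewrite lt_nm; apply: le_lt_trans.
have -> : complex.Re z - complex.Re y = complex.Re (z - y) by case: z y => [? ?] [? ?].
exact: nm_Re.
Qed.

Lemma Re_tTheta_path_continuous (T : 'M[C R]_2 -> C R) W (m : C R) s :
  differentiable T (lift_path W s) ->
  {for s, continuous (fun r : R => complex.Re (m * T (lift_path W r)))}.
Proof.
move=> /differentiable_continuous Tc.
have pathc : {for s, continuous (lift_path W)}.
  apply: cvgD; first exact: cvg_cst.
  by apply: cvgZr_tmp; exact: continuous_real_complex.
have mT : {for s, continuous (fun r : R => m * T (lift_path W r) : C R)}.
  apply: cvgM; first exact: cvg_cst.
  exact: (continuous_comp pathc Tc).
exact: (continuous_comp mT (@continuous_Re _)).
Qed.

(** The square of a purely imaginary number is at most 0, at distance at least 1 from 1. *)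
Lemma near1_sqr_Re (z : C R) : near1 (1 / 4) (z ^+ 2) -> complex.Re z != 0.
Proof.
move=> h; apply/eqP => z0.
have := le_trans (nm_Re _) h; rewrite expr2.
case: z z0 {h} => a b /= ->; rewrite mul0r sub0r; rewrite ler_norml => /andP[].
by have := sqr_ge0 b; rewrite expr2; lra.
Qed.

Lemma mul3_small (a b : R) : 0 <= a -> 0 <= b -> a <= 1 / 100 -> b <= 1 / 100 ->
  a * a * b <= 1 / 100.
Proof. by move=> *; nra. Qed.

Lemma tTheta_near (T : 'M[C R]_2 -> C R) W d : is_tTheta T -> H2 W -> 0 < d ->
  8192 * d <= 1 / 1000 -> log_near W d ->
  near1 (30 * (8192 * d)) (T W / Mform W).
Proof.
move=> HT HW d0 d1 near.
have d2 : d <= 1 / 100 by lra.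
have d3 : d <= 8192 * d by lra.
have M0 V : Mform V != 0 by rewrite Mform_mono mulf_neq0 ?mono_neq0.
have sq V : H2 V -> log_near V d -> near1 (30 * (8192 * d)) ((T V / Mform V) ^+ 2).
  move=> HV nV; have [_ _ _ x4] := log_near_nm _ _ nV.
  apply: (tTheta_sqr_near _ _ _ _ _ _ _ (theta_square_relations V HV)
    (tTheta_sqr T V HT HV) (theta_asymptotic V d HV d0 d1 nV) d1) => //.
    exact: le_trans x4 d3.
  have [n1 n2 n3 n4] := X_neq0 V.
  exact: (mulf_neq0 (mulf_neq0 (mulf_neq0 n1 n2) n3) n4).
apply: near1_sqrt; first exact: sq.
(* Dividing by the fixed value [Mform W] makes continuity immediate and changes the real part of
   [T / Mform] along the path only by a positive factor. *)
pose g s := complex.Re ((Mform W)^-1 * T (lift_path W s)).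
have gE s : g s = expR (- (2 * pi * s))
    * complex.Re (T (lift_path W s) / Mform (lift_path W s)).
  have scale (a : R) (z : C R) : a * complex.Re z = complex.Re (a%:C%C * z).
    by case: z => ? ? /=; rewrite mul0r subr0.
  rewrite scale Mform_lift_path invfM /g; congr complex.Re.
  have e0 : (expR (- (2 * pi * s)))%:C%C != 0 :> C R.
    by rewrite -nm_gt0 nm_real normr_gt0 gt_eqF ?expR_gt0.
  by field; rewrite e0 M0.
have path0 : lift_path W 0 = W by rewrite /lift_path scale0r addr0.
have g0E : g 0 = complex.Re (T W / Mform W).
  by rewrite /g path0 mulrC.
rewrite -g0E.
have gn0 s : 0 <= s -> g s != 0.
  move=> s0; rewrite gE; apply: mulf_neq0; first by rewrite gt_eqF ?expR_gt0.
  apply: near1_sqr_Re; apply: near1W (sq _ _ _) _.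
  - exact: H2_lift_path.
  - exact: log_near_lift_path.
  - by lra.
have [b b0 gb] : exists2 b, 0 <= b & 0 < g b.
  have q30 : q3 W != 0 by exact: cexp_neq0.
  have q40 : q4 W != 0 by exact: cexp_neq0.
  have [_ _ _ lim] := HT.
  (* After multiplication by [q3 W / 64] this tolerance becomes 1/4, so [T / Mform] ends up within
     distance less than 1 of 1. *)
  have [|B HB] := lim (w12 W) (w21 W) `|64 / q3 W / 4|.
    by rewrite normr_gt0 !mulf_neq0 ?invr_neq0.
  pose b := Num.max 0 (Num.max (B - complex.Im (w11 W) + 1) (B - complex.Im (w22 W) + 1)).
  have [b0 b1 b2] : [/\ 0 <= b, B - complex.Im (w11 W) + 1 <= b
                       & B - complex.Im (w22 W) + 1 <= b].
    by rewrite /b !le_max !lexx ?orbT.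
  exists b => //; have [e12 e21] := lift_path_offdiag W b.
  have [d11 d22] := lift_path_diag W b.
  have Im_shift z : complex.Im (z + b%:C%C * 'i) = complex.Im z + b.
    by case: z => ? ? /=; ring.
  have := HB (lift_path W b) (H2_lift_path W b HW b0) e12 e21.
  rewrite d11 d22 !Im_shift; set V := lift_path W b in e12 e21 *.
  have -> : q3 V = q3 W by rewrite /q3 e12 e21.
  have -> : q4 V = q4 W by rewrite /q4 e12 e21.
  have c1 : B < complex.Im (w11 W) + b.
    by rewrite -ltrBlDl; apply: lt_le_trans b1; rewrite ltrDl.
  have c2 : B < complex.Im (w22 W) + b.
    by rewrite -ltrBlDl; apply: lt_le_trans b2; rewrite ltrDl.
  move=> /(_ c1 c2) HL.
  rewrite gE pmulr_rgt0 ?expR_gt0 //.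
  have q10 : q1 V != 0 by exact: cexp_neq0.
  have q20 : q2 V != 0 by exact: cexp_neq0.
  have MV : T V / Mform V = T V / (q1 V * q2 V) * (q3 W / 64).
    rewrite /Mform /X1 /X2 /X3 /X4 (_ : q3 V = q3 W); last by rewrite /q3 e12 e21.
    rewrite (_ : q4 V = q4 W); last by rewrite /q4 e12 e21.
    by field; rewrite q10 q20 q30 q40.
  have [_ _ x3 x4] := log_near_nm _ _ near.
  have n4 : near1 (1 / 100) (1 - X4 W).
    by rewrite /near1 addrAC subrr add0r nmN; exact: le_trans x4 d2.
  have n34 : near1 (1 / 100) (1 - q3 W * q4 W).
    rewrite /near1 addrAC subrr add0r nmN.
    have -> : q3 W * q4 W = X3 W * X3 W * X4 W by rewrite /X3 /X4; field.
    rewrite (nmM _ (X4 W)) nmM.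
    by apply: mul3_small; rewrite ?nm_ge0 // ?(le_trans x3) ?(le_trans x4).
  have n := near1M _ _ _ _ n4 n34.
  have : nm (T V / Mform V - (1 - X4 W) * (1 - q3 W * q4 W)) < 1 / 4.
    have -> : T V / Mform V - (1 - X4 W) * (1 - q3 W * q4 W)
       = (T V / (q1 V * q2 V) - -64 * (q3 W - q4 W) * ((1 - q3 W * q4 W) / (q3 W * q4 W)))
         * (q3 W / 64).
      by rewrite MV /X4; field; rewrite q10 q20 q30 q40.
    move: HL; rewrite !nmE ltcR => HL.
    have q3n : 0 < nm (q3 W / 64) by rewrite nm_gt0 mulf_neq0 ?invr_neq0.
    rewrite nmM; rewrite -(ltr_pM2r q3n) in HL.
    apply: lt_le_trans HL _; rewrite -nmM.
    have -> : 64 / q3 W / 4 * (q3 W / 64) = 4%:R^-1 by field.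
    by rewrite nmV nm_nat mul1r.
  move=> h; have := nm_Re (T V / Mform V - 1).
  have -> : complex.Re (T V / Mform V - 1) = complex.Re (T V / Mform V) - 1.
    by case: (_ / _).
  have := nmD (T V / Mform V - (1 - X4 W) * (1 - q3 W * q4 W))
              ((1 - X4 W) * (1 - q3 W * q4 W) - 1).
  rewrite addrA subrK ler_norml => h1 /andP[h2 _].
  rewrite /near1 in n; clear - h h1 h2 n; lra.
rewrite ltNge; apply/negP => g0; have gb' := ltW gb.
(* A change of sign between 0 and [b] would force a zero of [g], contradicting [gn0]. *)
have [c] : exists2 c, c \in `[0, b] & g c = 0.
  apply: IVT => //.
    apply: continuous_in_subspaceT => s; rewrite inE /= in_itv /= => /andP[s0 _].
    apply: Re_tTheta_path_continuous.
    by have [Td _ _ _] := HT; apply: Td; exact: H2_lift_path.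
  by rewrite ge_min le_max g0 gb' orbT.
by rewrite in_itv /= => /andP[c0 _] /eqP; apply/negP; exact: gn0.
Qed.

End SignOfT.

(** * The solution near the boundary point *)

Section NearO1.
Context {R : realType}.
Implicit Types (W : 'M[C R]_2) (d e : R) (t : nat -> C R) (x y z w : C R).

Lemma near1_div (a b : R) x y : near1 a (x * y) -> near1 b y -> b <= 1 / 2 ->
  near1 (2 * (a + b)) x.
Proof.
rewrite /near1 => h hy b2; have [y1 _] := near1_nm _ _ hy.
have := nmB (x * y - 1) (y - 1).
have -> : x * y - 1 - (y - 1) = (x - 1) * y by ring.
rewrite nmM; have := nm_ge0 (x - 1); move: (nm (x - 1)) (nm y) (nm (x * y - 1)) (nm (y - 1)) h hy y1.
by move=> *; nra.
Qed.

(** The factor 5 leaves room over 4 (1 + 1/10) / (1 - 1/10) = 44/9. *)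
Lemma near1_ratio (a b c : R) x y u : near1 a x -> near1 b y -> b <= 1 / 10 ->
  a <= 1 / 10 -> nm (4 * u * x / y) <= 5 * nm u.
Proof.
move=> hx hy b1 a1; have [_ x1] := near1_nm _ _ hx; have [y1 _] := near1_nm _ _ hy.
have y0 : 0 < nm y by lra.
rewrite !nmM nmV nm_nat ler_pdivrMr //.
have := nm_ge0 u; move: (nm u) (nm x) (nm y) x1 y1 => u' x' y' *; nra.
Qed.

Definition nonzero_denominators t w : Prop :=
  [/\ [/\ t 8%N != 0, w != 0 & w - t 7%N != 0], w - t 9%N != 0,
      t 4%N + t 9%N - w != 0 & t 3%N + t 9%N - w != 0].

Lemma near_solution t T x1 x2 x3 x4 w e : theta_relations t -> T ^+ 2 = disc t ->
  asymptotic t x1 x2 x3 x4 e -> e <= 1 / 1000 ->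
  x1 != 0 -> x2 != 0 -> x3 != 0 -> x4 != 0 ->
  nm x1 <= e -> nm x2 <= e -> nm x3 <= e -> nm x4 <= e ->
  near1 (30 * e) (T / (64 * (x1 * x2 * x3 * x4))) ->
  w = (2 * t 8%N)^-1 * (lin t - T) ->
  nonzero_denominators t w /\
  forall z1 z2 z3 z4, formulaz t w z1 z2 z3 z4 ->
    [/\ nm z1 <= 5 * nm x1, nm z2 <= 5 * nm x2, nm z3 <= 5 * nm x3
      & nm z4 <= 5 * nm x4].
Proof.
move=> Ht Tsq [v1 [v3 [v5 [v7 [v8 [s]]]]]].
move=> [[[n1 n3 n5 n7 n8] ns] t1E t3E t5E [t7E t8E SE]] e1.
move=> x10 x20 x30 x40 x1e x2e x3e x4e nT wE.
have e0 : 0 <= e := le_trans (nm_ge0 _) x4e.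
have v80 : v8 != 0 by apply: (near1_neq0 _ _ n8); lra.
have t80 : t 8%N != 0 by rewrite t8E.
have cubic := root_cubic _ _ _ Ht Tsq t80 wE.
case: Ht => r5 r10 r1 r2 r8.
set D := t 3%N + t 9%N - w in cubic *; set E := t 4%N + t 9%N - w in cubic *.
set r := T / _ in nT.
have M0 : 64 * (x1 * x2 * x3 * x4) != 0 by rewrite !mulf_neq0.
have TE : T = 64 * (x1 * x2 * x3 * x4) * r by rewrite /r mulrC divfK.
pose dl := D / (64 * (x1 * x2 * x3 * x4)).
have DE : D = 64 * (x1 * x2 * x3 * x4) * dl by rewrite /dl mulrC divfK.
clearbody dl.
(* This is [2 * t 8 * D = Sform t + T] divided by [128 * (x1 * x2 * x3 * x4)]. As [s] and [r] are
   both close to 1, no cancellation occurs. *)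
have dlE : dl * v8 = (s + r) / 2.
  apply: (mulfI M0).
  have -> : 64 * (x1 * x2 * x3 * x4) * (dl * v8) = D * t 8%N by rewrite DE t8E; ring.
  have -> : 64 * (x1 * x2 * x3 * x4) * ((s + r) / 2) = (Sform t + T) / 2.
    by rewrite SE TE; field.
  rewrite /D wE /Sform /lin; apply: (mulfI (_ : 2 != 0)) => //.
  have -> : 2 * ((t 3%N + t 9%N - (2 * t 8%N)^-1 * (t 7%N * t 8%N - t 10%N * t 5%N + t 6%N * t 9%N - T)) * t 8%N)
    = 2 * (t 3%N + t 9%N) * t 8%N - (t 7%N * t 8%N - t 10%N * t 5%N + t 6%N * t 9%N - T).
    by field.
  by rewrite r10 r2 r1 r5 r8; field.
have ndl : near1 (46 * e) dl.
  have h : near1 (20 * e) (dl * v8).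
    by rewrite dlE; apply: near1W (near1_mean _ _ _ _ ns nT) _; lra.
  by apply: near1W (near1_div _ _ _ _ h n8 _) _; lra.
have phi (v x : C R) : near1 (3 * e) v -> nm x <= e -> near1 (8 * e) (v + 4 * x * dl).
  move=> nv xe; have n4 : nm (4 * x) <= 4 * e by rewrite nmM nm_nat ler_pM2l.
  apply: near1W (near1D _ _ _ _ nv (near1_small _ _ _ _ ndl n4)) _; nra.
have p5 : near1 (8 * e) (v5 + 4 * (- x1) * dl) by apply: phi; rewrite ?nmN.
have p3 : near1 (8 * e) (v3 + 4 * (- x2) * dl) by apply: phi; rewrite ?nmN.
have p1 := phi _ _ n1 x3e.
set f5 := v5 + _ in p5; set f3 := v3 + _ in p3; set f1 := v1 + _ in p1.
have FE : w - t 7%N = 16 * (x2 * x3 * x4) * f5.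
  have -> : w - t 7%N = t 5%N - D by rewrite r5 /D; ring.
  by rewrite t5E DE /f5; ring.
have GE : w - t 9%N = 16 * (x1 * x3 * x4) * f3.
  have -> : w - t 9%N = t 3%N - D by rewrite /D; ring.
  by rewrite t3E DE /f3; ring.
have AE : w - t 6%N = - (16 * (x1 * x2 * x4) * f1).
  have -> : w - t 6%N = - (t 1%N + D) by rewrite r1 /D; ring.
  by rewrite t1E DE /f1; ring.
have nw : near1 (4 * e) w.
  have -> : w = v7 + 16 * (x2 * x3 * x4) * f5 by rewrite -FE -t7E; ring.
  have hx : nm (16 * (x2 * x3 * x4)) <= 16 * (e * e * e).
    by rewrite nmM nm_nat ler_pM2l // !nmM !ler_pM ?mulr_ge0 ?nm_ge0.
  apply: near1W (near1D _ _ _ _ n7 (near1_small _ _ _ _ p5 hx)) _.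
  have e2 : e * e <= 1 / 1000 by nra.
  have e3 : e * e * e <= 1 / 1000 * e by rewrite ler_wpM2r.
  have e4 : 16 * (e * e * e) * (1 + 8 * e) <= 16 * (1 / 1000 * e) * 2.
    by apply: ler_pM; rewrite ?mulr_ge0 // ?ler_pM2l //; lra.
  by lra.
have w0 : w != 0 by apply: (near1_neq0 _ _ nw); lra.
have dl0 : dl != 0 by apply: (near1_neq0 _ _ ndl); lra.
have f10 : f1 != 0 by apply: (near1_neq0 _ _ p1); lra.
have f30 : f3 != 0 by apply: (near1_neq0 _ _ p3); lra.
have f50 : f5 != 0 by apply: (near1_neq0 _ _ p5); lra.
have D0 : D != 0 by rewrite DE mulf_neq0.
(* [E] is recovered by solving the cubic identity for it, since its size is of higher order than
   what the separate expansions show. *)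
have EE : E = - (64 * (x1 * x2 * x3 * x4) * x4 * (f1 * f3 * f5) / (w * dl)).
  apply: (mulfI (_ : w * D != 0)); first by rewrite mulf_neq0.
  rewrite cubic FE GE AE DE; field; by rewrite w0 dl0.
have F0 : w - t 7%N != 0 by rewrite FE !mulf_neq0.
have G0 : w - t 9%N != 0 by rewrite GE !mulf_neq0.
have wd0 : w * dl != 0 by rewrite mulf_neq0.
have fff0 : f1 * f3 * f5 != 0 by rewrite !mulf_neq0.
have E0 : E != 0.
  by rewrite EE oppr_eq0 mulf_neq0 ?invr_neq0 // mulf_neq0 // mulf_neq0.
split; first by [].
move=> z1 z2 z3 z4 [-> -> -> ->]; rewrite -/D -/E.
have -> : D / (w - t 7%N) = 4 * x1 * dl / f5.
  by rewrite DE FE; field; rewrite ?x20 ?x30 ?x40 ?f50.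
have -> : D / (w - t 9%N) = 4 * x2 * dl / f3.
  by rewrite DE GE; field; rewrite ?x10 ?x30 ?x40 ?f30.
have -> : (w - t 7%N) * (w - t 9%N) / (w * E) = 4 * (- x3) * dl / f1.
  rewrite FE GE EE; field.
  by rewrite ?x10 ?x20 ?x30 ?x40 ?f10 ?f30 ?f50 ?w0 ?dl0.
have -> : E / D = - x4 * (f1 * f3 * f5 / (w * dl ^+ 2)).
  by rewrite EE DE; field; rewrite ?x10 ?x20 ?x30 ?x40 ?w0 ?dl0.
split.
- by apply: (near1_ratio _ _ 0 _ _ _ ndl p5); lra.
- by apply: (near1_ratio _ _ 0 _ _ _ ndl p3); lra.
- by rewrite -(nmN x3); apply: (near1_ratio _ _ 0 _ _ _ ndl p1); lra.
rewrite nmM nmN mulrC ler_wpM2r ?nm_ge0 //.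
have [l1 u1] := near1_nm _ _ p1; have [l3 u3] := near1_nm _ _ p3.
have [l5 u5] := near1_nm _ _ p5; have [lw _] := near1_nm _ _ nw.
have [ld _] := near1_nm _ _ ndl.
rewrite nmM nmV !nmM.
have gw : 9 / 10 <= nm w by lra.
have gd : 9 / 10 <= nm dl by lra.
have g2 : 1 / 2 <= nm w * (nm dl * nm dl).
  have gdd : (9 / 10) * (9 / 10) <= nm dl * nm dl by apply: ler_pM => //; lra.
  have h : 9 / 10 * (9 / 10 * (9 / 10)) <= nm w * (nm dl * nm dl).
    by apply: ler_pM => //; lra.
  by lra.
rewrite ler_pdivrMr; last by lra.
have h13 : nm f1 * nm f3 <= 121 / 100.
  have -> : 121 / 100 = (11 / 10) * (11 / 10) :> R by field.
  by apply: ler_pM; rewrite ?nm_ge0 //; lra.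
have h135 : nm f1 * nm f3 * nm f5 <= (121 / 100) * (11 / 10).
  by apply: ler_pM; rewrite ?mulr_ge0 ?nm_ge0 //; lra.
by lra.
Qed.

(** Together with [master_disc] this gives T / S = +- Q / (2 P0 - Q), where P0 and Q tend to 1 for
    small z. *)
Lemma master_Sform t w z1 z2 z3 z4 : masterz t w z1 z2 z3 z4 ->
  Sform t = w ^+ 2 * (z1 * z2 * z3 * z4) * (2 * P0 z1 z2 z3 z4 - Qpoly z1 z2 z3 z4).
Proof.
move=> mz; have [[t3 _ _ _] [t5 t6 t8 _]] := masterz_values _ _ _ _ _ _ mz.
have [[_ t1 _ _ t2] _] := mz.
rewrite /Sform -t1 -t2 t3 t5 t6 t8 /P0 /P1 /P4 /P7 /P8 /P10 /Qpoly; ring.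
Qed.

Lemma small_P0_Qpoly z1 z2 z3 z4 :
  nm z1 <= 1 / 10 -> nm z2 <= 1 / 10 -> nm z3 <= 1 / 10 -> nm z4 <= 1 / 10 ->
  near1 (1 / 2) (P0 z1 z2 z3 z4) /\ near1 (1 / 2) (Qpoly z1 z2 z3 z4).
Proof.
move=> h1 h2 h3 h4.
have bnd (x y : C R) (a b : R) : nm x <= a -> nm y <= b -> nm (x * y) <= a * b.
  by move=> *; rewrite nmM ler_pM ?nm_ge0.
have bndD (x y : C R) (a b : R) : nm x <= a -> nm y <= b -> nm (x + y) <= a + b.
  by move=> *; apply: le_trans (nmD _ _) _; rewrite lerD.
have h12 := bnd _ _ _ _ h1 h2; have h13 := bnd _ _ _ _ h1 h3.
have h23 := bnd _ _ _ _ h2 h3; have h123 := bnd _ _ _ _ h12 h3.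
have hf := bnd _ _ _ _ h123 (bnd _ _ _ _ h4 h4).
split; rewrite /near1.
  have -> : P0 z1 z2 z3 z4 - 1 = - ((z1 * z2 + z1 * z3 + z2 * z3 + z1 * z2 * z3) * z4
      + z1 * z2 * z3 * (z4 * z4)) by rewrite /P0; ring.
  rewrite nmN.
  have := bndD _ _ _ _ (bnd _ _ _ _ (bndD _ _ _ _ (bndD _ _ _ _ (bndD _ _ _ _ h12 h13) h23) h123) h4) hf.
  by move=> h; apply: le_trans h _; lra.
have -> : Qpoly z1 z2 z3 z4 - 1 = z4 * (1 + z1 + z2 + z3) - z1 * z2 * z3 * (z4 * z4).
  by rewrite /Qpoly; ring.
have n1 : nm (1 : C R) <= 1 by rewrite nm1.
have hs := bnd _ _ _ _ h4 (bndD _ _ _ _ (bndD _ _ _ _ (bndD _ _ _ _ n1 h1) h2) h3).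
by apply: le_trans (nmB _ _) _; apply: le_trans (lerD hs hf) _; lra.
Qed.

(* A solution with small [z] belongs to the root [T], not to [- T]: it has
   [T / Sform t] close to 1. *)
Lemma small_solution_root t T x1 x2 x3 x4 w e z1 z2 z3 z4 :
  T ^+ 2 = disc t -> asymptotic t x1 x2 x3 x4 e -> e <= 1 / 1000 ->
  x1 * x2 * x3 * x4 != 0 ->
  near1 (30 * e) (T / (64 * (x1 * x2 * x3 * x4))) -> masterz t w z1 z2 z3 z4 ->
  nm z1 <= 1 / 10 -> nm z2 <= 1 / 10 -> nm z3 <= 1 / 10 -> nm z4 <= 1 / 10 ->
  T = w ^+ 2 * (z1 * z2 * z3 * z4) * Qpoly z1 z2 z3 z4.
Proof.
move=> Tsq [v1 [v3 [v5 [v7 [v8 [s [[_ ns] _ _ _ [_ _ SE]]]]]]]] e1 x0 nT mz h1 h2 h3 h4.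
have [nP nQ] := small_P0_Qpoly _ _ _ _ h1 h2 h3 h4.
have S2 := master_Sform _ _ _ _ _ _ mz.
have := Tsq; rewrite (master_disc _ _ _ _ _ _ mz) => /eqP.
rewrite eqf_sqr => /orP[/eqP //|/eqP TE].
have M0 : 64 * (x1 * x2 * x3 * x4) != 0 by rewrite mulf_neq0.
set M := 64 * _ in nT SE M0; set p := P0 _ _ _ _ in nP S2; set q := Qpoly _ _ _ _ in nQ S2 TE.
(* For the wrong sign, [s - T / M = k * p] is small while [p] has modulus at least 1/2, so [k] is
   small; but [s + T / M = k * (p - q)] is close to 2 and [p - q] has modulus at most 1. *)
pose k := 2 * (w ^+ 2 * (z1 * z2 * z3 * z4)) / M.
have sE : s = Sform t / M by rewrite SE mulrC mulKf.
have rE : s - T / M = k * p by rewrite sE S2 TE /k; field.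
have qE : s + T / M = k * (p - q) by rewrite sE S2 TE /k; field.
have [p1 _] := near1_nm _ _ nP.
have npq : nm (p - q) <= 1.
  have -> : p - q = (p - 1) - (q - 1) by ring.
  by apply: le_trans (nmB _ _) _; rewrite /near1 in nP nQ; lra.
have ls : nm (s - T / M) <= 40 * e.
  have -> : s - T / M = (s - 1) - (T / M - 1) by ring.
  by apply: le_trans (nmB _ _) _; rewrite /near1 in ns nT; lra.
have us : 2 - 40 * e <= nm (s + T / M).
  have -> : s + T / M = 2 + ((s - 1) + (T / M - 1)) by ring.
  have := nmBD 2 ((s - 1) + (T / M - 1)); have := nmD (s - 1) (T / M - 1).
  by rewrite nm_nat; rewrite /near1 in ns nT; lra.
exfalso; rewrite rE nmM in ls; rewrite qE nmM in us.
have := nm_ge0 k; move: (nm k) (nm p) (nm (p - q)) ls us p1 npq => k' p' pq' *.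
by have : k' <= 80 * e; nra.
Qed.

End NearO1.

(** * Existence and uniqueness near the boundary point *)

Section LocalUniqueness.
Context {R : realType}.
Implicit Types (W : 'M[C R]_2) (d e : R) (t : nat -> C R) (z w : C R).

Lemma asymptotic_neq0 t x1 x2 x3 x4 e : asymptotic t x1 x2 x3 x4 e ->
  e <= 1 / 1000 -> x1 != 0 -> x2 != 0 -> x3 != 0 -> x4 != 0 ->
  t 1%N != 0 /\ t 3%N != 0.
Proof.
move=> [v1 [v3 [v5 [v7 [v8 [s [[[n1 n3 _ _ _] _] -> -> _ _]]]]]]] e1 x10 x20 x30 x40.
have v10 : v1 != 0 by apply: (near1_neq0 _ _ n1); lra.
have v30 : v3 != 0 by apply: (near1_neq0 _ _ n3); lra.
by rewrite !mulf_neq0.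
Qed.

(** [P1] has the factors [z1], [z2], [z4], and [P7] has the factor [z3]. *)
Lemma master_neq0 t w z1 z2 z3 z4 : masterz t w z1 z2 z3 z4 ->
  t 1%N != 0 -> t 3%N != 0 ->
  [/\ z1 != 0, z2 != 0, z3 != 0, z4 != 0 & w != 0].
Proof.
move=> [[_ <- _ _ _] [_ <- _ _ _]]; rewrite /P1 /P7 !mulf_eq0 !negb_or oppr_eq0.
move=> /andP[/andP[/andP[/andP[? ?] _] ?] ?].
by move=> /andP[/andP[/andP[_ ?] _] _].
Qed.

Lemma local_part (T : 'M[C R]_2 -> C R) : is_tTheta T ->
  exists2 e0 : C R, 0 < e0 &
  forall e : C R, 0 < e -> e <= e0 ->
  exists2 d : C R, 0 < d &
  forall W : 'M[C R]_2, H2 W -> near_o1 d W ->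
    denominators_neq0 W (sol_omega0_sq W (T W)) /\
    forall z1 z2 z3 z4 omega0 : C R,
      (small e z1 z2 z3 z4 /\ master_equation W z1 z2 z3 z4 omega0) <->
      (omega0 ^+ 2 = sol_omega0_sq W (T W) /\
       is_solution_formula W (omega0 ^+ 2) z1 z2 z3 z4).
Proof.
(* 1/10 is the threshold of [small_P0_Qpoly]. *)
move=> HT; exists (1 / 10)%:C%C; first by rewrite ltcR; lra.
move=> eC /gt0_C[-> ]; rewrite lecR; move: (complex.Re eC) => e /= e0 e1.
(* The first bound validates the asymptotics; the second makes the bounds [5 * nm X] on the
   coordinates smaller than [e]. *)
pose d : R := Num.min (1 / 1000 / 8192) (e / 6).
have d0 : 0 < d by rewrite lt_min; apply/andP; split; lra.
have d1 : 8192 * d <= 1 / 1000.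
  have : d <= 1 / 1000 / 8192 by rewrite ge_min lexx.
  by lra.
have de : 5 * d < e.
  have : d <= e / 6 by rewrite ge_min lexx orbT.
  by lra.
have dd : d <= 8192 * d by lra.
exists d%:C%C; first by rewrite ltcR.
move=> W HW; rewrite near_o1E => near.
have rels := theta_square_relations W HW.
have Tsq := tTheta_sqr T W HT HW.
have as_t := theta_asymptotic W d HW d0 d1 near.
have nT := tTheta_near T W d HT HW d0 d1 near.
have [x10 x20 x30 x40] := X_neq0 W.
have [h1 h2 h3 h4] := log_near_nm _ _ near.
have [h1' h2' h3' h4'] := And4 (le_trans h1 dd) (le_trans h2 dd) (le_trans h3 dd) (le_trans h4 dd).
have [den small_z] := near_solution _ _ _ _ _ _ _ _ rels Tsq as_t d1 x10 x20 x30 x40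
  h1' h2' h3' h4' nT (erefl _).
have {}den : denominators_neq0 W (sol_omega0_sq W (T W)).
  case: den => -[t80 w0 F0] G0 E0 D0.
  have sq_neq0 (x : C R) : x ^+ 2 != 0 -> x != 0 by rewrite expf_eq0.
  exact: (And4 (And3 (sq_neq0 _ t80) w0 F0) G0 E0 D0).
split; first exact: den.
move=> z1 z2 z3 z4 omega0; split; last first.
  move=> [wE fz]; split; last by apply: (formula_part T) => //; rewrite wE.
  rewrite wE in fz; have [b1 b2 b3 b4] := small_z z1 z2 z3 z4 fz.
  have bound (z X : C R) : nm z <= 5 * nm X -> nm X <= d -> `|z| < e%:C%C.
    move=> zX Xd; rewrite lt_nm (le_lt_trans zX) // (le_lt_trans _ de) //.
    by rewrite ler_pM2l.
  split; [exact: bound b1 h1|exact: bound b2 h2|exact: bound b3 h3|exact: bound b4 h4].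
move=> [[s1 s2 s3 s4] mz].
have {}mz : masterz (fun k => Theta k W ^+ 2) (omega0 ^+ 2) z1 z2 z3 z4 := mz.
have sm (z : C R) : `|z| < e%:C%C -> nm z <= 1 / 10.
  by rewrite lt_nm => ?; rewrite ltW // (lt_le_trans _ e1).
have x0 := mulf_neq0 (mulf_neq0 (mulf_neq0 x10 x20) x30) x40.
have TE := small_solution_root _ _ _ _ _ _ _ _ _ _ _ _ Tsq as_t d1 x0 nT mz
  (sm _ s1) (sm _ s2) (sm _ s3) (sm _ s4).
have [t10 t30] := asymptotic_neq0 _ _ _ _ _ _ as_t d1 x10 x20 x30 x40.
have [z10 z20 z30 z40 w0] := master_neq0 _ _ _ _ _ _ mz t10 t30.
have [[Th8 _ _] _ _ _] := den.
have t80 : Theta 8 W ^+ 2 != 0 by rewrite expf_neq0.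
split; first exact: (master_root _ _ _ _ _ _ _ t80 mz TE).
exact: (master_formula _ _ _ _ _ _ z10 z20 z30 z40 w0 mz).
Qed.

End LocalUniqueness.

Theorem proposition5p9 (R : realType) (T : 'M[C R]_2 -> C R)
    (T_tTheta : is_tTheta T) :
  [/\ (* the formulas solve the master equation *)
      forall (W : 'M[C R]_2) (z1 z2 z3 z4 omega0 : C R), H2 W ->
        omega0 ^+ 2 = sol_omega0_sq W (T W) ->
        denominators_neq0 W (omega0 ^+ 2) ->
        is_solution_formula W (omega0 ^+ 2) z1 z2 z3 z4 ->
        master_equation W z1 z2 z3 z4 omega0,
      (* over all of H2 the solution is unique up to the sign of the square
         root T of T ^+ 2 *)
      forall (W : 'M[C R]_2) (z1 z2 z3 z4 omega0 : C R), H2 W ->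
        Theta 8 W != 0 -> z1 * z2 * z3 * z4 * omega0 != 0 ->
        master_equation W z1 z2 z3 z4 omega0 ->
        is_solution_formula W (omega0 ^+ 2) z1 z2 z3 z4 /\
        (omega0 ^+ 2 = sol_omega0_sq W (T W) \/
         omega0 ^+ 2 = sol_omega0_sq W (- T W))
    & (* around o1, where z1, ..., z4 are local coordinates, it is unique *)
      exists2 e0 : C R, 0 < e0 &
      forall e : C R, 0 < e -> e <= e0 ->
      exists2 d : C R, 0 < d &
      forall W : 'M[C R]_2, H2 W -> near_o1 d W ->
        denominators_neq0 W (sol_omega0_sq W (T W)) /\
        forall z1 z2 z3 z4 omega0 : C R,
          (small e z1 z2 z3 z4 /\ master_equation W z1 z2 z3 z4 omega0) <->
          (omega0 ^+ 2 = sol_omega0_sq W (T W) /\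
           is_solution_formula W (omega0 ^+ 2) z1 z2 z3 z4)].
Proof.
split.
- move=> W z1 z2 z3 z4 omega0 HW; exact: formula_part.
- move=> W z1 z2 z3 z4 omega0 HW; exact: unique_part.
- exact: local_part.
Qed.
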